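(* Let $p$ be an odd prime and let $G=\langle a,b\rangle$ be a GGS-group of FG-type defined over the $p$-adic tree. Then the following hold: (i) If $\ell(m)\le i<r(m)$ for some $m\ge 0$, then $|\gamma_i(G):\gamma_{i+1}(G)|=p^2$. Also $\gamma_i(G)=\langle x(i),y_{\ell(m)}(i)\rangle\,\gamma_{i+1}(G)=\langle x(i),y_{\ell(m)}(i)\rangle^G$. (ii) If $r(m)\le i<\ell(m+1)$ for some $m\ge 0$, then $|\gamma_i(G):\gamma_{i+1}(G)|=p$. Also $\gamma_i(G)=\langle x(i)\rangle\,\gamma_{i+1}(G)=\langle x(i)\rangle^G$. In particular, $G$ is a group of lower central width $2$.
   Context: $p$ is an odd prime and $\sigma=(1\ 2\ \ldots\ p)$. The $p$-adic tree $\mathcal T$ has as vertices the words over $X=\{1,\dots,p\}$, with $v$ joined to $vx$ ($x\in X$). $\mathrm{Aut}(\mathcal T)$ acts on the right; $fg$ means first $f$, then $g$. The section $f|_x$ ($x\in X$) is defined by $(xv)f=(xf)\,(v\,f|_x)$, and $\psi:\mathrm{Aut}(\mathcal T)\to \mathrm{Aut}(\mathcal T)\wr \mathrm{Sym}(p)$, $f\mapsto (f|_1,\dots,f|_p)\,\sigma(f)$, where $\sigma(f)$ is the permutation induced by $f$ on the first level, is a group isomorphism. Let $a$ be defined by $\psi(a)=(1,\dots,1)\sigma$ (of order $p$, so $a^e$ makes sense for $e\in\mathbb F_p$). For a non-zero vector $\mathbf e=(e_1,\dots,e_{p-1})\in\mathbb F_p^{p-1}$, let $b$ be the automorphism fixing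 the first level and defined recursively by $\psi(b)=(a^{e_1},\dots,a^{e_{p-1}},b)$. The GGS-group with defining vector $\mathbf e$ is $G=\langle a,b\rangle$. Put $\varepsilon=\sum_{i=1}^{p-1}e_i$ and $\delta=\sum_{i=1}^{p-1}ie_i$ in $\mathbb F_p$; $G$ is of FG-type if $\varepsilon\ne0$ and $\delta\ne 0$. Commutators: $[x,y]=x^{-1}y^{-1}xy$, left-normed. $\gamma_i(G)$ is the $i$th term of the lower central series ($\gamma_1(G)=G$), and $H^G$ is the normal closure of $H$ in $G$. Integer sequences: $\ell(0)=1$, $\ell(1)=p$, $\ell(m)=p(\ell(m-1)-1)-1$ for $m\ge2$; $r(0)=2$, $r(1)=p+1$, $r(m)=p(r(m-1)-1)-1$ for $m\ge 2$. Elements: $x(1)=b$ and $x(i)=[b,a^{\varepsilon}b,\overset{i-1}{\ldots},a^{\varepsilon}b]$ for $i\ge2$; $y_1(1)=a$ and $y_j(i)=[x(j-1),b,a^{\varepsilon}b,\overset{i-j}{\ldots},a^{\varepsilon}b]$ for $2\le j\le i$ (an overset $k$ means that the entry is repeated $k$ times). If all indices $|\gamma_i(G):\gamma_{i+1}(G)|$ are powers of $p$ and are bounded, the lower central width of the residually nilpotent group $G$ is $\max_{i\ge1}\log_p|\gamma_i(G):\gamma_{i+1}(G)|$. *)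

(* Defs.v *)
From HB Require Import structures.
From mathcomp Require Import all_boot all_order all_algebra.
From mathcomp Require Import boolp classical_sets cardinality.

Set Implicit Arguments.
Unset Strict Implicit.
Unset Printing Implicit Defensive.

Import GRing.Theory.
Local Open Scope classical_set_scope.
Local Open Scope group_scope.

(* Subgroups of a possibly infinite group, as classical sets. *)
Section Groups.
Variable T : groupType.
Implicit Types (A B H K G : set T) (n i w p : nat).

Definition is_subgroup H : Prop :=
  [/\ H 1, forall x y, H x -> H y -> H (x * y) & forall x, H x -> H x^-1].

Definition gen A : set T := smallest is_subgroup A.

Definition set_mul A B : set T := [set x * y | x in A & y in B].

Definition commutator_subgroup A B : set T :=
  gen [set [~ x, y] | x in A & y in B].

(* Indexed from 1; the value at 0 is a dummy, equal to G. *)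
Definition gamma G i : set T := iter i.-1 (fun H => commutator_subgroup H G) G.

Definition normal_closure H G : set T := gen [set x ^ g | x in H & g in G].

(* |H : K| = n, counting the left cosets h K with h in H. *)
Definition has_index H K n : Prop :=
  ([set [set h * k | k in K] | h in H] #= `I_n)%card.

Definition residually_nilpotent G : Prop :=
  \bigcap_(i in [set i | 0 < i]) gamma G i = [set 1].

(* The function n is log_p |gamma_i : gamma_(i+1)|; the last two clauses say
   that w is its maximum over i >= 1. *)
Definition has_lower_central_width p G w : Prop :=
  residually_nilpotent G /\
  exists n : nat -> nat,
    [/\ forall i, 0 < i -> has_index (gamma G i) (gamma G i.+1) (p ^ n i)%N,
        forall i, 0 < i -> n i <= w
      & exists2 i, 0 < i & n i = w].

(* [u, c, ..., c] with k entries c, left-normed. *)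
Definition comm_iter (u c : T) k : T := iter k (fun z => [~ z, c]) u.

End Groups.

Section Tree.
Variable p : nat.

(* The letter i + 1 of X = {1, ..., p} is the ordinal i of 'I_p. *)
Definition word : Type := seq 'I_p.
Implicit Types (u v : word) (x : 'I_p).

Definition child u v : Prop := exists x, v = rcons u x.

Definition adjacent u v : Prop := child u v \/ child v u.

Record taut : Type := TAut {
  act : word -> word;
  act_inv : word -> word;
  actK : cancel act act_inv;
  act_invK : cancel act_inv act;
  act_adj : forall u v, adjacent (act u) (act v) <-> adjacent u v }.

Lemma taut_ext (f g : taut) : act f =1 act g -> f = g.
Proof.
case: f g => [f f' fK f'K fa] [g g' gK g'K ga] /= /funext efg.
subst g.
have efg' : f' = g' by apply/funext => v; rewrite -{1}(g'K v) fK.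
subst g'.
by congr TAut; exact: Prop_irrelevance.
Qed.

HB.instance Definition _ := gen_eqMixin taut.
HB.instance Definition _ := gen_choiceMixin taut.

Definition taut_one : taut :=
  @TAut id id (fun=> erefl) (fun=> erefl) (fun _ _ => iff_refl _).

Lemma taut_inv_adj (f : taut) u v :
  adjacent (act_inv f u) (act_inv f v) <-> adjacent u v.
Proof. by rewrite -(act_adj f) !act_invK. Qed.

Definition taut_inv (f : taut) : taut :=
  TAut (act_invK f) (actK f) (taut_inv_adj f).

Lemma taut_mul_adj (f g : taut) u v :
  adjacent ((act g \o act f) u) ((act g \o act f) v) <-> adjacent u v.
Proof. by rewrite /= !act_adj. Qed.

(* Right action: f g is first f, then g. *)
Definition taut_mul (f g : taut) : taut :=
  TAut (can_comp (actK g) (actK f)) (can_comp (act_invK f) (act_invK g))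
       (taut_mul_adj f g).

Lemma taut_mulA : associative taut_mul.
Proof. by move=> f g h; apply: taut_ext. Qed.
Lemma taut_mul1 : left_id taut_one taut_mul.
Proof. by move=> f; apply: taut_ext. Qed.
Lemma taut_mulr1 : right_id taut_one taut_mul.
Proof. by move=> f; apply: taut_ext. Qed.
Lemma taut_mulV : left_inverse taut_one taut_inv taut_mul.
Proof. by move=> f; apply: taut_ext => v /=; rewrite act_invK. Qed.
Lemma taut_mulrV : right_inverse taut_one taut_inv taut_mul.
Proof. by move=> f; apply: taut_ext => v /=; rewrite actK. Qed.

HB.instance Definition _ := isGroup.Build taut
  taut_mulA taut_mul1 taut_mulr1 taut_mulV taut_mulrV.

Lemma adj_of_child (f g : word -> word) : cancel f g ->
    (forall u v, child u v -> child (f u) (f v)) ->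
    (forall u v, child u v -> child (g u) (g v)) ->
  forall u v, adjacent (f u) (f v) <-> adjacent u v.
Proof.
move=> fK fc gc u v; split=> -[] c.
- by left; rewrite -(fK u) -(fK v); exact: gc.
- by right; rewrite -(fK u) -(fK v); exact: gc.
- by left; exact: fc.
- by right; exact: fc.
Qed.

(* g is the section of f at the letter x. *)
Definition is_section (f : taut) x (g : taut) : Prop :=
  forall v, act f (x :: v) = act f [:: x] ++ act g v.

Definition map_head (s : 'I_p -> 'I_p) v : word :=
  if v is x :: v' then s x :: v' else [::].

Lemma map_headK s s' : cancel s s' -> cancel (map_head s) (map_head s').
Proof. by move=> sK [|x v] //=; rewrite sK. Qed.

Lemma map_head_child s u v : child u v -> child (map_head s u) (map_head s v).
Proof. by case=> x ->; case: u => [|y u]; [exists (s x)|exists x]. Qed.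

Definition ggs_a : taut :=
  TAut (map_headK (@ordSK p)) (map_headK (@ord_predK p))
    (adj_of_child (map_headK (@ordSK p)) (@map_head_child _) (@map_head_child _)).

Lemma ggs_a_head x : act ggs_a [:: x] = [:: ordS x].
Proof. by []. Qed.

Lemma ggs_a_section x : is_section ggs_a x 1.
Proof. by []. Qed.

(* The entry e_(i+1) of the defining vector is e 0 i. *)
Variable e : 'rV['F_p]_(p.-1).

(* For n = e this is the action of b, for which insub x = None exactly when x
   is the last letter; with ggs_a^-1 in place of ggs_a it is that of b^-1. *)
Fixpoint b_fun (a : taut) (v : word) : word :=
  if v is x :: v' then
    x :: (if insub (x : nat) is Some i then act (a ^+ e 0%R i) v'
          else b_fun a v')
  else [::].

Lemma b_funK a a' : a * a' = 1 -> a' * a = 1 -> cancel (b_fun a) (b_fun a').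
Proof.
move=> aa' a'a; elim=> [|x v IH] //=; congr cons.
case: (insub _) => [i|//].
rewrite -[LHS]/(act (a ^+ e 0%R i * a' ^+ e 0%R i) v).
by rewrite -expgMn ?aa' ?expg1n //; rewrite /commute aa' a'a.
Qed.

Definition preserves_child (f : word -> word) : Prop :=
  f [::] = [::] /\ forall u v, child u v -> child (f u) (f v).

Lemma preserves_childX (a : taut) n :
  preserves_child (act a) -> preserves_child (act (a ^+ n)).
Proof.
case=> a0 ac; elim: n => [|n [n0 nc]]; first by rewrite expg0.
rewrite expgS; split=> [|u v /ac /nc //].
by rewrite -[LHS]/(act (a ^+ n) (act a [::])) a0.
Qed.

Lemma b_fun_child a u v :
  preserves_child (act a) -> child u v -> child (b_fun a u) (b_fun a v).
Proof.
move=> ac [x ->]; elim: u => [|y u [z IH]] /=.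
  exists x; case: (insub _) => [i|//].
  by case: (preserves_childX (e 0%R i) ac) => ->.
case: (insub _) => [i|]; last by exists z; rewrite IH.
have [_ aXc] := preserves_childX (e 0%R i) ac.
have [|t ->] := aXc u (rcons u x); first by exists x.
by exists t.
Qed.

Lemma ggs_a_child : preserves_child (act ggs_a).
Proof. by split=> // u v; exact: map_head_child. Qed.

Lemma ggs_aV_child : preserves_child (act ggs_a^-1).
Proof. by split=> // u v; exact: map_head_child. Qed.

Definition ggs_b : taut :=
  TAut (b_funK (mulgV ggs_a) (mulVg ggs_a))
    (b_funK (mulVg ggs_a) (mulgV ggs_a))
    (adj_of_child (b_funK (mulgV ggs_a) (mulVg ggs_a))
      (fun u v => b_fun_child ggs_a_child)
      (fun u v => b_fun_child ggs_aV_child)).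

Lemma ggs_b_head x : act ggs_b [:: x] = [:: x].
Proof.
rewrite /=; case: (insub _) => [i|//].
by case: (preserves_childX (e 0%R i) ggs_a_child) => ->.
Qed.

Lemma ggs_b_section (i : 'I_p.-1) x :
  x = i :> nat -> is_section ggs_b x (ggs_a ^+ e 0%R i).
Proof. by move=> xi v; rewrite ggs_b_head /= xi valK. Qed.

Lemma ggs_b_section_last x : x = p.-1 :> nat -> is_section ggs_b x ggs_b.
Proof. by move=> xp v; rewrite ggs_b_head /= xp insubF ?ltnn. Qed.

Definition GGS : set taut := gen [set ggs_a; ggs_b].

Definition eps : 'F_p := (\sum_i e 0 i)%R.

Definition delta : 'F_p := (\sum_(i < p.-1) i.+1%:R * e 0 i)%R.

Definition FG_type : Prop := eps != 0%R /\ delta != 0%R.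

Definition ggs_c : taut := ggs_a ^+ eps * ggs_b.

Definition ggs_x (i : nat) : taut := comm_iter ggs_b ggs_c i.-1.

(* y_j(i) is used for j = i = 1 and for 2 <= j <= i only. *)
Definition ggs_y (j i : nat) : taut :=
  if j == 1%N then ggs_a
  else comm_iter [~ ggs_x j.-1, ggs_b] ggs_c (i - j).

End Tree.

Section Sequences.
Variable p : nat.

Fixpoint ell (m : nat) : nat :=
  match m with
  | 0 => 1
  | 1 => p
  | m'.+1 => p * (ell m' - 1) - 1
  end%N.

Fixpoint rseq (m : nat) : nat :=
  match m with
  | 0 => 2
  | 1 => p.+1
  | m'.+1 => p * (rseq m' - 1) - 1
  end%N.

End Sequences.

(* Main.v *)
Require Import Defs.
From HB Require Import structures.
From mathcomp Require Import all_boot all_order all_algebra.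
From mathcomp Require Import boolp classical_sets cardinality.
From mathcomp Require Import ring zify.

(* Let f(k) = p (k - 1) - 1, the recursion behind both integer sequences, let
   c = a^eps b, and let L_k be the set of elements fixing the first level all of
   whose sections lie in gamma_k(G).  As G is regular branch over gamma_2(G), for
   k >= 2 the quotient L_k / L_(k+1) consists of all functions from F_p (the
   letters) to gamma_k / gamma_(k+1); commutation with c acts on them as the
   difference operator of step eps, whose (p - 1)st power sends a function to the
   constant function equal to its sum, and for k >= 3 the sum is all that remains
   of L_k modulo gamma_(f(k) + 1).  Hence L_k <= gamma_f(k) and
   gamma_f(k+1) <= L_k, and the p factors gamma_i / gamma_(i+1) with
   f(k) <= i < f(k+1) all have the rank of gamma_k / gamma_(k+1).  When the rank
   jumps from 1 to 2 the new generator is a commutator with b of an element whose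
   sections depend on the letter affinely with non-zero slope; its independence
   comes from delta <> 0.  The blocks k = 1 and k = 2 are computed directly.
   Finally, every non-trivial normal subgroup of G contains some gamma_n, and a
   normal subgroup containing generators of gamma_i modulo gamma_(i+1) covers all
   later factors, hence contains gamma_i as soon as it contains some gamma_n. *)

Set Implicit Arguments.
Unset Strict Implicit.
Unset Printing Implicit Defensive.

Import GRing.Theory.
Local Open Scope classical_set_scope.
Local Open Scope ring_scope.
Local Open Scope group_scope.

(** * Lower central series *)

(** Modulo [gamma_2(G)] the sections of [b] multiply to [c]. Hence, if all sections of [g] are
    congruent to [u], those of [[g, c]] have the class of [[u, c]] as coordinate sum: commuting with
    [c] upstairs reproduces commuting with [c] downstairs, which is how the generators of one factor
    are carried over to a whole block. This scheme breaks down at [k = 2]: the sections of [x(p)]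
    are congruent to [c] itself and [[c, c] = 1], so [x(p + 1)] has coordinate sum 0 and has to be
    followed through its first moment, which is [- delta / eps]. The non-zero sum in [L_2] comes
    instead from [[x(p - 1), b]] and equals [- 2 delta / eps^2], which uses [delta <> 0] and the
    oddness of [p]. The argument is carried out in a type [T] whose elements have their sections
    again in [T], with letters in F_p: the lower central series is then that of the whole type, and
    rotations of the first level are translations. *)

Section LowerCentralSeries.
Variable T : groupType.
Implicit Types (H M A : set T) (g h x y z : T) (i j n : nat).

Lemma commMg x y z : [~ x * y, z] = [~ x, z] ^ y * [~ y, z].
Proof. by rewrite /commg /conjg !invgM !mulgA !mulgK. Qed.

Lemma commgM x y z : [~ x, y * z] = [~ x, z] * [~ x, y] ^ z.
Proof. by rewrite /commg /conjg !invgM !mulgA !mulgK. Qed.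

Lemma subg1 H : is_subgroup H -> H 1. Proof. by case. Qed.
Lemma subgM H g h : is_subgroup H -> H g -> H h -> H (g * h).
Proof. by case=> _ + _; apply. Qed.
Lemma subgV H g : is_subgroup H -> H g -> H g^-1.
Proof. by case=> _ _; apply. Qed.
Lemma subgX H g n : is_subgroup H -> H g -> H (g ^+ n).
Proof.
move=> sH Hg; elim: n => [|n IH]; first exact: subg1.
by rewrite expgS; exact: subgM.
Qed.
Lemma subgVE H g : is_subgroup H -> H g^-1 -> H g.
Proof. by move=> sH /(subgV sH); rewrite invgK. Qed.
Lemma subgMl H g h : is_subgroup H -> H g -> H (g * h) -> H h.
Proof. by move=> sH Hg Hgh; rewrite -(mulKg g h); apply: subgM => //; apply: subgV. Qed.
Lemma subgMr H g h : is_subgroup H -> H h -> H (g * h) -> H g.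
Proof. by move=> sH Hh Hgh; rewrite -(mulgK h g); apply: subgM => //; apply: subgV. Qed.
Lemma subg_prod H (I : Type) (r : seq I) (F : I -> T) :
  is_subgroup H -> (forall k, H (F k)) -> H (\prod_(i <- r) F i).
Proof.
by move=> sH HF; apply: big_ind => // [|? ?]; [exact: subg1|exact: subgM].
Qed.

Lemma gen_subgroup A : is_subgroup (gen A).
Proof.
split=> [H [[]]//|g h Ag Ah H HH|g Ag H HH].
  by apply: subgM; [case: HH|exact: Ag|exact: Ah].
by apply: subgV; [case: HH|exact: Ag].
Qed.

Lemma gen_sub A : A `<=` gen A.
Proof. by move=> g Ag H [_]; apply. Qed.

Lemma gen_min A H : is_subgroup H -> A `<=` H -> gen A `<=` H.
Proof. by move=> sH AH g; apply. Qed.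

Definition lcs n : set T := gamma [set: T] n.
Arguments lcs : simpl never.

Lemma lcs1 g : lcs 1 g. Proof. by []. Qed.
Lemma lcs0 g : lcs 0 g. Proof. by []. Qed.
Hint Resolve lcs0 lcs1 : core.

Lemma lcs_subgroup n : is_subgroup (lcs n).
Proof. by case: n => [|[|n]]; [split|split|exact: gen_subgroup]. Qed.
Hint Resolve lcs_subgroup : core.

Lemma lcs_comm n g h : lcs n g -> lcs n.+1 [~ g, h].
Proof. by case: n => [//|n] gg; apply: gen_sub; exists g => //; exists h. Qed.

Lemma lcs_min n H : is_subgroup H ->
  (forall g h, lcs n.+1 g -> H [~ g, h]) -> lcs n.+2 `<=` H.
Proof. by move=> sH HH; apply: gen_min => // _ [g gg [h _ <-]]; exact: HH. Qed.

Opaque lcs.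

Lemma lcs_leS n : lcs n.+1 `<=` lcs n.
Proof.
elim: n => [g|n IH]; first by move=> _; exact: lcs0.
case: n IH => [|n] IH; first by move=> g _; exact: lcs1.
apply: lcs_min => // g h /IH; exact: lcs_comm.
Qed.

Lemma lcs_le m n : (m <= n)%N -> lcs n `<=` lcs m.
Proof.
move=> mn; rewrite -(subnKC mn); elim: (_ - _)%N => [|k IH]; first by rewrite addn0.
by rewrite addnS => g /lcs_leS /IH.
Qed.

Lemma lcs_conj n g h : lcs n g -> lcs n (g ^ h).
Proof.
move=> gg; rewrite -(mulVKg g (g ^ h)) -commgEl; apply: subgM => //.
exact/lcs_leS/lcs_comm.
Qed.

Lemma lcs_commr n g h : lcs n g -> lcs n.+1 [~ h, g].
Proof. by move=> gg; rewrite -invgR; apply: subgV => //; exact: lcs_comm. Qed.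

Lemma lcs_iter n g c k : lcs n g -> lcs (n + k) (comm_iter g c k).
Proof.
move=> gg; elim: k => [|k IH]; first by rewrite addn0.
by rewrite addnS; exact: lcs_comm.
Qed.

Lemma lcsX n g k : lcs n g -> lcs n (g ^+ k). Proof. exact: subgX. Qed.
Lemma lcsM n g h : lcs n g -> lcs n h -> lcs n (g * h).
Proof. exact: (subgM (lcs_subgroup n)). Qed.
Lemma lcsV n g : lcs n g -> lcs n g^-1.
Proof. exact: (subgV (lcs_subgroup n)). Qed.
Lemma lcs_1 n : lcs n 1. Proof. exact: (subg1 (lcs_subgroup n)). Qed.
Hint Resolve lcs_1 : core.

Definition eqm n g h := lcs n (g^-1 * h).

Lemma eqm_refl n g : eqm n g g. Proof. by rewrite /eqm mulVg; exact: subg1. Qed.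
Hint Resolve eqm_refl : core.
Lemma eqm_sym n g h : eqm n g h -> eqm n h g.
Proof. by move=> /(subgV (lcs_subgroup n)); rewrite invgM invgK. Qed.
Lemma eqm_trans n g h k : eqm n g h -> eqm n h k -> eqm n g k.
Proof.
by move=> e1 e2; rewrite /eqm -(mulgK h (g^-1)) -mulgA; apply: subgM.
Qed.
Lemma eqmM n g h g' h' : eqm n g g' -> eqm n h h' -> eqm n (g * h) (g' * h').
Proof.
move=> e1 e2; rewrite /eqm.
have -> : (g * h)^-1 * (g' * h') = (g^-1 * g') ^ h * (h^-1 * h').
  by rewrite /conjg invgM !mulgA mulgK.
by apply: subgM => //; exact: lcs_conj.
Qed.
Lemma eqmMl n g h k : eqm n h k -> eqm n (g * h) (g * k).
Proof. by move=> ?; apply: eqmM. Qed.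
Lemma eqmMr n g h k : eqm n h k -> eqm n (h * g) (k * g).
Proof. by move=> ?; apply: eqmM. Qed.
Lemma eqmV n g h : eqm n g h -> eqm n g^-1 h^-1.
Proof.
move=> e; apply: eqm_sym; rewrite /eqm invgK.
have -> : h * g^-1 = (g^-1 * h) ^ g^-1 by rewrite /conjg invgK !mulgA mulgV mul1g.
exact: lcs_conj.
Qed.
Lemma eqm_mem n m g h : (m <= n)%N -> eqm n g h -> lcs m g -> lcs m h.
Proof.
move=> mn /(lcs_le mn) e gg; rewrite -(mulVKg g h); exact: subgM.
Qed.
Lemma eqm1 n g : eqm n 1 g <-> lcs n g.
Proof. by rewrite /eqm invg1 mul1g. Qed.
Lemma eqm_J n g h : lcs n g -> eqm n.+1 g (g ^ h).
Proof. by move=> gg; rewrite /eqm; exact: lcs_comm. Qed.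
Lemma eqm_C n g h : lcs n g -> eqm n.+1 (g * h) (h * g).
Proof.
by move=> gg; rewrite (conjgC g h); apply: eqmMl; apply/eqm_sym/eqm_J.
Qed.

Lemma eqm_commM n g g' h : lcs n g -> eqm n.+2 [~ g * g', h] ([~ g, h] * [~ g', h]).
Proof.
move=> gg; rewrite commMg; apply: eqmMr; apply: eqm_sym; apply: eqm_J.
exact: lcs_comm.
Qed.

Lemma eqm_commgM n g h h' : lcs n g -> eqm n.+2 [~ g, h * h'] ([~ g, h] * [~ g, h']).
Proof.
move=> gg; rewrite commgM.
have Lh : lcs n.+1 [~ g, h] by exact: lcs_comm.
apply: (@eqm_trans _ _ ([~ g, h'] * [~ g, h])).
  by apply: eqmMl; apply: eqm_sym; exact: eqm_J.
by apply: eqm_sym; exact: eqm_C.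
Qed.

Lemma eqm_commX n g h k : lcs n g -> eqm n.+2 [~ g ^+ k, h] ([~ g, h] ^+ k).
Proof.
move=> gg; elim: k => [|k IH]; first by rewrite !expg0 comm1g.
rewrite !expgS; apply: (eqm_trans (eqm_commM _ _ gg)); exact: eqmMl.
Qed.

Lemma eqm_commgX n g h k : lcs n g -> eqm n.+2 [~ g, h ^+ k] ([~ g, h] ^+ k).
Proof.
move=> gg; elim: k => [|k IH]; first by rewrite !expg0 commg1.
rewrite !expgS; apply: (eqm_trans (eqm_commgM _ _ gg)); exact: eqmMl.
Qed.

Lemma eqm_Xmul n g h k : lcs n g -> lcs n h ->
  eqm n.+1 ((g * h) ^+ k) (g ^+ k * h ^+ k).
Proof.
move=> gg hh; elim: k => [|k IH]; first by rewrite !expg0 mulg1.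
rewrite !expgS.
apply: (eqm_trans (eqmMl _ IH)); rewrite -!mulgA; apply: eqmMl; rewrite !mulgA.
by apply: eqmMr; exact: eqm_C.
Qed.

(** For [g] in [lcs n] the map taking [h] to [[~ g, h]] is a homomorphism modulo [lcs n.+2].
    Commutator conditions therefore need checking only on generators. *)
Lemma subgroup_commr n M g : is_subgroup M -> lcs n.+2 `<=` M -> lcs n g ->
  is_subgroup [set h | M [~ g, h]].
Proof.
move=> sM sub gg.
have K h h' : eqm n.+2 h h' -> M h' -> M h.
  move=> /eqm_sym e Mh; rewrite -(mulVKg h' h); apply: subgM => //; exact: sub.
split=> [|h h' /= Mh Mh'|h /= Mh]; first by rewrite /= commg1; exact: subg1.
  by apply: (K _ _ (eqm_commgM _ _ gg)); apply: subgM.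
apply: (K _ ([~ g, h]^-1)); last exact: subgV.
have := eqm_commgM h h^-1 gg; rewrite mulgV commg1.
move=> /(eqmMl [~ g, h]^-1); rewrite mulgA mulVg mul1g mulg1 => e.
by apply: eqm_sym.
Qed.

Lemma subgroup_comml n M : is_subgroup M -> lcs n.+2 `<=` M ->
  is_subgroup [set g | lcs n g /\ forall h, M [~ g, h]].
Proof.
move=> sM sub.
have K h h' : eqm n.+2 h h' -> M h' -> M h.
  move=> /eqm_sym e Mh; rewrite -(mulVKg h' h); apply: subgM => //; exact: sub.
split=> [|h h' /= [gh Mh] [gh' Mh']|h /= [gh Mh]].
- by split=> [|h]; rewrite ?comm1g; exact: subg1.
- split=> [|k]; first exact: subgM.
  by apply: (K _ _ (eqm_commM _ _ gh)); apply: subgM.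
split=> [|k]; first exact: subgV.
apply: (K _ ([~ h, k]^-1)); last exact: subgV.
have := eqm_commM h^-1 k gh; rewrite mulgV comm1g.
move=> /(eqmMl [~ h, k]^-1); rewrite mulgA mulVg mul1g mulg1 => e.
by apply: eqm_sym.
Qed.

(** Quantifying over the subgroups above [lcs n.+1] replaces quotient groups and applies directly to
    preimages under commutation. *)
Definition generates n (A : set T) := forall M, is_subgroup M ->
  lcs n.+1 `<=` M -> A `<=` M -> lcs n `<=` M.

Lemma generates_succ n A (b c : T) :
  (forall H, is_subgroup H -> H b -> H c -> forall g, H g) ->
  A `<=` lcs n -> generates n A -> (0 < n)%N ->
  forall M, is_subgroup M -> lcs n.+2 `<=` M ->
    (forall s, A s -> M [~ s, b] /\ M [~ s, c]) -> lcs n.+1 `<=` M.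
Proof.
case: n => // n genT AL gA _ M sM sub HM; apply: lcs_min => // g h gg.
have sM' := subgroup_comml sM sub.
have : lcs n.+1 `<=` [set g | lcs n.+1 g /\ forall h, M [~ g, h]]; last by move=> /(_ g gg) [].
apply: gA => //.
- by move=> x Lx; split=> [|y]; [exact: lcs_leS|apply: sub; exact: lcs_comm].
- move=> s As; split; first exact: AL.
  have [Mb Mc] := HM _ As => k.
  by apply: (genT _ (subgroup_commr sM sub (AL _ As))).
Qed.

(** Modulo [lcs 2] the group is abelian and generated by elements of order dividing [p]; the
    congruence between [[~ g, h] ^+ p] and [[~ g ^+ p, h]] carries this from one factor to the
    next. *)
Lemma lcs_exponent p n (a b : T) :
  (forall H, is_subgroup H -> H a -> H b -> forall g, H g) ->
  a ^+ p = 1 -> b ^+ p = 1 -> (0 < n)%N -> forall g, lcs n g -> lcs n.+1 (g ^+ p).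
Proof.
move=> genT ap bp.
have base : forall g, lcs 2 (g ^+ p).
  apply: genT; rewrite /= ?ap ?bp; [|exact: (subg1 (lcs_subgroup 2))..].
  split=> [|g h /= gp hp|g /= gp]; first by rewrite /= expg1n; exact: subg1.
    apply: (eqm_mem _ (eqm_sym (@eqm_Xmul 1 g h p (lcs1 g) (lcs1 h)))) => //.
    exact: (subgM (lcs_subgroup _)).
  by rewrite expVgn; exact: (subgV (lcs_subgroup 2)).
elim: n => // -[|n] IH _; first by move=> g _; exact: base.
have sM : is_subgroup [set g | lcs n.+2 g /\ lcs n.+3 (g ^+ p)].
  split=> [|g h /= [gg gp] [hh hp]|g /= [gg gp]].
  - by rewrite /= expg1n; split; exact: (subg1 (lcs_subgroup _)).
  - split; first exact: (subgM (lcs_subgroup _)).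
    by apply: (eqm_mem _ (eqm_sym (eqm_Xmul _ gg hh))) => //; exact: (subgM (lcs_subgroup _)).
  - by rewrite expVgn; split; exact: (subgV (lcs_subgroup _)).
move=> g gg; have [] // : [set g | lcs n.+2 g /\ lcs n.+3 (g ^+ p)] g.
apply: lcs_min gg => // {}g h gg; split; first exact: lcs_comm.
apply: (eqm_mem _ (eqm_commX _ _ gg)) => //; apply: lcs_comm; exact: IH.
Qed.

End LowerCentralSeries.

Opaque lcs.
#[global] Hint Resolve lcs0 lcs1 lcs_subgroup lcs_1 eqm_refl : core.
Local Arguments nat_of_ord : simpl never.

(** * Finite differences over the prime field *)

Section FiniteDifferences.
Local Open Scope ring_scope.
Variables (p : nat) (p_pr : prime p) (U : lmodType 'F_p).
Implicit Types (f : 'F_p -> U) (h l m : 'F_p).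

(** The sign follows [secR]: up to conjugation, the section of [[~ g, h]] at [l] is that of [g] at
    [l - chi h] divided by that of [g] at [l]. *)
Definition diff h f l := f (l - h) - f l.

Lemma sum_shift (W : nmodType) (F : 'F_p -> W) h : \sum_l F (l + h) = \sum_l F l.
Proof. by rewrite [RHS](reindex_inj (addIr h)). Qed.

Lemma sum_Fp (W : nmodType) (G : nat -> W) : \sum_(m : 'F_p) G m = \sum_(i < p) G i.
Proof.
rewrite -(big_mkord xpredT G) -[in RHS](Fp_cast p_pr) big_mkord; exact: eq_bigr.
Qed.

Lemma diffC h m f : diff h (diff m f) = diff m (diff h f).
Proof.
apply/funext => l; rewrite /diff !opprB (addrAC l (- h) (- m)) addrACA [RHS]addrACA.
by rewrite [X in _ = _ + X]addrC.
Qed.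

Lemma iter_diffC h m n f : iter n (diff h) (diff m f) = diff m (iter n (diff h) f).
Proof. by elim: n => // n IH; rewrite !iterS IH diffC. Qed.

Lemma iter_diffE h n f l :
  iter n (diff h) f l = \sum_(i < n.+1) (('X - 1) ^+ n : {poly 'F_p})`_i *: f (l - h *+ i).
Proof.
elim: n l => [|n IH] l; first by rewrite big_ord1 expr0 coef1 scale1r mulr0n subr0.
rewrite iterS /diff !IH exprS mulrBl mul1r.
under [RHS]eq_bigr => i _ do rewrite coefB scalerBl.
rewrite sumrB; congr (_ - _).
  rewrite [RHS]big_ord_recl coefXM scale0r add0r; apply: eq_bigr => i _.
  by rewrite coefXM /= /bump /= mulrS opprD addrA.
rewrite [RHS]big_ord_recr /= nth_default ?scale0r ?addr0 //.
by rewrite -[1]/(1%:P) size_exp_XsubC.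
Qed.

(** By Frobenius [(X - 1)^p = X^p - 1]; one factor [X - 1] is cancelled. As all coefficients are 1,
    [p - 1] differences amount to a sum over all letters. *)
Lemma XsubC1_exp : ('X - 1 : {poly 'F_p}) ^+ p.-1 = \sum_(i < p) 'X^i.
Proof.
have nz : ('X - 1 : {poly 'F_p}) != 0 by rewrite -[1]/(1%:P) polyXsubC_eq0.
apply: (mulfI nz); rewrite -exprS prednK ?prime_gt0 // -subrX1.
have cp : p \in [pchar {poly 'F_p}] by rewrite pchar_poly pchar_Fp.
by have := pFrobenius_autB_comm cp (mulrC 'X 1); rewrite !pFrobenius_autE expr1n.
Qed.

Lemma natFpK (m : 'F_p) : (m : nat)%:R = m :> 'F_p.
Proof. exact: natr_Zp. Qed.

Lemma mulrn_Fp (u : U) (m : 'F_p) : u *+ m = m *: u.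
Proof. by rewrite -scaler_nat natFpK. Qed.

Lemma sum_orbit (W : nmodType) (F : 'F_p -> W) h l : h != 0 ->
  \sum_(i < p) F (l - h *+ i) = \sum_m F m.
Proof.
move=> h0; rewrite -(sum_Fp (fun i => F (l - h *+ i))).
rewrite (reindex_inj (h := fun m : 'F_p => (l - m) / h)).
  apply: eq_bigr => m _; congr F.
  by rewrite -mulr_natr natFpK mulrC divfK // opprB addrC subrK.
by move=> m m' /(mulIf (invr_neq0 h0)) /addrI /oppr_inj.
Qed.

Lemma iter_diff_sum h f l : h != 0 -> iter p.-1 (diff h) f l = \sum_m f m.
Proof.
move=> h0; rewrite iter_diffE XsubC1_exp prednK ?prime_gt0 //.
rewrite (eq_bigr (fun i : 'I_p => f (l - h *+ i))); last first.
  move=> i _; rewrite coef_sum (bigD1 i) //= coefXn eqxx big1 ?addr0 ?scale1r //.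
  by move=> j ji; rewrite coefXn (inj_eq val_inj) eq_sym (negbTE ji).
exact: sum_orbit.
Qed.

(** Leibniz rule for a product with the identity function, whose second difference vanishes. *)
Lemma iter_diff_mul h n f l :
  iter n.+1 (diff h) (fun m => m *: f m) l =
    l *: iter n.+1 (diff h) f l - (h *+ n.+1) *: iter n (diff h) f (l - h).
Proof.
have alg (m k : 'F_p) (u v z : U) : (m - h) *: u - k *: (u + v) - (m *: z - k *: v) =
    m *: (u - z) - (k + h) *: u.
  rewrite scalerDr opprD addrA opprB addrA subrK scalerBl scalerBr scalerDl opprD addrA.
  by rewrite addrAC (addrAC (m *: u) (- (h *: u))) [LHS]addrAC.
elim: n l => [|n IH] l.
  by rewrite /= /diff scalerBl scalerBr addrAC.
have itS F m : iter n.+2 (diff h) F m = iter n.+1 (diff h) F (m - h) - iter n.+1 (diff h) F m.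
  by [].
rewrite !itS !IH (mulrSr h n.+1) -(alg _ _ _ (iter n (diff h) f (l - h))); congr (_ - _ *: _ - _).
by rewrite iterS /diff subrK.
Qed.

(** The Leibniz rule is used for [p - 1] differences of [m *: f m]: these give the moment, the term
    containing the sum of [f] drops out, and [h *+ p.-1 = - h]. *)
Lemma iter_diff_moment h f l : (1 < p)%N -> h != 0 -> \sum_m f m = 0 ->
  iter p.-2 (diff h) f l = h^-1 *: \sum_m m *: f m.
Proof.
move=> p1 h0 f0; apply: (scalerI h0); rewrite scalerA divff // scale1r.
have pE : p.-2.+1 = p.-1 by rewrite prednK // -subn1 subn_gt0.
have := iter_diff_mul h p.-2 f (l + h).
rewrite pE iter_diff_sum // iter_diff_sum // f0 scaler0 add0r addrK => ->.
have -> : h *+ p.-1 = - h; last by rewrite scaleNr opprK.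
apply/eqP; rewrite -addr_eq0 -mulrSr prednK ?prime_gt0 //.
by rewrite -mulr_natr (pchar_Fp_0 p_pr) mulr0.
Qed.

Lemma diff_const h f u : h != 0 -> (forall l, diff h f l = u) ->
  forall l, f l = f 0 - (l / h) *: u.
Proof.
move=> h0 fu l.
have K n k : f (k - h *+ n) = f k + u *+ n.
  elim: n => [|n IH]; first by rewrite mulr0n subr0 addr0.
  rewrite mulrS opprD addrCA addrC.
  by rewrite -[LHS](subrK (f (k - h *+ n))) -/(diff _ _ _) fu IH addrCA -mulrS.
have := K (l / h) l; rewrite -mulr_natr natFpK mulrC divfK // subrr => ->.
by rewrite mulrn_Fp addrK.
Qed.

Lemma diff0_const h f : h != 0 -> (forall l, diff h f l = 0) -> forall l, f l = f 0.
Proof. by move=> h0 f0 l; rewrite (diff_const h0 f0) scaler0 subr0. Qed.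

Lemma diff_affine (B u : U) h l : diff h (fun m => B - m *: u) l = h *: u.
Proof. by rewrite /diff scalerBl !opprB !addrA subrK addrAC subrr add0r. Qed.

Lemma moment_diff f (F : 'F_p -> U) h :
  \sum_l l *: (f (l - h) - f l + F l) = h *: (\sum_l f l) + \sum_l l *: F l.
Proof.
under eq_bigr do rewrite scalerDr scalerBr.
rewrite big_split sumrB /=; congr (_ + _).
rewrite -(sum_shift (fun l => l *: f (l - h)) h) -sumrB scaler_sumr.
by apply: eq_bigr => l _; rewrite addrK scalerDl addrAC subrr add0r.
Qed.

Lemma affine_const_eq0 (B v : U) (r u : 'F_p) : r != 0 -> v != 0 ->
  u *: (B + (1 * r) *: v) = u *: (B + (0 * r) *: v) -> u = 0.
Proof.
move=> r0 v0 /eqP; rewrite mul1r mul0r scale0r addr0 scalerDr addrC -subr_eq0 addrK.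
by rewrite !scaler_eq0 (negbTE r0) (negbTE v0) !orbF => /eqP.
Qed.

End FiniteDifferences.

(** * Coordinates on a factor of the lower central series *)

Section Coordinates.
Variables (p : nat) (p_pr : prime p) (T : groupType).
Implicit Types (g h x y : T) (n : nat) (w : bool).

(** The plane also serves for factors of rank 1, so that both ranks share the same lemmas. *)
Definition plane : lmodType 'F_p := (('F_p)^o * ('F_p)^o)%type.
Lemma plane2D (u v : plane) : (u + v)%R.2 = (u.2 + v.2)%R. Proof. by []. Qed.
Lemma plane2Z k (u : plane) : (k *: u)%R.2 = (k * u.2)%R. Proof. by []. Qed.
Lemma plane2N (u : plane) : (- u)%R.2 = (- u.2)%R. Proof. by []. Qed.
Lemma plane1D (u v : plane) : (u + v)%R.1 = (u.1 + v.1)%R. Proof. by []. Qed.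
Lemma plane1Z k (u : plane) : (k *: u)%R.1 = (k * u.1)%R. Proof. by []. Qed.
Lemma plane1N (u : plane) : (- u)%R.1 = (- u.1)%R. Proof. by []. Qed.

Lemma plane_eq (u v : plane) : u.1 = v.1 -> u.2 = v.2 -> u = v.
Proof. by case: u v => [? ?] [? ?] /= -> ->. Qed.

Lemma plane_sum1 (I : finType) (F : I -> plane) :
  (\sum_i F i)%R.1 = (\sum_i (F i).1)%R.
Proof. by apply: (big_morph (fun z : plane => z.1)). Qed.

Lemma plane_sum2 (I : finType) (F : I -> plane) :
  (\sum_i F i)%R.2 = (\sum_i (F i).2)%R.
Proof. by apply: (big_morph (fun z : plane => z.2)). Qed.

Lemma fst_neq0 (u : plane) : u.1 != 0%R -> u != 0%R.
Proof. by apply: contraNneq => ->. Qed.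

Lemma plane_one_neq0 : ((1, 0)%R : plane) != 0%R.
Proof. by apply: fst_neq0; exact: oner_neq0. Qed.

Lemma plane_expand (u : plane) w : (~~ w -> u.2 = 0%R) ->
  (u.1 *: (1, 0) + u.2 *: (0, w%:R))%R = u.
Proof.
move=> wu; apply: plane_eq; first by rewrite plane1D !plane1Z /= mulr1 mulr0 addr0.
rewrite plane2D !plane2Z /= mulr0 add0r.
by case: w wu => [_|/(_ isT) ->]; rewrite ?mulr1 ?mul0r.
Qed.

Lemma plane_line (u : plane) : u.2 = 0%R -> u = (u.1 *: (1, 0))%R.
Proof. by move=> u2; apply: plane_eq; rewrite ?plane1Z ?plane2Z /= ?mulr1 ?mulr0. Qed.

Implicit Types th : T -> plane.

Record coordinates n th : Prop := Coordinates {
  coordM : forall g h, lcs n g -> lcs n h -> th (g * h) = (th g + th h)%R;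
  coord_ker : forall g, lcs n g -> th g = 0%R <-> lcs n.+1 g }.

Section CoordTheory.
Variables (n : nat) (th : T -> plane) (thP : coordinates n th).

Lemma coord1 : th 1 = 0%R.
Proof. by apply/(coord_ker thP); exact: lcs_1. Qed.

Lemma coordV g : lcs n g -> th g^-1 = (- th g)%R.
Proof.
move=> gg; apply/eqP; rewrite -addr_eq0 -(coordM thP) ?mulVg ?coord1 //.
exact: lcsV.
Qed.

Lemma coordX g k : lcs n g -> th (g ^+ k) = (th g *+ k)%R.
Proof.
move=> gg; elim: k => [|k IH]; first by rewrite coord1.
by rewrite expgS (coordM thP) // ?IH ?mulrS //; exact: lcsX.
Qed.

Lemma coord_eqm g h : lcs n g -> eqm n.+1 g h -> th g = th h.
Proof.
move=> gg e; have hh := eqm_mem (leqnSn _) e gg.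
move: e => /(coord_ker thP _).2; rewrite (coordM thP) ?coordV //; last first.
- exact: lcsV.
move=> /(_ (lcsM (lcsV gg) hh)) /eqP.
by rewrite addrC subr_eq0 => /eqP.
Qed.

Lemma eqm_coord g h : lcs n g -> lcs n h -> th g = th h -> eqm n.+1 g h.
Proof.
move=> gg hh e; have gV := lcsV gg.
apply/(coord_ker thP); first exact: lcsM.
by rewrite (coordM thP) // coordV // e addNr.
Qed.

Lemma coordJ g h : lcs n g -> th (g ^ h) = th g.
Proof. by move=> gg; symmetry; apply: coord_eqm => //; exact: eqm_J. Qed.

Lemma coord_prod (I : Type) (r : seq I) (F : I -> T) : (forall i, lcs n (F i)) ->
  th (\prod_(i <- r) F i) = (\sum_(i <- r) th (F i))%R.
Proof.
move=> LF; elim: r => [|i r IH]; first by rewrite !big_nil coord1.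
rewrite !big_cons (coordM thP) ?IH //.
by apply: subg_prod => //; exact: lcs_subgroup.
Qed.

End CoordTheory.

Section Bilinear.
Variables (n : nat) (th : T -> plane) (thP : coordinates n.+1 th).

Lemma coord_commMl g g' h : lcs n g -> lcs n g' ->
  th [~ g * g', h] = (th [~ g, h] + th [~ g', h])%R.
Proof.
move=> gg gg'; rewrite -(coordM thP); [|exact: lcs_comm..].
by apply: (coord_eqm thP) => //; [apply: lcs_comm; exact: lcsM|exact: eqm_commM].
Qed.

Lemma coord_commMr g h h' : lcs n g ->
  th [~ g, h * h'] = (th [~ g, h] + th [~ g, h'])%R.
Proof.
move=> gg; rewrite -(coordM thP); [|exact: lcs_comm..].
by apply: (coord_eqm thP) => //; [exact: lcs_comm|exact: eqm_commgM].
Qed.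

Lemma coord_commXl g h k : lcs n g -> th [~ g ^+ k, h] = (th [~ g, h] *+ k)%R.
Proof.
move=> gg; rewrite -(coordX thP); last exact: lcs_comm.
by apply: (coord_eqm thP) => //; [apply: lcs_comm; exact: lcsX|exact: eqm_commX].
Qed.

Lemma coord_commXr g h k : lcs n g -> th [~ g, h ^+ k] = (th [~ g, h] *+ k)%R.
Proof.
move=> gg; rewrite -(coordX thP); last exact: lcs_comm.
by apply: (coord_eqm thP) => //; [exact: lcs_comm|exact: eqm_commgX].
Qed.

Lemma coord_comm_eqml g g' h : lcs n g -> eqm n.+1 g g' ->
  th [~ g, h] = th [~ g', h].
Proof.
move=> gg e; rewrite -[g'](mulVKg g) coord_commMl //.
  rewrite [X in (_ + X)%R](_ : _ = 0%R) ?addr0 //.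
  by have L := lcs_comm h e; apply/(coord_ker thP) => //; exact: lcs_leS.
by apply: lcs_leS.
Qed.

Lemma coord_comm_scale th0 g g' h (k : 'F_p) : coordinates n th0 ->
  lcs n g -> lcs n g' -> th0 g = (k *: th0 g')%R -> th [~ g, h] = (k *: th [~ g', h])%R.
Proof.
move=> th0P gg gg' e.
have /(coord_comm_eqml h gg) -> : eqm n.+1 g (g' ^+ k).
  apply: (eqm_coord th0P) => //; first exact: lcsX.
  by rewrite (coordX th0P) // e mulrn_Fp.
by rewrite coord_commXl // mulrn_Fp.
Qed.

End Bilinear.

(* [w] tells whether the factor has rank 2; if not, [y] has coordinates [(0, 0)]
   and the second coordinate vanishes identically. *)
Record basis n x y w th : Prop := Basis {
  basis_coord :> coordinates n th;
  basis_lx : lcs n x;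
  basis_x : th x = (1, 0)%R;
  basis_ly : lcs n y;
  basis_y : th y = (0, w%:R)%R;
  basis_line : ~~ w -> forall g, lcs n g -> (th g).2 = 0%R }.

Lemma basis_expand n x y w th g : basis n x y w th -> lcs n g ->
  eqm n.+1 g (x ^+ (th g).1 * y ^+ (th g).2).
Proof.
move=> B gg; have [C lx ex ly ey ln] := B.
have lX := @lcsX T n x (th g).1 lx; have lY := @lcsX T n y (th g).2 ly.
apply: (eqm_coord C) => //; first exact: lcsM.
rewrite (coordM C) // !(coordX C) // ex ey !mulrn_Fp plane_expand // => nw.
exact: ln.
Qed.

Lemma basis_generates n x y w th : basis n x y w th -> generates n [set x; y].
Proof.
move=> B M sM sub MS g gg; have e := basis_expand B gg.
have Mxy : M (x ^+ (th g).1 * y ^+ (th g).2).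
  by apply: subgM => //; apply: subgX => //; apply: MS; [left|right].
by apply: subgVE => //; apply: (subgMr sM Mxy); exact: sub.
Qed.

(** The coordinates are exponents of [x] and [y] obtained by choice: [expo] makes exponents matter
    only modulo [p], and [indep] makes them unique. *)
Lemma basis_exists n x y w : (0 < n)%N -> lcs n x -> lcs n y ->
  generates n [set x; y] -> (forall g, lcs n g -> lcs n.+1 (g ^+ p)) ->
  (~~ w -> lcs n.+1 y) ->
  (forall u v : 'F_p, lcs n.+1 (x ^+ u * y ^+ v) -> u = 0%R /\ (w -> v = 0%R)) ->
  exists th, basis n x y w th.
Proof.
move=> n0 lx ly gen expo wy indep.
pose phi (u : plane) := x ^+ u.1 * y ^+ u.2.
have lphi u : lcs n (phi u) by apply: lcsM; exact: lcsX.
have Xmod g k m : lcs n g -> (k %% p = m %% p)%N -> eqm n.+1 (g ^+ k) (g ^+ m).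
  move=> gg km.
  have K k' : eqm n.+1 (g ^+ k') (g ^+ (k' %% p)).
    apply: eqm_sym; rewrite {2}(divn_eq k' p) addnC expgnDr mulnC expgnA /eqm mulKg.
    by apply: lcsX; exact: expo.
  by apply: eqm_trans (K k) _; rewrite km; exact/eqm_sym/K.
have XF (u v : 'F_p) g : lcs n g -> eqm n.+1 (g ^+ (u + v)%R) (g ^+ u * g ^+ v).
  move=> gg; rewrite -expgnDr; apply: Xmod => //.
  by rewrite -(val_Fp_nat p_pr) natFpK -(val_Fp_nat p_pr) natrD !natFpK.
have phiM u v : eqm n.+1 (phi (u + v)%R) (phi u * phi v).
  apply: eqm_trans (eqmM (XF _ _ _ lx) (XF _ _ _ ly)) _; rewrite /phi -!mulgA.
  apply: eqmMl; rewrite !mulgA; apply: eqmMr; apply: eqm_C; exact: lcsX.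
have phi0 : phi 0%R = 1 by rewrite /phi !expg0 mulg1.
have phiV u : eqm n.+1 (phi (- u)%R) (phi u)^-1.
  have := eqmMl (phi u)^-1 (phiM u (- u)%R).
  by rewrite addrN phi0 mulg1 mulKg => /eqm_sym.
have phi_inj u : lcs n.+1 (phi u) -> (~~ w -> u.2 = 0%R) -> u = 0%R.
  case: u => u v /indep /= [-> wv] nwv; congr pair.
  by case: (w) wv nwv => [-> //|_ ->].
have ex g : exists u : plane, lcs n g -> eqm n.+1 g (phi u) /\ (~~ w -> u.2 = 0%R).
  case: (pselect (lcs n g)) => gg; last by exists 0%R.
  have [u e] : exists u, eqm n.+1 g (phi u).
    pose M := [set g | exists u, eqm n.+1 g (phi u)].
    have sM : is_subgroup M.
      split=> [|h k [u hu] [v kv]|h [u hu]].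
      - by exists 0%R; rewrite phi0.
      - exists (u + v)%R; apply: eqm_trans (eqmM hu kv) _; exact/eqm_sym/phiM.
      - exists (- u)%R; apply: eqm_trans (eqmV hu) _; exact/eqm_sym/phiV.
    have : lcs n `<=` M; last by apply.
    apply: gen => // [h hh|_ [->|->]].
    - by exists 0%R; rewrite phi0; apply: eqm_sym; rewrite /eqm invg1 mul1g.
    - exists (1, 0)%R; rewrite /phi /= expg0 mulg1 -[X in eqm _ X _]expg1.
      by apply: Xmod => //; rewrite Fp_cast // modn_mod.
    - exists (0, 1)%R; rewrite /phi /= expg0 mul1g -[X in eqm _ X _]expg1.
      by apply: Xmod => //; rewrite Fp_cast // modn_mod.
  case: (boolP w) => hw; first by exists u.
  (* In rank 1 [y] is trivial modulo [lcs n.+1], and its exponent is normalised to 0 to keep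
     coordinates unique. *)
  exists (u.1, 0)%R => _; split=> //; apply: eqm_trans e _.
  rewrite /phi /= expg0; apply: eqmMl; apply: eqm_sym; rewrite /eqm invg1 mul1g.
  by apply: lcsX; exact: wy.
have [th thP] := choice ex.
have uniq g u : lcs n g -> eqm n.+1 g (phi u) -> (~~ w -> u.2 = 0%R) -> th g = u.
  move=> gg e wu; have [e' wu'] := thP g gg.
  apply/eqP; rewrite -subr_eq0; apply/eqP; apply: phi_inj; last first.
    by move=> nw; rewrite /= wu' // wu // subr0.
  apply: (eqm_mem (leqnn _) (g := (phi (th g) * (phi u)^-1))).
    apply: eqm_sym; apply: eqm_trans (phiM _ _) _; apply: eqmMl; exact: phiV.
  have := eqmMr (phi u)^-1 (eqm_trans (eqm_sym e) e').
  by rewrite mulgV => /eqm1.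
have thM g h : lcs n g -> lcs n h -> th (g * h) = (th g + th h)%R.
  move=> gg hh; apply: uniq; first exact: lcsM.
    apply: eqm_trans (eqmM (thP g gg).1 (thP h hh).1) _; exact/eqm_sym/phiM.
  by move=> nw; rewrite /= (thP g gg).2 // (thP h hh).2 // addr0.
exists th; split=> //.
- split=> // g gg; split=> [e|Lg].
    by have [] := thP g gg; rewrite e phi0 => /eqm_sym /eqm1.
  by apply: uniq => //; rewrite phi0; exact/eqm_sym/eqm1.
- apply: uniq => //; rewrite /phi /= expg0 mulg1 -[X in eqm _ X _]expg1.
  by apply: Xmod => //; rewrite Fp_cast // modn_mod.
- case: (boolP w) wy => hw wy.
    apply: uniq => //; last by rewrite hw.
    rewrite /phi /= -[x ^+ _]/1 mul1g -[X in eqm _ X _]expg1.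
    by apply: Xmod => //; rewrite Fp_cast // modn_mod.
  by apply: uniq => //; rewrite phi0; apply/eqm_sym/eqm1; exact: wy.
- by move=> nw g gg; apply: (thP g gg).2.
Qed.

End Coordinates.

(** * Groups acting like a GGS-group of FG-type *)

(* The letter [l] of the tree alphabet is read modulo [p], so that [p] becomes [0]:
   [ev l] is the entry [e_l] of the defining vector, completed by [ev 0 = 0],
   [sec g l] is the section of [g] at [l], and [chi g] is the exponent of the
   permutation induced by [g] on the first level.  [moves g n] stands for
   "[g] moves some word of length [n]". *)
Record ggs_group (p : nat) (T : groupType) := GGSGroup {
  p_pr : prime p;
  p_odd : odd p;
  ga : T;
  gb : T;
  ev : 'F_p -> 'F_p;
  chi : T -> 'F_p;
  sec : T -> 'F_p -> T;
  moves : T -> nat -> Prop;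
  ev0 : ev 0%R = 0%R;
  eps_neq0 : (\sum_l ev l)%R != 0%R;
  delta_neq0 : (\sum_l l * ev l)%R != 0%R;
  chiM : forall g h, chi (g * h) = (chi g + chi h)%R;
  secM : forall g h l, sec (g * h) l = sec g l * sec h (l + chi g)%R;
  chi_a : chi ga = 1%R;
  sec_a : forall l, sec ga l = 1;
  chi_b : chi gb = 0%R;
  sec_b0 : sec gb 0%R = gb;
  sec_b : forall l, l != 0%R -> sec gb l = ga ^+ ev l;
  gen_ab : forall H, is_subgroup H -> H ga -> H gb -> forall g, H g;
  moves0 : forall g, ~ moves g 0;
  movesS : forall g n, moves g n.+1 -> chi g <> 0%R \/ exists l, moves (sec g l) n;
  moves_neq1 : forall g, g <> 1 -> exists n, moves g n }.

Arguments gen_ab {p T} g0 {H}.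

Section GGSBasics.
Variables (p : nat) (T : groupType) (S : ggs_group p T).
Local Notation a := (ga S).
Local Notation b := (gb S).
Local Notation e := (ev S).
Local Notation chi := (chi S).
Local Notation sec := (sec S).
Local Notation pr := (p_pr S).
Implicit Types (g h : T) (k l m : 'F_p) (n i : nat).

Definition geps : 'F_p := (\sum_l e l)%R.
Definition gdelta : 'F_p := (\sum_l l * e l)%R.
Definition gc : T := a ^+ geps * b.
Local Notation c := gc.

Lemma chi1 : chi 1 = 0%R.
Proof. by apply: (addrI (chi 1)); rewrite addr0 -chiM mulg1. Qed.

Lemma chiV g : chi g^-1 = (- chi g)%R.
Proof. by apply/eqP; rewrite -addr_eq0 -chiM mulVg chi1. Qed.

Lemma chiX g n : chi (g ^+ n) = (chi g *+ n)%R.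
Proof.
elim: n => [|n IH]; first by rewrite chi1.
by rewrite expgS chiM IH mulrS.
Qed.

Lemma chiJ g h : chi (g ^ h) = chi g.
Proof. by rewrite !chiM chiV addrC addrK. Qed.

Lemma chiR g h : chi [~ g, h] = 0%R.
Proof. by rewrite commgEl chiM chiJ chiV addNr. Qed.

Lemma sec1 l : sec 1 l = 1.
Proof.
by have := secM S 1 1 l; rewrite chi1 addr0 mulg1 -{1}[sec 1 l]mulg1 => /mulgI.
Qed.

Lemma secV g l : sec g^-1 l = (sec g (l - chi g)%R)^-1.
Proof.
apply: (mulIg (sec g (l - chi g)%R)); rewrite mulVg.
by rewrite -chiV -secM mulVg sec1.
Qed.

Lemma secJ g h l : chi g = 0%R ->
  sec (g ^ h) l = sec g (l - chi h)%R ^ sec h (l - chi h)%R.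
Proof. by move=> g0; rewrite !secM secV g0 addr0 chiV. Qed.

Lemma secR g h l : chi g = 0%R ->
  sec [~ g, h] l = (sec g l)^-1 * sec g (l - chi h)%R ^ sec h (l - chi h)%R.
Proof. by move=> g0; rewrite commgEl secM secV secJ // chiV g0 !subr0. Qed.

Lemma secX g n l : chi g = 0%R -> sec (g ^+ n) l = sec g l ^+ n.
Proof.
move=> g0; elim: n => [|n IH]; first exact: sec1.
by rewrite !expgS secM g0 addr0 IH.
Qed.

Lemma sec_aX n l : sec (a ^+ n) l = 1.
Proof.
elim: n l => [|n IH] l; first exact: sec1.
by rewrite expgS secM sec_a IH mulg1.
Qed.

(** If such a [g] moved a word of length [n], then, as it fixes the first level, one of its sections
    would move a word of length [n - 1] and still satisfy [P], down to the empty word. This proves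
    equations between recursively defined elements. *)
Lemma self_similar_trivial (P : T -> Prop) :
  (forall g, P g -> chi g = 0%R /\ forall l, P (sec g l)) -> forall g, P g -> g = 1.
Proof.
move=> HP g Pg; apply: contrapT => /(moves_neq1 S) [n].
elim: n g Pg => [|n IH] g /HP [g0 Pg]; first exact: moves0.
by move=> /movesS[|[l]]; [rewrite g0|apply: IH].
Qed.

Lemma sec_inj g h : chi g = chi h -> sec g =1 sec h -> g = h.
Proof.
move=> egh sgh; apply: (mulIg h^-1); rewrite mulgV.
apply: (@self_similar_trivial (fun x => x = g * h^-1 \/ x = 1) _ _ (or_introl erefl)).
move=> x [->|->].
  split=> [|l]; first by rewrite chiM chiV egh subrr.
  by right; rewrite secM secV egh addrK sgh mulgV.
by split=> [|l]; [exact: chi1|right; exact: sec1].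
Qed.

Lemma a_exp : a ^+ p = 1.
Proof.
apply: sec_inj => [|l]; last by rewrite sec_aX sec1.
by rewrite chiX chi_a chi1 (pchar_Fp_0 pr).
Qed.

Lemma aX_mod i j : (i %% p = j %% p)%N -> a ^+ i = a ^+ j.
Proof.
move=> ij; rewrite (divn_eq i p) (divn_eq j p) ij.
by rewrite !expgnDr ![(_ * p)%N]mulnC !expgnA a_exp !expg1n.
Qed.

Lemma aXD k l : a ^+ (k + l)%R = a ^+ k * a ^+ l.
Proof.
rewrite -expgnDr; apply: aX_mod.
by rewrite -(val_Fp_nat pr) natFpK -(val_Fp_nat pr) natrD !natFpK.
Qed.

Lemma chi_aX k : chi (a ^+ k) = k.
Proof. by rewrite chiX chi_a natFpK. Qed.

Lemma b_exp : b ^+ p = 1.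
Proof.
apply: (@self_similar_trivial (fun x => x = b ^+ p \/ x = 1) _ _ (or_introl erefl)).
move=> x [->|->]; last by split=> [|l]; [exact: chi1|right; exact: sec1].
split=> [|l]; first by rewrite chiX chi_b mul0rn.
have [->|l0] := eqVneq l 0%R.
  by left; rewrite secX ?chi_b // sec_b0.
by right; rewrite secX ?chi_b // sec_b // -expgnA mulnC expgnA a_exp expg1n.
Qed.

Lemma geps_neq0 : geps != 0%R. Proof. exact: eps_neq0. Qed.
Lemma gdelta_neq0 : gdelta != 0%R. Proof. exact: delta_neq0. Qed.

Lemma chi_c : chi c = geps.
Proof. by rewrite chiM chi_aX chi_b addr0. Qed.

Lemma sec_c l : sec c l = sec b (l + geps)%R.
Proof. by rewrite secM sec_aX mul1g chi_aX. Qed.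

Lemma gen_bc H : is_subgroup H -> H b -> H c -> forall g, H g.
Proof.
move=> sH Hb Hc; apply: (gen_ab S sH _ Hb).
have Ha : H (a ^+ geps) by apply: (subgMr sH Hb).
have -> : a = (a ^+ geps) ^+ (geps^-1 : 'F_p)%R; last exact: subgX.
rewrite -expgnA -{1}[a]expg1; apply: aX_mod.
by rewrite -!(val_Fp_nat pr) natrM !natFpK divff // geps_neq0.
Qed.

(* As [eps <> 0], the exponent of [b] modulo [p] can be read off the sections. *)
Definition chib g : 'F_p := (geps^-1 * \sum_l chi (sec g l))%R.

Lemma geps_chib g : (geps * chib g = \sum_l chi (sec g l))%R.
Proof. by rewrite mulrA divff ?mul1r // geps_neq0. Qed.

Lemma chibM g h : chib (g * h) = (chib g + chib h)%R.
Proof.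
rewrite /chib -mulrDr; congr (_ * _)%R.
under eq_bigr do rewrite secM chiM.
by rewrite big_split /= (sum_shift (fun l => chi (sec h l))).
Qed.

Lemma chib_a : chib a = 0%R.
Proof. by rewrite /chib big1 ?mulr0 // => l _; rewrite sec_a chi1. Qed.

Lemma chib_b : chib b = 1%R.
Proof.
rewrite /chib (eq_bigr e) ?mulVf ?geps_neq0 // => l _.
by have [->|l0] := eqVneq l 0%R; rewrite ?sec_b0 ?chi_b ?ev0 // sec_b // chi_aX.
Qed.

Lemma chib1 : chib 1 = 0%R.
Proof. by apply: (addrI (chib 1)); rewrite addr0 -chibM mulg1. Qed.

Lemma chibV g : chib g^-1 = (- chib g)%R.
Proof. by apply/eqP; rewrite -addr_eq0 -chibM mulVg chib1. Qed.

Lemma chibX g n : chib (g ^+ n) = (chib g *+ n)%R.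
Proof.
elim: n => [|n IH]; first by rewrite chib1.
by rewrite expgS chibM IH mulrS.
Qed.

Lemma chibJ g h : chib (g ^ h) = chib g.
Proof. by rewrite !chibM chibV addrC addrK. Qed.

Lemma chibR g h : chib [~ g, h] = 0%R.
Proof. by rewrite commgEl chibM chibJ chibV addNr. Qed.

Lemma lcs_exp n g : (0 < n)%N -> lcs n g -> lcs n.+1 (g ^+ p).
Proof. by move=> n0; apply: (lcs_exponent (@gen_ab _ _ S) a_exp b_exp n0). Qed.

(** [chib] comes first because [x(1) = b] and [y(1) = a]. *)
Definition theta1 g : plane p := (chib g, chi g).

Lemma lcs2_chi g : lcs 2 g -> chi g = 0%R /\ chib g = 0%R.
Proof.
move=> gg; have : [set g | chi g = 0%R /\ chib g = 0%R] g; last by [].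
apply: (lcs_min _ _ gg) => [|h k _]; last by rewrite /= chiR chibR.
split=> /= [|h k [h0 h1] [k0 k1]|h [h0 h1]].
- by rewrite chi1 chib1.
- by rewrite chiM chibM h0 h1 k0 k1 addr0.
- by rewrite chiV chibV h0 h1 oppr0.
Qed.

Lemma theta1_basis : basis 1 b a true theta1.
Proof.
have [th B] : exists th : T -> plane p, basis 1 b a true th.
  apply: basis_exists => //; first exact: pr.
  - by move=> M sM _ MS g _; apply: (gen_ab S) => //; apply: MS; [right|left].
  - by move=> g; exact: lcs_exp.
  move=> u v /lcs2_chi []; rewrite chiM chibM !chiX !chibX chi_a chi_b chib_a chib_b.
  by rewrite !mul0rn add0r addr0 !natFpK => -> ->.
suff -> : theta1 = th by [].
apply/funext; apply: (gen_ab S).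
- have [C _ _ _ _ _] := B; split=> [|g h /= eg eh|g /= eg].
  + by rewrite /= /theta1 chi1 chib1 (coord1 C).
  + by rewrite (coordM C) // -eg -eh /theta1 chiM chibM.
  + by rewrite (coordV C) // -eg /theta1 chiV chibV.
- by rewrite /= /theta1 chib_a chi_a (basis_y B).
- by rewrite /= /theta1 chib_b chi_b (basis_x B).
Qed.

Lemma lcs2P g : lcs 2 g <-> chi g = 0%R /\ chib g = 0%R.
Proof.
split; first exact: lcs2_chi.
by move=> [g0 g1]; apply/(coord_ker theta1_basis) => //; rewrite /theta1 g0 g1.
Qed.

End GGSBasics.

(** * Branching over the derived subgroup *)

Section Branching.
Variables (p : nat) (T : groupType) (S : ggs_group p T).
Local Notation a := (ga S).
Local Notation b := (gb S).
Local Notation e := (ev S).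
Local Notation chi := (chi S).
Local Notation sec := (sec S).
Local Notation pr := (p_pr S).
Implicit Types (g h t : T) (k l m d x y : 'F_p) (n i : nat).

Lemma aXM k l : a ^+ (k * l)%R = a ^+ k ^+ l.
Proof.
rewrite -expgnA; apply: aX_mod.
by rewrite -!(val_Fp_nat pr) natrM !natFpK.
Qed.

Lemma expF1 (g : T) : g ^+ (1%R : 'F_p) = g.
Proof. exact: expg1. Qed.

Lemma p_gt2 : (2 < p)%N.
Proof. by have := p_odd S; have := prime_gt1 pr; case: (p) => [|[|[|]]]. Qed.

Lemma two_neq0 : (2%:R : 'F_p)%R != 0%R.
Proof.
apply/eqP => /(congr1 (@nat_of_ord _)); rewrite (val_Fp_nat pr 2) modn_small //.
exact: p_gt2.
Qed.

Lemma aXN k : a ^+ (- k)%R = (a ^+ k)^-1.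
Proof. by apply: (mulIg (a ^+ k)); rewrite mulVg -aXD addNr. Qed.

Lemma div_commE (x y z : T) :
  ([~ x, y] * [~ z, x])^-1 ^ (x^-1 * y^-1 * x) = [~ x, z * y^-1].
Proof. by rewrite /commg /conjg !gnorm. Qed.

Lemma sec_rot g m l : chi g = 0%R -> sec (g ^ (a ^+ m)) l = sec g (l - m)%R.
Proof. by move=> g0; rewrite secJ // sec_aX conjg1 chi_aX. Qed.

(** At the letter 0, [b] provides the section [b], and a conjugate of [b] by a power of [a] provides
    a non-trivial power of [a]; rotation handles the other letters. *)
Lemma section_onto t l : exists2 g, chi g = 0%R & sec g l = t.
Proof.
have [g g0 <-] : exists2 g, chi g = 0%R & sec g 0%R = t; last first.
  by exists (g ^ (a ^+ l)); rewrite ?chiJ // sec_rot // subrr.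
pose H := [set t | exists2 g, chi g = 0%R & sec g 0%R = t].
have sH : is_subgroup H.
  split=> [|_ _ [g g0 <-] [h h0 <-]|_ [g g0 <-]].
  - by exists 1; rewrite ?chi1 ?sec1.
  - by exists (g * h); rewrite ?chiM ?g0 ?h0 ?addr0 // secM g0 addr0.
  - by exists g^-1; rewrite ?chiV ?g0 ?oppr0 // secV g0 subr0.
apply: (gen_ab S sH); last by exists b; rewrite ?chi_b ?sec_b0.
have [m em] : exists m, e m != 0%R.
  apply: contrapT => e0; have := geps_neq0 S; rewrite /geps big1 ?eqxx // => m _.
  by apply/eqP; apply: contrapT => /negP em; apply: e0; exists m.
have m0 : m != 0%R by apply: contraNneq em => ->; rewrite ev0.
have Ha : H (a ^+ e m).
  by exists (b ^ (a ^+ (- m)%R)); rewrite ?chiJ ?chi_b // sec_rot ?chi_b // opprK add0r sec_b.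
have -> : a = (a ^+ e m) ^+ ((e m)^-1)%R; last exact: subgX.
by rewrite -aXM divff.
Qed.

(* Some element has sections [h] at [0] and [h'] at [d] (their product if [d = 0])
   and [1] elsewhere. *)
Definition two_point h d h' := exists2 g, chi g = 0%R &
  forall l, sec g l = (if l == 0%R then h else 1) * (if l == d then h' else 1).

Lemma two_point_trans h d h' l t :
  two_point h d h' -> two_point h'^-1 l t -> two_point h (d + l)%R t.
Proof.
move=> [g g0 gE] [k k0 kE]; exists (g * k ^ (a ^+ d)).
  by rewrite chiM chiJ g0 k0 addr0.
move=> m; rewrite secM g0 addr0 sec_rot // gE kE subr_eq0 (subr_eq m) (addrC l).
by rewrite -mulgA; case: (m == d); rewrite ?mul1g // mulVKg.
Qed.

(** The commutator of a power of [b] with a power of [b] rotated by [l]: away from [0] and [l] both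
    have powers of [a] as sections, and these commute. *)
Lemma two_point_comm l x y : l != 0%R ->
  two_point [~ b ^+ x, a ^+ (e (- l) * y)%R] l [~ a ^+ (e l * x)%R, b ^+ y].
Proof.
move=> l0; exists [~ b ^+ x, (b ^ (a ^+ l)) ^+ y]; first exact: chiR.
have c1 : chi (b ^+ x) = 0%R by rewrite chiX chi_b mul0rn.
have c2 : chi ((b ^ (a ^+ l)) ^+ y) = 0%R by rewrite chiX chiJ chi_b mul0rn.
move=> m; rewrite secR // c2 subr0.
rewrite !secX ?chiJ ?chi_b // sec_rot ?chi_b // -commgEl.
have [->|m0] := eqVneq m 0%R.
  by rewrite eq_sym (negbTE l0) mulg1 sec_b0 sub0r sec_b ?oppr_eq0 // aXM.
have [->|ml] := eqVneq m l.
  by rewrite mul1g subrr sec_b0 sec_b // aXM.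
rewrite mulg1 !sec_b ?subr_eq0 //; apply/eqP/commgP; apply: commuteX2; apply: commuteX2.
exact: commute_refl.
Qed.

Definition one_point h := exists2 g, chi g = 0%R &
  forall l, sec g l = if l == 0%R then h else 1.

Lemma one_point_subgroup : is_subgroup one_point.
Proof.
split=> [|h h' [g g0 gE] [g' g'0 g'E]|h [g g0 gE]].
- by exists 1 => [|l]; rewrite ?chi1 // sec1; case: ifP.
- exists (g * g'); first by rewrite chiM g0 g'0 addr0.
  by move=> l; rewrite secM g0 addr0 gE g'E; case: ifP; rewrite ?mulg1.
- exists g^-1; first by rewrite chiV g0 oppr0.
  by move=> l; rewrite secV g0 subr0 gE; case: ifP; rewrite ?invg1.
Qed.

Lemma one_point_conj h t : one_point h -> one_point (h ^ t).
Proof.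
move=> [g g0 gE]; have [k k0 kE] := section_onto t 0%R.
exists (g ^ k); first by rewrite chiJ.
by move=> l; rewrite secJ // k0 subr0 gE; case: eqP => [->|]; rewrite ?kE ?conj1g.
Qed.

(* If [e] were even, [delta] would vanish. *)
Lemma asymmetric : exists2 l : 'F_p, e (- l)%R != 0%R & e (- l)%R != e l.
Proof.
have [l el] : exists l, e (- l)%R != e l.
  apply: contrapT => N; have {}N l : e (- l)%R = e l.
    by apply/eqP; apply: contrapT => /negP el; apply: N; exists l.
  have : (2%:R * gdelta S)%R = 0%R :> 'F_p.
    rewrite mulr_natl mulr2n {1}/gdelta (reindex_inj oppr_inj) /= -big_split /=.
    by rewrite big1 // => l _; rewrite N mulNr addNr.
  by move/eqP; rewrite mulf_eq0 (negbTE two_neq0) (negbTE (gdelta_neq0 S)).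
have [el0|] := eqVneq (e (- l)%R) 0%R; last by exists l.
by exists (- l)%R; rewrite opprK eq_sym // -el0.
Qed.

(* Elements from [two_point_comm] are composed along the letters [l, 2l, ...] so that
   the inner sections cancel; after [p] steps the chain closes up at [0]. *)
Lemma one_point_chain l n x y : l != 0%R -> e (- l)%R != 0%R ->
  let st := iter n (fun u : 'F_p * 'F_p => (u.2, e l / e (- l) * u.1)%R) (x, y) in
  two_point [~ b ^+ x, a ^+ (e (- l) * y)%R] (l *+ n.+1)%R [~ a ^+ (e l * st.1)%R, b ^+ st.2].
Proof.
move=> l0 r0 /=; elim: n => [|n IH]; first exact: two_point_comm.
rewrite mulrSr; apply: (two_point_trans IH); rewrite /= invgR.
set st := iter n _ _.

have -> : (e l * st.1 = e (- l) * (e l / e (- l) * st.1))%R.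
  by rewrite [RHS]mulrA [(e (- l) * _)%R]mulrC divfK.
exact: two_point_comm.
Qed.

Lemma one_point_comm_b : exists2 k : 'F_p, k != 0%R & one_point [~ b, a ^+ k].
Proof.
have [l r0 rs] := asymmetric.
have l0 : l != 0%R by apply: contraNneq rs => ->; rewrite oppr0.
have [s0|s0] := eqVneq (e l) 0%R.
  exists (e (- l)%R) => //; have [g g0 gE] := two_point_comm 1%R 1%R l0.
  exists g => // m; rewrite gE s0 mul0r mulr1 expg0 comm1g; case: ifP; rewrite ?if_same mulg1 //.
(* [c] is chosen so that the chain started at [(1, c)] ends, after [p] links, with exponents [c] and
   [c * c], which is 1 by Fermat. Both ends are then commutators with [b] itself and fuse, up to
   inversion and conjugation, into [[~ b, a ^+ k]] with [k = (e l - e (- l)) * c], non-zero by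
   asymmetry. *)
set kap := (e l / e (- l))%R; pose c : 'F_p := (kap ^+ p./2)%R.
have kap0 : kap != 0%R by rewrite mulf_neq0 ?invr_neq0.
have cc : (c * c)%R = 1%R.
  rewrite -exprD addnn; apply: (mulfI kap0); rewrite -exprS mulr1.
  have -> : (p./2.*2.+1 = p)%N by rewrite -[RHS]odd_double_half (p_odd S).
  by rewrite -[kap]natFpK -(pFrobenius_autE (pchar_Fp pr)) pFrobenius_aut_nat.
have c0 : c != 0%R by rewrite expf_neq0.
have it j : iter j.*2 (fun u : 'F_p * 'F_p => (u.2, kap * u.1)%R) (1, c)%R =
    (kap ^+ j, kap ^+ j * c)%R.
  elim: j => [|j IH]; first by rewrite expr0 mul1r.
  by rewrite doubleS !iterS IH /= exprS mulrA.
have := one_point_chain p./2.*2 1%R c l0 r0; rewrite /= -/kap it /= -/c cc.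
have -> : (p./2.*2.+1 = p)%N by rewrite -[RHS]odd_double_half (p_odd S).
rewrite -mulr_natr (pchar_Fp_0 pr) mulr0 => -[g g0 gE].
exists ((e l - e (- l)) * c)%R.
  by rewrite mulf_neq0 // subr_eq0 eq_sym.
have K : one_point ([~ b, a ^+ (e (- l) * c)%R] * [~ a ^+ (e l * c)%R, b]).
  exists g => // m; rewrite gE; by case: ifP; rewrite ?mulg1.
rewrite mulrBl aXD aXN -div_commE.
by apply: one_point_conj; apply: (subgV one_point_subgroup).
Qed.

(** [one_point] is a normal subgroup containing [[~ b, a ^+ k]] for some non-zero [k], so modulo it
    the generators [a] and [b] commute. *)
Lemma one_point_lcs2 h : lcs 2 h -> one_point h.
Proof.
have sO := one_point_subgroup.
have sub t : is_subgroup [set h | one_point [~ t, h]].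
  split=> [|u v Hu Hv|v /= Hv] /=.
  - by rewrite commg1; exact: subg1.
  - by rewrite commgM; apply: subgM => //; exact: one_point_conj.
  - have -> : [~ t, v^-1] = ([~ t, v] ^ v^-1)^-1.
      by rewrite /commg /conjg !gnorm.
    by apply: subgV => //; exact: one_point_conj.
have [k k0 bk] := one_point_comm_b.
have Ob t : one_point [~ b, t].
  apply: (gen_ab S (sub b)); last by rewrite /= commgg; exact: subg1.
  have -> : a = (a ^+ k) ^+ (k^-1 : 'F_p)%R by rewrite -aXM divff.
  by apply: (subgX _ (sub b)).
have Oa t : one_point [~ a, t].
  apply: (gen_ab S (sub a)); first by rewrite /= commgg; exact: subg1.
  by rewrite /= -invgR; apply: subgV.
move=> hh; apply: (lcs_min sO _ hh) => g u _.
rewrite -invgR; apply: subgV => //.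
by apply: (gen_ab S (sub u)); rewrite /= -invgR; apply: subgV.
Qed.

End Branching.

(** * Elements with all sections in a lower central term *)

Section CoordinatewiseSeries.
Variables (p : nat) (T : groupType) (S : ggs_group p T).
Local Notation a := (ga S).
Local Notation b := (gb S).
Local Notation c := (gc S).
Local Notation chi := (chi S).
Local Notation sec := (sec S).
Implicit Types (g h t : T) (k l m d : 'F_p) (n i : nat).

Definition lcsp n g := chi g = 0%R /\ forall l, lcs n (sec g l).
Local Notation L := lcsp.

Lemma lcsp_subgroup n : is_subgroup (L n).
Proof.
split=> [|g h [g0 gL] [h0 hL]|g [g0 gL]].
- by split=> [|l]; rewrite ?chi1 ?sec1.
- split=> [|l]; first by rewrite chiM g0 h0 addr0.
  by rewrite secM; apply: lcsM.
- split=> [|l]; first by rewrite chiV g0 oppr0.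
  by rewrite secV; apply: lcsV.
Qed.

Lemma lcspJ n g h : L n g -> L n (g ^ h).
Proof.
move=> [g0 gL]; split=> [|l]; first by rewrite chiJ.
by rewrite secJ //; apply: lcs_conj.
Qed.

Lemma lcspR n g h : L n g -> L n [~ g, h].
Proof.
by move=> gL; rewrite commgEl; apply: (subgM (lcsp_subgroup n));
 [exact: (subgV (lcsp_subgroup n))|exact: lcspJ].
Qed.

Lemma lcspX n g i : L n g -> L n (g ^+ i).
Proof. exact: (subgX _ (lcsp_subgroup n)). Qed.

Lemma lcspRS n g h : L n g -> chi h = 0%R -> L n.+1 [~ g, h].
Proof.
move=> [g0 gL] h0; split=> [|l]; first exact: chiR.
by rewrite secR // h0 subr0 -commgEl; apply: lcs_comm.
Qed.

Lemma iota_exists : exists f : 'F_p -> T -> T, forall l h, lcs 2 h ->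
  chi (f l h) = 0%R /\ forall m, sec (f l h) m = if m == l then h else 1.
Proof.
suff /choice [f fP] : forall lh : 'F_p * T, exists g, lcs 2 lh.2 ->
    chi g = 0%R /\ forall m, sec g m = if m == lh.1 then lh.2 else 1.
  by exists (fun l h => f (l, h)) => l h; exact: fP (l, h).
move=> [l h]; case: (pselect (lcs 2 h)) => [/(one_point_lcs2 S) [g g0 gE]|?]; last by exists 1.
exists (g ^ (a ^+ l)) => _; split=> [|m]; first by rewrite chiJ.
by rewrite sec_rot // gE subr_eq0.
Qed.

(** The embedding of [lcs 2] at a given letter that branching provides. It is a total function by
    choice; nothing is known about its values outside [lcs 2]. *)
Definition giota : 'F_p -> T -> T := projT1 (cid iota_exists).
Local Notation iota := giota.

Lemma chi_iota l h : lcs 2 h -> chi (iota l h) = 0%R.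
Proof. by move=> hh; have [] := projT2 (cid iota_exists) l h hh. Qed.

Lemma sec_iota l h m : lcs 2 h -> sec (iota l h) m = if m == l then h else 1.
Proof. by move=> hh; have [_] := projT2 (cid iota_exists) l h hh; apply. Qed.

Lemma iota_eq g l h : lcs 2 h -> chi g = 0%R ->
  (forall m, sec g m = if m == l then h else 1) -> g = iota l h.
Proof.
move=> hh g0 gE; apply: (sec_inj (S := S)); first by rewrite chi_iota.
by move=> m; rewrite gE sec_iota.
Qed.

Lemma iotaM l h t : lcs 2 h -> lcs 2 t -> iota l (h * t) = iota l h * iota l t.
Proof.
move=> hh tt; symmetry; apply: iota_eq; first exact: lcsM.
  by rewrite chiM !chi_iota // addr0.
by move=> m; rewrite secM chi_iota // addr0 !sec_iota //; case: eqP; rewrite ?mulg1.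
Qed.

Lemma iotaV l h : lcs 2 h -> iota l h^-1 = (iota l h)^-1.
Proof.
move=> hh; symmetry; apply: iota_eq; first exact: lcsV.
  by rewrite chiV chi_iota // oppr0.
by move=> m; rewrite secV chi_iota // subr0 sec_iota //; case: eqP; rewrite ?invg1.
Qed.

Lemma iota1 l : iota l 1 = 1.
Proof. by symmetry; apply: iota_eq => [|//|m]; rewrite ?chi1 // sec1 if_same. Qed.

Lemma iotaR l h g : lcs 2 h -> chi g = 0%R -> [~ iota l h, g] = iota l [~ h, sec g l].
Proof.
move=> hh g0; apply: iota_eq; [exact/lcs_leS/lcs_comm|exact: chiR|].
move=> m; rewrite secR ?chi_iota // g0 subr0 sec_iota //.
by case: eqP => [->|_]; rewrite -commgEl // comm1g.
Qed.

Lemma iota_rot l h : lcs 2 h -> iota l h = iota 0%R h ^ (a ^+ l).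
Proof.
move=> hh; symmetry; apply: iota_eq => // [|m]; first by rewrite chiJ chi_iota.
by rewrite sec_rot ?chi_iota // sec_iota // subr_eq0.
Qed.

Lemma lcsp_iota n l h : (1 < n)%N -> lcs n h -> L n (iota l h).
Proof.
move=> n1 hn; have h2 := lcs_le n1 hn; split=> [|m]; first exact: chi_iota.
by rewrite sec_iota //; case: eqP.
Qed.

Lemma lcsp_prod n g : (1 < n)%N -> L n g -> g = \prod_l iota l (sec g l).
Proof.
move=> n1 [g0 gL]; have g2 l : lcs 2 (sec g l) by exact: lcs_le (gL l).
have K (r : seq 'F_p) : uniq r ->
    chi (\prod_(l <- r) iota l (sec g l)) = 0%R /\
    forall m, sec (\prod_(l <- r) iota l (sec g l)) m = if m \in r then sec g m else 1.
  elim: r => [|l r IH] /=; first by rewrite big_nil chi1; split=> // m; rewrite sec1.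
  move=> /andP [lr /IH [c0 cE]]; rewrite big_cons chiM chi_iota // c0 addr0.
  split=> // m; rewrite secM chi_iota // addr0 sec_iota // cE in_cons.
  by case: eqP => [->|]; rewrite ?(negbTE lr) ?mulg1 ?mul1g.
have [c0 cE] := K (index_enum 'F_p) (index_enum_uniq _).
by apply: (sec_inj (S := S)); [rewrite c0|move=> m; rewrite cE mem_index_enum].
Qed.

Section SumMap.
Variables (n : nat) (n1 : (1 < n)%N) (th : T -> plane p) (thP : coordinates n th).

Definition lsum g : plane p := (\sum_l th (sec g l))%R.

Lemma lsumM g h : L n g -> L n h -> lsum (g * h) = (lsum g + lsum h)%R.
Proof.
move=> [g0 gL] [h0 hL]; rewrite /lsum -big_split; apply: eq_bigr => l _ /=.
by rewrite secM g0 addr0 (coordM thP).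
Qed.

Lemma lsumX g i : L n g -> lsum (g ^+ i) = (lsum g *+ i)%R.
Proof.
move=> [g0 gL]; rewrite /lsum -sumrMnl; apply: eq_bigr => l _.
by rewrite secX // (coordX thP).
Qed.

Lemma secR_coord g h l : L n g ->
  th (sec [~ g, h] l) = diff (chi h) (fun m => th (sec g m)) l.
Proof.
move=> [g0 gL]; rewrite secR // (coordM thP).
- by rewrite (coordV thP) // (coordJ thP) // addrC.
- exact: lcsV.
- exact: lcs_conj.
Qed.

(* Modulo commutators every element of [L n] can be moved to the letter [0], where
   only the product of its sections matters. *)
Lemma lsum_congr M g h : is_subgroup M -> (forall g t, L n g -> M [~ g, t]) ->
  L n g -> L n h -> lsum g = lsum h -> M (g^-1 * h).
Proof.
move=> sM MR gL hL gh; have sL := lcsp_subgroup n.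
pose Q := [set g | L n g /\ M g].
have sQ : is_subgroup Q.
  split=> [|x y [xL xM] [yL yM]|x [xL xM]].
  - by split; apply: subg1.
  - by split; apply: subgM.
  - by split; apply: subgV.
have QR x t : L n x -> Q [~ x, t] by move=> xL; split; [exact: lcspR|exact: MR].
have QJ x t : Q x -> Q (x ^ t).
  by move=> Qx; rewrite -[x ^ t](mulVKg x) -commgEl; apply: subgM => //; apply: QR; case: Qx.
(* A generator [[~ y, t]] of [lcs n.+1], placed at the letter 0, is the commutator of [iota 0 y]
   with a lift of [t] that fixes the first level. *)
have Qi0 x : lcs n.+1 x -> Q (iota 0%R x).
  have sP : is_subgroup [set x | lcs 2 x /\ Q (iota 0%R x)].
    split=> [|y z [y2 Qy] [z2 Qz]|y [y2 Qy]].
    - by split=> //; rewrite iota1; apply: subg1.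
    - by split; [exact: lcsM|rewrite iotaM //; apply: subgM].
    - by split; [exact: lcsV|rewrite iotaV //; apply: subgV].
  case: n n1 QR => [//|n'] n1' QR' xx.
  have [] // : [set x | lcs 2 x /\ Q (iota 0%R x)] x.
  apply: (lcs_min sP _ xx) => y t yy; have y2 := lcs_le n1' yy.
  have [t' t'0 <-] := section_onto S t 0%R.
  split; first exact/lcs_leS/lcs_comm.
  by rewrite -iotaR //; apply: QR'; apply: lcsp_iota.
have Qi l x : lcs n x -> Q ((iota 0%R x)^-1 * iota l x).
  move=> xn; have x2 := lcs_le n1 xn.
  by rewrite (iota_rot l) // -commgEl; apply: QR; apply: lcsp_iota.
have QM x y x' y' : Q (x^-1 * x') -> Q (y^-1 * y') -> Q ((x * y)^-1 * (x' * y')).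
  move=> Qx Qy; have -> : (x * y)^-1 * (x' * y') = (x^-1 * x') ^ y * (y^-1 * y').
    by rewrite /conjg !gnorm.
  by apply: subgM => //; exact: QJ.
have Qg x : L n x -> Q ((iota 0%R (\prod_l sec x l))^-1 * x).
  move=> xL; rewrite {2}(lcsp_prod n1 xL); have [x0 xn] := xL.
  elim: (index_enum _) => [|l r IH].
    by rewrite !big_nil iota1 mulVg; apply: subg1.
  rewrite !big_cons iotaM; [|exact: lcs_le (xn l)|]; last first.
    by apply: (subg_prod _ (lcs_subgroup T 2)) => m; exact: lcs_le (xn m).
  by apply: QM => //; exact: Qi.
have sn x : L n x -> lcs n (\prod_l sec x l).
  by case=> _ xn; apply: (subg_prod _ (lcs_subgroup T n)).
have sth x : L n x -> th (\prod_l sec x l) = lsum x.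
  by case=> _ xn; rewrite (coord_prod thP).
have := eqm_coord thP (sn g gL) (sn h hL); rewrite !sth // => /(_ gh) /Qi0.
have s2 x : L n x -> lcs 2 (\prod_l sec x l) by move=> /sn; apply: lcs_le.
have gV := lcsV (s2 g gL); rewrite (iotaM _ gV (s2 h hL)) (iotaV _ (s2 g gL)) => Q0.
have [_] : Q (g^-1 * h); last by [].
rewrite -[X in Q X]mulg1 -(mulVg (iota 0%R (\prod_l sec h l))).
have := subgM sQ (subgM sQ (subgV sQ (Qg g gL)) Q0) (Qg h hL).
by rewrite !gnorm.
Qed.

Lemma lsum_mem M g h : is_subgroup M -> (forall g t, L n g -> M [~ g, t]) ->
  L n g -> L n h -> lsum g = lsum h -> M g -> M h.
Proof.
by move=> sM MR gL hL gh Mg; rewrite -(mulVKg g h); apply: subgM => //; apply: lsum_congr.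
Qed.

(** The sums of [g1] and [g2] are triangular, so in rank 2 they span the plane, while in rank 1 that
    of [g1] spans the line. Every coordinate sum is thus matched by some [g1 ^+ i * g2 ^+ j], and
    [lsum_mem] applies. *)
Lemma lsum_generates x y w M g1 g2 : basis n x y w th ->
  is_subgroup M -> (forall g t, L n g -> M [~ g, t]) ->
  L n g1 -> M g1 -> (lsum g1).1 != 0%R -> (lsum g1).2 = 0%R ->
  L n g2 -> M g2 -> (w -> (lsum g2).2 != 0%R) ->
  L n `<=` M.
Proof.
move=> B sM MR L1 M1 u1 u2 L2 M2 v2 g gL.
have lin h : L n h -> ~~ w -> (lsum h).2 = 0%R.
  move=> [_ hL] nw; rewrite /lsum (big_morph (fun z : plane p => z.2) (id1 := 0%R) (op1 := +%R)) //.
  by rewrite big1 // => l _; apply: (basis_line B).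
pose j : 'F_p := ((lsum g).2 / (lsum g2).2)%R.
pose i : 'F_p := (((lsum g).1 - j * (lsum g2).1) / (lsum g1).1)%R.
have L12 : L n (g1 ^+ i * g2 ^+ j).
  by apply: (subgM (lcsp_subgroup n)); apply: lcspX.
apply: (lsum_mem sM MR L12 gL); last by apply: subgM => //; apply: subgX.
rewrite lsumM; [|exact: lcspX..]; rewrite !lsumX // !mulrn_Fp.
have nw := lin g gL.
case: (lsum g) (lsum g1) (lsum g2) @j @i u1 u2 v2 nw {L12} => [s1 s2] [r1 r2] [q1 q2] /=.
move=> r10 -> q20 sw; rewrite /GRing.scale /GRing.add /= /scale_pair /add_pair /=.
rewrite /GRing.scale /= mulr0 add0r divfK //; congr pair; first by rewrite subrK.
by case: (w) q20 sw => [/(_ isT) q20 _|_ -> //]; rewrite ?mul0r // divfK.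
Qed.

(** Bootstrapping on the depth: if [L n] lies in [lcs j], its commutators lie in [lcs j.+1], and
    [g1], [g2] supply what is left as long as [j < i]. *)
Lemma lcsp_deep x y w i g1 g2 : basis n x y w th ->
  lcs i g1 -> L n g1 -> (lsum g1).1 != 0%R -> (lsum g1).2 = 0%R ->
  lcs i g2 -> L n g2 -> (w -> (lsum g2).2 != 0%R) ->
  L n `<=` lcs i.
Proof.
move=> B i1 L1 u1 u2 i2 L2 v2.
have : forall j, (j <= i)%N -> L n `<=` lcs j; last by apply.
elim=> [_ g _|j IH ji]; first exact: lcs0.
apply: (lsum_generates B (lcs_subgroup T j.+1) _ L1 _ u1 u2 L2 _ v2).
- by move=> g t /(IH (ltnW ji)); exact: lcs_comm.
- exact: lcs_le i1.
- exact: lcs_le i2.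
Qed.

End SumMap.

Lemma sum_comm_b n (th : T -> plane p) u : coordinates n.+1 th -> lcs n u ->
  (\sum_l th [~ u, sec b l])%R = th [~ u, c].
Proof.
move=> C un; rewrite /gc (coord_commMr C) // (coord_commXr C) //.
rewrite (bigD1 0%R) //= sec_b0 addrC.
congr (_ + _)%R; rewrite mulrn_Fp /geps scaler_suml [RHS](bigD1 0%R) //=.
rewrite ev0 scale0r add0r; apply: eq_bigr => l l0.
by rewrite sec_b // (coord_commXr C) // mulrn_Fp.
Qed.

(* If the sections of [g] agree modulo [lcs n.+2], the coordinate sum of [[~ g, h]] is
   additive in [h], hence determined by its values at [a] and [b]. *)
Lemma lsum_comm n (th : T -> plane p) g h : coordinates n.+2 th -> chi g = 0%R ->
  (forall l, lcs n.+1 (sec g l)) -> (forall l, eqm n.+2 (sec g 0%R) (sec g l)) ->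
  L n.+2 [~ g, h] /\ lsum th [~ g, h] = (chib S h *: th [~ sec g 0%R, c])%R.
Proof.
move=> C g0 gn ge; set u := sec g 0%R in ge *.
have gl l : sec [~ g, h] l =
    ((u^-1 * sec g l)^-1 * (u^-1 * sec g (l - chi h)%R)) *
    [~ sec g (l - chi h)%R, sec h (l - chi h)%R].
  by rewrite secR // /commg /conjg !gnorm.
have Lg m l : lcs n.+2 ((u^-1 * sec g m)^-1 * (u^-1 * sec g l)).
  by apply: lcsM; [apply: lcsV|]; exact: ge.
split=> [|].
  split=> [|l]; first exact: chiR.
  by rewrite gl; apply: lcsM => //; exact: lcs_comm.
have un : lcs n.+1 u by exact: gn.
pose ph h := (\sum_l th [~ u, sec h l])%R.
have -> : lsum th [~ g, h] = ph h.
  rewrite /lsum; under eq_bigr => l _.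
    rewrite gl (coordM C) //; last exact: lcs_comm.
    rewrite (coordM C); [|by apply: lcsV; exact: ge|exact: ge].
    rewrite (coordV C); last exact: ge.
    over.
  rewrite !big_split /= sumrN (sum_shift (fun l => th (u^-1 * sec g l)%g) (- chi h)%R) addNr add0r.
  rewrite (sum_shift (fun l => th [~ sec g l, sec h l]) (- chi h)%R).
  by apply: eq_bigr => l _; rewrite -(coord_comm_eqml C _ (gn 0%R) (ge l)).
have phM x y : ph (x * y) = (ph x + ph y)%R.
  rewrite /ph; under eq_bigr do rewrite secM (coord_commMr C) //.
  by rewrite big_split /= (sum_shift (fun l => th [~ u, sec y l])).
have ph1 : ph 1 = 0%R by apply: (addrI (ph 1)); rewrite addr0 -phM mulg1.
have phV x : ph x^-1 = (- ph x)%R by apply/eqP; rewrite -addr_eq0 -phM mulVg ph1.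
have phb : ph b = th [~ u, c] by exact: (sum_comm_b C un).
apply: (gen_ab S (H := [set h | ph h = (chib S h *: th [~ u, c])%R])).
- split=> [|x y /= xE yE|x /= xE]; first by rewrite /= ph1 chib1 scale0r.
    by rewrite phM xE yE chibM scalerDl.
  by rewrite phV xE chibV scaleNr.
- rewrite /= chib_a scale0r /ph big1 // => l _.
  by rewrite sec_a commg1 (coord1 C).
- by rewrite /= phb chib_b scale1r.
Qed.

(** Weighting by the letter removes the section [b], which sits at 0, and turns the exponents of [a]
    into [delta]. *)
Lemma sum_mul_comm_b n (th : T -> plane p) u : coordinates n.+1 th -> lcs n u ->
  (\sum_l l *: th [~ u, sec b l])%R = (gdelta S *: th [~ u, a])%R.
Proof.
move=> C un; rewrite /gdelta scaler_suml; apply: eq_bigr => l _.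
have [->|l0] := eqVneq l 0%R; first by rewrite !mul0r !scale0r.
by rewrite (sec_b S l0) (coord_commXr C) // mulrn_Fp scalerA.
Qed.

Lemma lsum_comm_b n (th0 th : T -> plane p) x z g (B0 sg : 'F_p) :
  coordinates n th0 -> coordinates n.+1 th -> lcs n x -> lcs n z -> L n g ->
  (forall l, th0 (sec g l) = ((B0 + l * sg) *: th0 x + th0 z)%R) ->
  L n.+1 [~ g, b] /\
  lsum th [~ g, b] =
    (B0 *: th [~ x, c] + (sg * gdelta S) *: th [~ x, a] + th [~ z, c])%R.
Proof.
move=> C0 C xn zn gL gB; have [g0 gn] := gL.
split; first by apply: lcspRS; rewrite ?chi_b.
have gl l : th (sec [~ g, b] l) =
    ((B0 + l * sg) *: th [~ x, sec b l] + th [~ z, sec b l])%R.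
  rewrite secR // chi_b subr0 -commgEl.
  have xk : lcs n (x ^+ (B0 + l * sg)%R * z) by apply: lcsM => //; exact: lcsX.
  rewrite (coord_comm_eqml C _ (gn l) (eqm_coord C0 (gn l) xk _)).
    by rewrite (coord_commMl C) ?(coord_commXl C) ?mulrn_Fp //; exact: lcsX.
  by rewrite gB (coordM C0) ?(coordX C0) ?mulrn_Fp //; exact: lcsX.
rewrite /lsum; under eq_bigr do rewrite gl scalerDl.
rewrite !big_split /= -scaler_sumr (sum_comm_b C xn) (sum_comm_b C zn); congr (_ + _ + _)%R.
rewrite -scalerA -(sum_mul_comm_b C) // scaler_sumr; apply: eq_bigr => l _.
by rewrite scalerA mulrC.
Qed.

End CoordinatewiseSeries.

(** * Index sequences *)

Section Indices.
Variables (p : nat) (p2 : (2 < p)%N).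
Local Open Scope nat_scope.

Definition step k := p * (k - 1) - 1.

Definition twodim i : bool := `[< exists m, ell p m <= i < rseq p m >].

Lemma ellSS m : ell p m.+2 = step (ell p m.+1). Proof. by []. Qed.
Lemma rseqSS m : rseq p m.+2 = step (rseq p m.+1). Proof. by []. Qed.

Lemma step_le j k : j <= k -> step j <= step k.
Proof.
by move=> jk; rewrite /step; apply: leq_sub2r; rewrite leq_mul2l leq_sub2r ?orbT.
Qed.

Lemma step3 : step 3 = p.*2.-1. Proof. rewrite /step; lia. Qed.

Lemma stepS k : 1 < k -> step k.+1 = step k + p.
Proof. case: k => [|[|k]] // _; rewrite /step; nia. Qed.

Lemma step_gt k : 3 <= k -> k.+1 < step k.
Proof. case: k => [|[|[|k]]] // _; rewrite /step; nia. Qed.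

Lemma step_ge k : 3 <= k -> step 3 <= step k. Proof. exact: step_le. Qed.

Lemma step_p j : p <= j -> p <= step j.
Proof.
move=> pj; apply: leq_trans (step_le pj); rewrite /step.
have : p * 2 <= p * (p - 1) by rewrite leq_mul2l; lia.
lia.
Qed.

Lemma ell_ge m : p <= ell p m.+1.
Proof. by elim: m => [|m IH]; rewrite ?leqnn // ellSS; exact: step_p. Qed.

Lemma twodim1 : twodim 1. Proof. by apply/asboolP; exists 0. Qed.
Lemma twodim_p : twodim p. Proof. by apply/asboolP; exists 1; rewrite /= leqnn ltnSn. Qed.

Lemma twodim_small i : 1 < i -> i < p -> ~~ twodim i.
Proof.
move=> i1 ip; apply/asboolP => -[[|m]]; first by rewrite /=; lia.
by have := ell_ge m; lia.
Qed.

Lemma twodim_mid i : p < i -> i < step 3 -> ~~ twodim i.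
Proof.
rewrite step3 => i1 ip; apply/asboolP => -[[|[|m]]]; [rewrite /=; lia..|].
rewrite ellSS => /andP[m1 _]; have := step_le (leq_trans p2 (ell_ge m)).
rewrite step3; lia.
Qed.

(** Both [ell] and [rseq] evolve by [step], which is monotone, so the block attached to [k] inherits
    the rank of [k]. *)
Lemma twodim_step k i : 3 <= k -> step k <= i < step k.+1 -> twodim i = twodim k.
Proof.
move=> k3 /andP[ki ik]; have i3 := leq_trans (step_ge k3) ki; rewrite step3 in i3.
have lt j l : step j < step l -> j < l.
  by move=> jl; rewrite ltnNge; apply/negP => /step_le; lia.
apply/asboolP/asboolP => -[m /andP[m1 m2]].
  case: m m1 m2 => [|[|m]]; [rewrite /=; lia..|rewrite ellSS rseqSS => m1 m2].
  exists m.+1; rewrite -ltnS; apply/andP; split; apply: lt; lia.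
case: m m1 m2 => [|m] m1 m2; first by move: m2 => /=; lia.
exists m.+2; rewrite ellSS rseqSS; have := step_le m1; have := step_le m2.
lia.
Qed.

End Indices.

Section IndexGaps.
Variables (p : nat) (p3 : (2 < p)%N).
Local Open Scope nat_scope.

Lemma step_lt j k : step p j < step p k -> j < k.
Proof. by move=> jk; rewrite ltnNge; apply/negP => /(step_le p); lia. Qed.

Lemma step_floor i : step p 3 <= i -> exists2 k, 3 <= k & step p k <= i < step p k.+1.
Proof.
elim: i => [|i IH]; first by rewrite (step3 p3); lia.
rewrite leq_eqVlt => /orP[/eqP <-|]; first by exists 3; rewrite // leqnn (@stepS p p3 3) //; lia.
rewrite ltnS => /IH [k k3 /andP[ki ik]].
have [E|ne] := eqVneq i.+1 (step p k.+1); last by exists k => //; lia.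
exists k.+1; first exact: leqW.
by rewrite E leqnn (@stepS p p3 k.+1) //; lia.
Qed.

Lemma rseq_gt m : p < rseq p m.+1.
Proof.
elim: m => [|m IH]; first exact: leqnn.
by rewrite rseqSS; apply: leq_trans (step_le p IH); rewrite /step; nia.
Qed.

(** Descent on [m]: beyond [step p 3], an index in this gap lies in the block of some [k] in the
    preceding gap. *)
Lemma twodim_gap m i : rseq p m <= i < ell p m.+1 -> ~~ twodim p i.
Proof.
elim: m i => [|m IH] i /andP[ri ie]; first exact: twodim_small.
have [i3|i3] := ltnP i (step p 3).
  by apply: twodim_mid => //; exact: leq_trans (rseq_gt m) ri.
have [k k3 ki] := step_floor i3; rewrite (twodim_step p3 k3 ki).
case: m IH ri ie => [|m] IH ri ie.
  apply: twodim_small => //; first exact: ltnW.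
  by apply: step_lt; move: ie; rewrite ellSS -[ell p 1]/p; lia.
apply: IH; apply/andP; split.
  by rewrite -ltnS; apply: step_lt; move: ri; rewrite rseqSS; lia.
by apply: step_lt; move: ie; rewrite ellSS; lia.
Qed.

(** This makes [gy] restart at [ell p m.+1] from a commutator with [b]. The index before [step p j]
    is the last one in the block of [j.-1]. *)
Lemma twodim_ell_pred m : ~~ twodim p (ell p m.+1).-1.
Proof.
elim: m => [|m IH]; first by apply: twodim_small => //=; lia.
rewrite ellSS; have := ell_ge p3 m; move: IH; move: (ell p m.+1) => j IH pj.
have [j3|j3] := leqP j 3.
  have -> : j = 3 by lia.
  by apply: twodim_mid => //; rewrite (step3 p3); lia.
have sj : step p j = step p j.-1 + p by rewrite -(@stepS p p3 j.-1) ?prednK //; lia.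
rewrite (@twodim_step p p3 j.-1) ?prednK //; lia.
Qed.

End IndexGaps.

(** * The generators of the lower central factors *)

Section Sequences.
Variables (p : nat) (T : groupType) (S : ggs_group p T).
Local Notation a := (ga S).
Local Notation b := (gb S).
Local Notation c := (gc S).
Local Notation chi := (chi S).
Local Notation sec := (sec S).
Local Notation pr := (p_pr S).
Local Notation L := (lcsp S).
Local Notation iota := (giota S).
Local Notation w := (twodim p).
Local Notation eps := (geps S).
Implicit Types (g h t : T) (k l m d : 'F_p) (n i j : nat).

Definition gx n : T := comm_iter b c n.-1.

(* [gy n] is the element y_ell(m)(n) of the paper if [ell p m <= n < rseq p m], and
   [1] if there is no such [m]. *)
Fixpoint gy n : T :=
  if n isn't n'.+1 then 1 else
  if n' is 0 then a else
  if ~~ w n then 1 else if w n' then [~ gy n', c] else [~ gx n', b].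

Lemma gyS n : gy n.+2 =
  if ~~ w n.+2 then 1 else if w n.+1 then [~ gy n.+1, c] else [~ gx n.+1, b].
Proof. by []. Qed.

Lemma gxS n : gx n.+2 = [~ gx n.+1, c]. Proof. by []. Qed.

Lemma lcs_gx n : lcs n (gx n).
Proof. by case: n => [|n]; [exact: lcs0|exact: (@lcs_iter _ 1)]. Qed.

Lemma lcs_gy n : lcs n (gy n).
Proof.
elim: n => [|[|n] IH] //; rewrite gyS.
by do 2!case: ifP => // _; apply: lcs_comm => //; exact: lcs_gx.
Qed.

Lemma gy1 n : (1 < n)%N -> ~~ w n -> gy n = 1.
Proof. by case: n => [|[|n]] // _ nw; rewrite gyS nw. Qed.

(* Junk value [0] as long as no basis is known to exist. *)
Definition gth n : T -> plane p :=
  if pselect (exists th : T -> plane p, basis n (gx n) (gy n) (w n) th) is left ex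
  then projT1 (cid ex) else fun=> 0%R.
Local Notation th := gth.

Definition good n := basis n (gx n) (gy n) (w n) (th n).

Lemma goodP n : (exists th : T -> plane p, basis n (gx n) (gy n) (w n) th) -> good n.
Proof.
by move=> ex; rewrite /good /gth; case: pselect => // ex'; exact: projT2 (cid ex').
Qed.

Lemma basis_uniq n x y v (th1 th2 : T -> plane p) g : basis n x y v th1 ->
  basis n x y v th2 -> lcs n g -> th1 g = th2 g :> plane p.
Proof.
move=> B1 B2 gn; have := basis_expand B1 gn.
move=> /(coord_eqm B2 gn) ->; have [C _ _ _ _ ln] := B1.
have lX := @lcsX T n x (th1 g).1 (basis_lx B1).
have lY := @lcsX T n y (th1 g).2 (basis_ly B1).
rewrite (coordM B2 lX lY) (coordX B2 _ (basis_lx B1)) (coordX B2 _ (basis_ly B1)).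
rewrite (basis_x B2) (basis_y B2).
rewrite !mulrn_Fp plane_expand // => nv; exact: ln.
Qed.

Lemma good1 : good 1.
Proof. by apply: goodP; exists (theta1 S); rewrite twodim1; exact: theta1_basis. Qed.

Lemma th1E g : th 1 g = (chib S g, chi g).
Proof.
by rewrite (basis_uniq good1 (th2 := theta1 S)) //; rewrite twodim1; exact: theta1_basis.
Qed.

Lemma th_x n : good n -> th n (gx n) = (1, 0)%R.
Proof. exact: basis_x. Qed.

Lemma chi_gx n : chi (gx n) = 0%R.
Proof. by rewrite /gx; case: n.-1 => [|j] /=; [exact: chi_b|exact: chiR]. Qed.

(** Commutation with [c] induces a homomorphism to the next factor, so independence can be pulled
    back from the last index of a block. *)
Lemma indep_pred n (X Y : T) v : (0 < n)%N -> lcs n X -> lcs n Y ->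
  (forall u z : 'F_p, lcs n.+2 ([~ X, c] ^+ u * [~ Y, c] ^+ z) -> u = 0%R /\ (v -> z = 0%R)) ->
  forall u z : 'F_p, lcs n.+1 (X ^+ u * Y ^+ z) -> u = 0%R /\ (v -> z = 0%R).
Proof.
move=> n0 XL YL H u z /(lcs_comm c) K; apply: H.
apply: (eqm_mem (leqnn _) _ K).
apply: eqm_trans (eqm_commM _ _ _) _; first exact: lcsX.
by apply: eqmM; apply: eqm_commX.
Qed.

Section Difference.
Variables (n : nat) (thn : T -> plane p) (C : coordinates n thn).

Lemma comm_iter_coord g j l : L n g ->
  L n (comm_iter g c j) /\
  thn (sec (comm_iter g c j) l) = iter j (diff eps) (fun m => thn (sec g m)) l.
Proof.
move=> gL; elim: j l => [//|j IH] l; have [jL _] := IH l.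
split; first exact: lcspR.
rewrite /comm_iter iterS -/(comm_iter g c j) (secR_coord C) // chi_c /=.
by congr (diff _ _ _); apply/funext => m; have [] := IH m.
Qed.

Lemma comm_iter_const g l : L n g ->
  thn (sec (comm_iter g c p.-1) l) = lsum S thn g.
Proof.
move=> gL; have [_ ->] := comm_iter_coord p.-1 l gL.
by rewrite (iter_diff_sum pr) ?geps_neq0.
Qed.

Lemma comm_const_affine g u : L n g -> (forall l, thn (sec [~ g, c] l) = u) ->
  forall l, thn (sec g l) = (thn (sec g 0%R) - (l / eps) *: u)%R.
Proof.
move=> gL gu; apply: (diff_const (f := fun m => thn (sec g m)) (geps_neq0 S)) => l.
by rewrite -(gu l) (secR_coord C) // chi_c.
Qed.

(* The coordinates of the sections are a polynomial function of the letter, of degree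
   at most [j], whose [j]th difference lies in [Lin]. *)
Definition polyn (Lin : plane p -> Prop) j g := L n g /\
  exists2 u, Lin u & forall l, iter j (diff 1%R) (fun m => thn (sec g m)) l = u.

Lemma polyn_subgroup (Lin : plane p -> Prop) j : Lin 0%R ->
  (forall u v, Lin u -> Lin v -> Lin (u + v)%R) -> (forall u, Lin u -> Lin (- u)%R) ->
  is_subgroup (polyn Lin j).
Proof.
move=> Lin0 LinD LinN; have sL := lcsp_subgroup S n.
have itD f1 f2 l : iter j (diff 1%R) (fun m => (f1 m + f2 m)%R) l =
    (iter j (diff 1%R) f1 l + iter j (diff 1%R) f2 l)%R :> plane p.
  elim: j l => [//|i IH] l; rewrite !iterS /diff !IH.
  by rewrite opprD addrACA.
have itN f l : iter j (diff 1%R) (fun m => - f m)%R l =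
    (- iter j (diff 1%R) f l)%R :> plane p.
  elim: j l {itD} => [//|i IH] l; rewrite !iterS /diff !IH.
  by rewrite opprD.
have it0 l : iter j (diff 1%R) (fun=> 0%R) l = 0%R :> plane p.
  by elim: j l {itD itN} => [//|i IH] l; rewrite iterS /diff !IH subrr.
split=> [|g h [gL [u Lu uE]] [hL [v Lv vE]]|g [gL [u Lu uE]]].
- split; first exact: subg1.
  exists 0%R => // l; rewrite -[RHS](it0 l); congr (iter _ _ _ l).
  by apply/funext => m; rewrite sec1 (coord1 C).
- split; first exact: subgM.
  exists (u + v)%R => [|l]; first exact: LinD.
  rewrite -(uE l) -(vE l) -itD; congr (iter _ _ _ l); apply/funext => m.
  by have [g0 gn] := gL; have [_ hn] := hL; rewrite secM g0 addr0 (coordM C).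
- split; first exact: subgV.
  exists (- u)%R => [|l]; first exact: LinN.
  rewrite -(uE l) -itN; congr (iter _ _ _ l); apply/funext => m.
  by have [g0 gn] := gL; rewrite secV g0 subr0 (coordV C).
Qed.

(** Commutation with [h] is a difference of step [chi h]: it lowers the degree by one and scales the
    top difference by [chi h]. *)
Lemma polyn_comm (Lin : plane p -> Prop) j g h : (forall k u, Lin u -> Lin (k *: u)%R) ->
  polyn Lin j.+1 g -> polyn Lin j [~ g, h].
Proof.
move=> LinZ [gL [u Lu uE]]; split; first exact: lcspR.
set F := iter j (diff 1%R) (fun m => thn (sec g m)).
have FE l : F l = (F 0 - (l / 1) *: u)%R.
  by apply: diff_const => [|m]; [exact: oner_neq0|exact: uE].
exists (chi h *: u)%R => [|l]; first exact: LinZ.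
have -> : (fun m => thn (sec [~ g, h] m)) = diff (chi h) (fun m => thn (sec g m)).
  by apply/funext => m; rewrite (secR_coord C).
rewrite iter_diffC -/F -(diff_affine (F 0%R) u (chi h) l); congr (diff _ _ _).
by apply/funext => m; rewrite FE divr1.
Qed.

Lemma polyn_chain (Lin : plane p -> Prop) i j r : (0 < i)%N -> Lin 0%R ->
  (forall u v, Lin u -> Lin v -> Lin (u + v)%R) -> (forall k u, Lin u -> Lin (k *: u)%R) ->
  lcs i `<=` polyn Lin (r + j) -> lcs (i + r) `<=` polyn Lin j.
Proof.
move=> i0 Lin0 LinD LinZ; have LinN u : Lin u -> Lin (- u)%R.
  by move=> /(LinZ (-1)%R); rewrite scaleN1r.
elim: r j => [|r IH] j H; first by rewrite addn0.
rewrite addnS; case: i i0 H IH => [//|i] _ H IH; rewrite addSn.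
apply: lcs_min; first exact: polyn_subgroup.
move=> g h gg; apply: polyn_comm => //; apply: IH => //.
by rewrite addnS.
Qed.

End Difference.

Lemma comm_iter_pred (x y : T) r : (0 < r)%N ->
  comm_iter x y r = [~ comm_iter x y r.-1, y].
Proof. by case: r. Qed.

(* Produces elements of [L n.+1] with prescribed coordinate sum, deep in the series. *)
Lemma deep_iter n (th0 thn : T -> plane p) g : (1 < n)%N ->
  coordinates n th0 -> coordinates n.+1 thn ->
  lcs n g -> L n.+1 (comm_iter (iota 0%R g) c p) /\
  lsum S thn (comm_iter (iota 0%R g) c p) = thn [~ g, c].
Proof.
move=> n1 C0 C gn; have gL := lcsp_iota S 0%R n1 gn.
have [hL _] := comm_iter_coord C0 p.-1 0%R gL.
set h := comm_iter (iota 0%R g) c p.-1 in hL *.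
(* The first [p - 1] commutations spread [g] evenly from the letter 0 over all letters, so that
   [lsum_comm] evaluates the last one. *)
have hE l : th0 (sec h l) = th0 g.
  rewrite (comm_iter_const C0) // /lsum (bigD1 0%R) //= sec_iota ?eqxx; last exact: lcs_le gn.
  rewrite big1 ?addr0 // => m m0; rewrite sec_iota ?(negbTE m0) ?(coord1 C0) //.
  exact: lcs_le gn.
have -> : comm_iter (iota 0%R g) c p = [~ h, c].
  exact: comm_iter_pred (prime_gt0 pr).
have [h0 hn] := hL; move: h hL hE h0 hn {gL} => h _ hE h0 hn.
case: n n1 C0 C gn hn => [//|n] n1 C0 C gn hn.
have [|RL RE] := lsum_comm c C h0 hn.
  by move=> l; apply: (eqm_coord C0) => //; rewrite !hE.
split=> //; rewrite RE /gc chibM chibX chib_a chib_b mul0rn add0r scale1r -/c.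
by rewrite (coord_comm_scale (k := 1%R) C _ C0 (hn _) gn) ?scale1r ?hE.
Qed.

(* Here the rank rises from 1 to 2: the affine term [l * s] contributes
   [s * \sum_l l * e_l = s * delta] to the second coordinate. *)
Lemma switch n X (B0 s : 'F_p) : (0 < n)%N -> good n -> good n.+1 ->
  w n.+1 -> ~~ w n -> L n X -> s != 0%R ->
  (forall l, th n (sec X l) = ((B0 + l * s) *: (1, 0))%R) ->
  L n.+1 [~ X, b] /\ (lsum S (th n.+1) [~ X, b]).2 != 0%R.
Proof.
move=> n0 Gn Gn1 w1 w0 XL s0 XE.
have [|RL ->] := @lsum_comm_b _ _ S n (th n) (th n.+1) (gx n) 1 X B0 s
  Gn Gn1 (lcs_gx n) (@lcs_1 _ _) XL.
  by move=> l; rewrite XE th_x // (coord1 Gn) addr0.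
split=> //; rewrite comm1g (coord1 Gn1) addr0.
case: n n0 Gn Gn1 w0 w1 {XE RL XL} => [//|n] _ Gn Gn1 w0 w1.
have xx : th n.+2 [~ gx n.+1, c] = (1, 0)%R by rewrite -gxS; apply: th_x.
have := basis_y Gn1; rewrite gyS w1 (negbTE w0) /= => yy.
(* As [c = a ^+ eps * b], [eps] times the class of [[x, a]] is [[x, c] - [x, b]], the difference of
   the two basis elements of this factor. *)
have xa : th n.+2 [~ gx n.+1, a] = (eps^-1 *: ((1, 0) - (0, 1)))%R.
  apply: (scalerI (geps_neq0 S)); rewrite scalerA divff ?geps_neq0 // scale1r.
  rewrite -yy -xx /gc (coord_commMr Gn1); last exact: lcs_gx.
  rewrite addrK (coord_commXr Gn1); last exact: lcs_gx.
  by rewrite mulrn_Fp.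
rewrite xx xa plane2Z plane2D plane2N /GRing.scale /= mulr0 !add0r mulrN1 mulrN oppr_eq0.
by rewrite !mulf_neq0 ?invr_neq0 ?gdelta_neq0 ?geps_neq0.
Qed.

End Sequences.

(** * Factors of index at most p *)

Section FirstLevel.
Variables (p : nat) (T : groupType) (S : ggs_group p T).
Local Notation a := (ga S).
Local Notation b := (gb S).
Local Notation c := (gc S).
Local Notation e := (ev S).
Local Notation chi := (chi S).
Local Notation chib := (chib S).
Local Notation sec := (sec S).
Local Notation pr := (p_pr S).
Local Notation L := (lcsp S).
Local Notation w := (twodim p).
Local Notation eps := (geps S).
Local Notation delta := (gdelta S).
Local Notation x := (gx S).
Local Notation y := (gy S).
Local Notation th := (gth S).
Local Notation good := (good S).
Implicit Types (g h t : T) (k l m d : 'F_p) (n i j : nat).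

Let p3 : (2 < p)%N := p_gt2 S.

Lemma gx_pred n : (1 < n)%N -> x n = [~ x n.-1, c].
Proof. by case: n => [|[|n]]. Qed.

Lemma gy_pred n : (1 < n)%N -> y n =
  if ~~ w n then 1 else if w n.-1 then [~ y n.-1, c] else [~ x n.-1, b].
Proof. by case: n => [|[|n]]. Qed.

Lemma chib_c : chib c = 1%R.
Proof. by rewrite /gc chibM chibX chib_a chib_b mul0rn add0r. Qed.

(* The sections determine each other: [chi] of them is the convolution of [chib] of them
   with the defining vector. *)
Lemma chi_sec_conv g l : chi (sec g l) = (\sum_m chib (sec g m) * e (l - m))%R.
Proof.
apply: (gen_ab S (H := [set g | forall l, chi (sec g l) = (\sum_m chib (sec g m) * e (l - m))%R]))
  => [|m|m].
- have HM g1 g2 : (forall l, chi (sec g1 l) = (\sum_m chib (sec g1 m) * e (l - m))%R) ->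
      (forall l, chi (sec g2 l) = (\sum_m chib (sec g2 m) * e (l - m))%R) ->
      forall l, chi (sec (g1 * g2) l) = (\sum_m chib (sec (g1 * g2) m) * e (l - m))%R.
    move=> E1 E2 m; rewrite secM chiM E1 E2.
    rewrite -(sum_shift (fun d => chib (sec g2 d) * e (m + chi g1 - d))%R (chi g1)).
    rewrite -big_split; apply: eq_bigr => d _ /=.
    by rewrite secM chibM mulrDl opprD addrACA subrr addr0.
  split=> [m|g1 g2 E1 E2|g1 E1 m].
  + by rewrite sec1 chi1 big1 // => d _; rewrite sec1 chib1 mul0r.
  + exact: HM.
  rewrite secV chiV E1 -(sum_shift (fun d => chib (sec g1 d) * e (m - chi g1 - d))%R (- chi g1)%R).
  rewrite -sumrN; apply: eq_bigr => d _.
  by rewrite secV chibV mulNr opprD addrACA subrr addr0.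
- by rewrite sec_a chi1 big1 // => d _; rewrite sec_a chib1 mul0r.
- rewrite (bigD1 0%R) //= sec_b0 chib_b mul1r subr0 big1 ?addr0 => [|d d0].
    by have [->|m0] := eqVneq m 0%R; rewrite ?sec_b0 ?chi_b ?ev0 // sec_b // chi_aX.
  by rewrite sec_b // chibX chib_a mul0rn mul0r.
Qed.

Lemma sum_chib_sec g : (\sum_m chib (sec g m))%R = chib g.
Proof.
apply: (mulfI (geps_neq0 S)); rewrite geps_chib.
under [RHS]eq_bigr do rewrite chi_sec_conv.
rewrite exchange_big mulr_sumr; apply: eq_bigr => m _ /=.
by rewrite -mulr_sumr (sum_shift e) mulrC.
Qed.

Lemma th1_c : th 1 c = (1, eps)%R.
Proof. by rewrite th1E chib_c chi_c. Qed.

Lemma lsum_th1 g : lsum S (th 1) g = (chib g *: th 1 c)%R.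
Proof.
rewrite th1_c /lsum; apply: plane_eq; rewrite ?plane_sum1 ?plane_sum2.
  under eq_bigr do rewrite th1E.
  by rewrite sum_chib_sec plane1Z /= mulr1.
under eq_bigr do rewrite th1E.
by rewrite plane2Z /= mulrC geps_chib.
Qed.

Lemma th1_const g k : (forall m, chib (sec g m) = k) ->
  forall l, th 1 (sec g l) = (k *: th 1 c)%R.
Proof.
move=> gk l; rewrite th1_c th1E gk chi_sec_conv.
apply: plane_eq; rewrite ?plane1Z ?plane2Z /= ?mulr1 //.
under eq_bigr do rewrite gk.
rewrite -mulr_sumr; congr (_ * _)%R; rewrite (reindex_inj oppr_inj) /=.
by under eq_bigr do rewrite opprK addrC; exact: sum_shift.
Qed.

Let C1 : coordinates 1 (th 1) := good1 S.

Lemma lcsp_1 g : chi g = 0%R -> L 1 g. Proof. by []. Qed.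

(** [x p] is [b] commuted [p - 1] times with [c], so each of its sections has the sum over the
    sections of [b] as coordinates. *)
Lemma gx_p_sec l : th 1 (sec (x p) l) = th 1 c.
Proof.
rewrite /gx (comm_iter_const C1); last exact/lcsp_1/chi_b.
by rewrite lsum_th1 chib_b scale1r.
Qed.

(** One commutation with [c] gives constant sections [c], so the [chib] of the sections is affine in
    [l]. Convolution with the defining vector then forces their [chi], and the moment [delta] leaves
    the offset [a ^+ (delta / eps)]. *)
Lemma gx_pred_p_sec : exists B0 : 'F_p, forall l,
  th 1 (sec (x p.-1) l) =
    ((B0 + l * (- eps^-1)) *: th 1 c + th 1 (a ^+ (delta / eps)%R))%R.
Proof.
set X := x p.-1.
have XE : forall l, th 1 (sec X l) = (th 1 (sec X 0%R) - (l / eps) *: th 1 c)%R.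
  apply: (comm_const_affine C1) => [|l]; first exact/lcsp_1/chi_gx.
  by rewrite -(gx_p_sec l) gx_pred // ltnW.
exists (chib (sec X 0%R)) => l; rewrite XE mulrN scalerBl addrAC; congr (_ - _)%R.
rewrite th1_c !th1E chibX chib_a mul0rn chi_aX; apply: plane_eq;
  rewrite ?plane1D ?plane1Z ?plane2D ?plane2Z /= ?mulr1 ?addr0 //.
rewrite chi_sec_conv (reindex_inj oppr_inj) /=.
have XB m : chib (sec X m) = (chib (sec X 0%R) - m / eps)%R.
  have := congr1 (fun z : plane p => z.1) (XE m).
  by rewrite th1_c !th1E plane1D plane1N plane1Z /= mulr1.
rewrite (eq_bigr (fun m => chib (sec X 0%R) * e m + eps^-1 * (m * e m)))%R => [|m _].
  by rewrite big_split /= -!mulr_sumr [(eps^-1 * _)%R]mulrC.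
by rewrite (XB (- m)%R) sub0r opprK mulNr opprK mulrDl mulrA [(eps^-1 * m)%R]mulrC.
Qed.

Lemma gx_pred_p_sec_affine : exists u : plane p, forall l,
  th 1 (sec (x p.-1) l) = (u + (l * (- eps^-1)) *: th 1 c)%R.
Proof.
have [B0 E] := gx_pred_p_sec; exists (B0 *: th 1 c + th 1 (a ^+ (delta / eps)%R))%R.
by move=> l; rewrite E scalerDl addrAC.
Qed.

(** On [lcs 2] the coordinate sum, which is the [(p - 1)]st difference, vanishes, so the degree is
    at most [p - 2]. *)
Lemma lcs2_polyn : lcs 2 `<=` polyn S 1 (th 1) (fun=> True) p.-2.
Proof.
move=> g /(lcs2P S) [g0 g1]; split; first exact: lcsp_1.
pose G := iter p.-2 (diff 1%R) (fun m => th 1 (sec g m)).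
exists (G 0%R) => // l; rewrite -/G.
apply: (@diff0_const _ _ 1%R) => [|m]; first exact: oner_neq0.
rewrite -[LHS]/(iter p.-2.+1 (diff 1%R) (fun m => th 1 (sec g m)) m) prednK; last by lia.
rewrite (iter_diff_sum pr) ?oner_neq0 //.
by rewrite -[LHS]/(lsum S (th 1) g) lsum_th1 g1 scale0r.
Qed.

Lemma lcs_p_const g : lcs p g ->
  chi g = 0%R /\ forall l, th 1 (sec g l) = (chib (sec g 0%R) *: th 1 c)%R.
Proof.
have pE : (2 + p.-2 = p)%N by lia.
have H : lcs (2 + p.-2) `<=` polyn S 1 (th 1) (fun=> True) 0.
  by apply: polyn_chain => //; rewrite addn0; exact: lcs2_polyn.
move: H; rewrite pE => H.
move=> /H [[g0 _] [u _ gu]]; split=> // l.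
apply: th1_const => m; have := gu m; rewrite -(gu 0%R) /= !th1E.
by move=> /(congr1 (fun z : plane p => z.1)).
Qed.

Definition gens n := generates n [set x n; y n].

Lemma gens_succ n (A : set T) : (0 < n)%N -> A `<=` lcs n -> generates n A ->
  (forall M, is_subgroup M -> lcs n.+2 `<=` M -> M (x n.+1) -> M (y n.+1) ->
    forall s, A s -> M [~ s, b] /\ M [~ s, c]) -> gens n.+1.
Proof.
move=> n0 An gA H M sM sub MA; apply: (generates_succ (@gen_bc _ _ S) An gA n0 sM sub) => s As.
by apply: H => //; apply: MA; [left|right].
Qed.

Lemma gens2 : gens 2.
Proof.
apply: (@gens_succ 1 [set b; c]) => //.
  by move=> M sM _ MA g _; apply: (gen_bc (S := S)) => //; apply: MA; [left|right].
move=> M sM _ Mx _ _ [->|->]; rewrite !commgg.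
  by split=> //; exact: subg1.
by split; [rewrite -invgR; exact: subgV|exact: subg1].
Qed.

Lemma indep_x n r : (0 < n)%N ->
  (forall u : 'F_p, lcs (n + r).+1 (x (n + r) ^+ u) -> u = 0%R) ->
  forall u : 'F_p, lcs n.+1 (x n ^+ u) -> u = 0%R.
Proof.
elim: r n => [|r IH] n n0; first by rewrite addn0.
rewrite addnS -addSn => /(IH n.+1 isT) H u xu; apply: H.
have -> : x n.+1 = [~ x n, c] by case: (n) n0.
apply: (eqm_mem (leqnn _) (eqm_commX _ _ (lcs_gx S n))); exact: lcs_comm.
Qed.

Lemma good_onedim n : (1 < n)%N -> ~~ w n -> gens n ->
  (forall u : 'F_p, lcs n.+1 (x n ^+ u) -> u = 0%R) -> good n.
Proof.
move=> n1 nw gn H; apply: goodP; apply: basis_exists => //.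
- exact: pr.
- exact: ltnW.
- exact: lcs_gx.
- exact: lcs_gy.
- by move=> g; apply: (lcs_exp S); exact: ltnW.
- by move=> _; rewrite gy1.
move=> u v; rewrite gy1 // expg1n mulg1 => /H ->; split=> // ww.
by rewrite ww in nw.
Qed.

(** It suffices to treat [x p.-1]: its sections vary with the letter modulo [lcs 2], those of
    elements of [lcs p] do not. *)
Lemma gx_indep_small n : (1 < n)%N -> (n < p)%N ->
  forall u : 'F_p, lcs n.+1 (x n ^+ u) -> u = 0%R.
Proof.
move=> n1 np; apply: (@indep_x n (p.-1 - n)); first exact: ltnW.
have -> : (n + (p.-1 - n))%N = p.-1 by lia.
move=> u; rewrite prednK ?prime_gt0 ?pr // => /lcs_p_const [_ E].
have [A AB] := gx_pred_p_sec_affine.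
have FE l : th 1 (sec (x p.-1 ^+ u) l) = (u *: (A + (l * (- eps^-1)) *: th 1 c))%R.
  by rewrite secX ?chi_gx // (coordX C1) // AB mulrn_Fp.
have := E 1%R; rewrite -(E 0%R) !FE; apply: affine_const_eq0.
  by rewrite oppr_eq0 invr_neq0 ?geps_neq0.
by rewrite th1_c; apply: fst_neq0; exact: oner_neq0.
Qed.

Lemma good2 : good 2.
Proof.
by apply: good_onedim => //; [exact: twodim_small|exact: gens2|exact: gx_indep_small].
Qed.

Lemma good_coord2 : coordinates 2 (th 2). Proof. exact: good2. Qed.
Let C2 := good_coord2.

(** Expansion of [[~ c, c] = 1] in its right entry. *)
Lemma th2_c_a : th 2 [~ c, a] = (eps^-1 *: (1, 0))%R.
Proof.
apply: (scalerI (geps_neq0 S)); rewrite scalerA divff ?geps_neq0 // scale1r.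
have xx : th 2 [~ b, c] = (1, 0)%R by exact: th_x good2.
have := commgg c; rewrite {2}/gc => /(congr1 (th 2)).
rewrite (coord1 C2) (coord_commMr C2) // (coord_commXr C2) // mulrn_Fp.
rewrite -[[~ c, b]]invgR (coordV C2) ?xx; last exact: (lcs_gx S 2).
by move=> /eqP; rewrite subr_eq0 => /eqP.
Qed.

Definition yp := [~ x p.-1, b].

Lemma gy_p : y p = yp.
Proof.
rewrite gy_pred ?(ltnW p3) // twodim_p /= ifN //; apply: twodim_small => //; lia.
Qed.

(** The slope [- eps^-1] and the offset [a ^+ (delta / eps)] of the sections of [x p.-1] each
    contribute [- delta / eps ^+ 2]. *)
Lemma lsum_yp : L 2 yp /\ lsum S (th 2) yp = (- (2%:R * delta / eps ^+ 2) *: (1, 0))%R.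
Proof.
have [B0 E] := gx_pred_p_sec.
have [RL RE] := lsum_comm_b C1 C2 (lcs1 c) (lcs1 _) (lcsp_1 (chi_gx S _)) E.
split=> //; rewrite RE commgg (coord1 C2) scaler0 add0r.
rewrite (coord_commXl C2) // mulrn_Fp.
rewrite -[[~ a, c]]invgR (coordV C2); last exact: lcs_comm.
rewrite th2_c_a scalerN -scaleNr -scalerDl scalerA; congr (_ *: _)%R.
by have := geps_neq0 S => e0; field.
Qed.

Lemma lsum_yp1 : (lsum S (th 2) yp).1 != 0%R.
Proof.
rewrite lsum_yp.2 plane1Z /= mulr1 oppr_eq0 !mulf_neq0 ?gdelta_neq0 ?(two_neq0 S) //.
by rewrite invr_eq0 expf_neq0 ?geps_neq0.
Qed.

Lemma lcs_yp : lcs p yp.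
Proof. by rewrite -gy_p; exact: lcs_gy. Qed.

Lemma lcsp2_lcs : L 2 `<=` lcs p.
Proof.
apply: (lcsp_deep (ltnSn 1) C2 good2 lcs_yp lsum_yp.1 lsum_yp1 _ (lcs_1 T p)).
- by rewrite lsum_yp.2 plane2Z mulr0.
- exact: (subg1 (lcsp_subgroup S 2)).
- by rewrite (negbTE (twodim_small p3 (ltnSn 1) p3)).
Qed.

Lemma gens_small n : (1 < n)%N -> (n <= p)%N -> gens n.
Proof.
elim: n => [//|[//|[_|n IH]] _ np]; first exact: gens2.
apply: (gens_succ _ _ (IH isT (ltnW np))) => //.
  by move=> _ [->|->]; [exact: lcs_gx|exact: lcs_gy].
have w2 : ~~ w n.+2 by exact: twodim_small.
move=> M sM sub Mx My _ [->|->]; rewrite ?gxS ?gy1 ?comm1g //; last by split; exact: subg1.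
split; last by rewrite -gxS.
have [pn|pn] := eqVneq n.+3 p.
  have wn : w n.+3 by rewrite pn twodim_p.
  by move: My; rewrite gyS wn (negbTE w2).
apply: sub; apply: (lcs_le _ (lcsp2_lcs _)); first by lia.
by apply: lcspRS; [exact: (lcsp_1 (chi_gx S n.+2))|exact: chi_b].
Qed.

Lemma good_small n : (1 < n)%N -> (n < p)%N -> good n.
Proof.
move=> n1 np; apply: good_onedim => //; [exact: twodim_small|exact: gens_small (ltnW np)|].
exact: gx_indep_small.
Qed.

(** All sections of an element of [lcs p] are congruent to the same power of [c], and [[~ c, c] =
    1], so its commutators have coordinate sum 0. *)
Lemma lcs_pS_lsum g : lcs p.+1 g -> L 2 g /\ lsum S (th 2) g = 0%R.
Proof.
have sK : is_subgroup [set g | L 2 g /\ lsum S (th 2) g = 0%R].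
  have sL := lcsp_subgroup S 2; split=> [|u v [uL u0] [vL v0]|u [uL u0]].
  - split; first exact: subg1.
    by rewrite /lsum big1 // => l _; rewrite sec1 (coord1 C2).
  - split; first exact: subgM.
    by rewrite (lsumM C2) // u0 v0 addr0.
  - split; first exact: subgV.
    have := lsumM C2 (subgV sL uL) uL; rewrite mulVg u0 addr0 => <-.
    by rewrite /lsum big1 // => l _; rewrite sec1 (coord1 C2).
have := @lcs_min T p.-1 _ sK; rewrite prednK ?prime_gt0 ?pr // => H; apply: H.
move=> {}g h /lcs_p_const [g0 gE].
have gn l : eqm 2 (sec g 0%R) (sec g l) by apply: (eqm_coord C1) => //; rewrite !gE.
have [RL RE] := lsum_comm h C2 g0 (fun l => lcs1 _) gn.
split=> //; rewrite RE (coord_comm_scale C2 _ C1 _ _ (gE 0%R)) //.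
by rewrite commgg (coord1 C2) !scaler0.
Qed.

(** The two generators are seen at different depths: the sections of [x p] are non-trivial modulo
    [lcs 2], whereas those of [yp] lie in [lcs 2] and its coordinate sum is non-zero. *)
Lemma good_p : good p.
Proof.
have gn : gens p by exact: gens_small (ltnW p3) (leqnn p).
apply: goodP; apply: basis_exists => //.
- exact: pr.
- exact: ltnW (ltnW p3).
- exact: lcs_gx.
- exact: lcs_gy.
- by move=> g; apply: (lcs_exp S); exact: ltnW (ltnW p3).
- by rewrite (twodim_p p).
move=> u v; rewrite gy_p => /lcs_pS_lsum [uL uE].
have [yL yE] := lsum_yp; have y0 := yL.1.
have u0 : u = 0%R.
  have := uL.2 0%R; rewrite secM secX ?chi_gx // chiX chi_gx mul0rn addr0 secX //.
  move=> /(coord_ker C1 (lcs1 _)).2; rewrite (coordM C1) // !(coordX C1) //.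
  have /(coord_ker C1 (lcs1 _)) -> := yL.2 0%R; rewrite mul0rn addr0.
  rewrite gx_p_sec mulrn_Fp th1_c => /(congr1 (fun z : plane p => z.1)).
  by rewrite plane1Z /= mulr1.
split=> // _; move: uE; rewrite u0 mul1g (lsumX C2) // yE mulrn_Fp.
move=> /(congr1 (fun z : plane p => z.1)) /eqP.
have := lsum_yp1; rewrite yE !plane1Z => K.
by rewrite mulf_eq0 (negbTE K) orbF => /eqP.
Qed.

End FirstLevel.

(** * Factors between p and 2p - 1 *)

Section SecondLevel.
Variables (p : nat) (T : groupType) (S : ggs_group p T).
Local Notation b := (gb S).
Local Notation c := (gc S).
Local Notation chi := (chi S).
Local Notation sec := (sec S).
Local Notation pr := (p_pr S).
Local Notation L := (lcsp S).
Local Notation w := (twodim p).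
Local Notation eps := (geps S).
Local Notation delta := (gdelta S).
Local Notation x := (gx S).
Local Notation th := (gth S).
Local Notation good := (good S).
Implicit Types (g h t : T) (k l m d : 'F_p) (n i j : nat).

Let p3 : (2 < p)%N := p_gt2 S.

Let C1 : coordinates 1 (th 1) := good1 S.
Let C2 : coordinates 2 (th 2) := good_coord2 S.
Local Notation yp := (yp S).
Local Notation one := ((1, 0)%R : plane p).

Lemma w2 : ~~ w 2. Proof. exact: twodim_small. Qed.

Lemma cX_sec n l : th 1 (sec (c ^+ n) l) = (\sum_(i < n) th 1 (sec c (l - (- eps) *+ i)))%R.
Proof.
elim: n => [|n IH]; first by rewrite big_ord0 sec1 (coord1 C1).
rewrite expgSr secM (coordM C1) // IH big_ord_recr /=.
by rewrite chiX chi_c mulNrn opprK.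
Qed.

(** [c ^+ p] and [x p] both have all sections congruent to [c], so they differ by an element of
    [L 2], which lies in [lcs p]. *)
Lemma cX_lcs3 : lcs 3 (c ^+ p).
Proof.
have sec_cp l : th 1 (sec (c ^+ p) l) = th 1 c.
  rewrite cX_sec (sum_orbit pr (fun m => th 1 (sec c m))) ?oppr_eq0 ?geps_neq0 //.
  under eq_bigr do rewrite sec_c.
  rewrite (sum_shift (fun m => th 1 (sec b m))) -[LHS]/(lsum S (th 1) b).
  by rewrite lsum_th1 chib_b scale1r.
have chi_cp : chi (c ^+ p) = 0%R by rewrite chiX -mulr_natr (pchar_Fp_0 pr) mulr0.
apply: (lcs_le p3); rewrite -(mulVKg (x p) (c ^+ p)); apply: lcsM; first exact: lcs_gx.
apply: (lcsp2_lcs (S := S)); split=> [|l]; first by rewrite chiM chiV chi_gx oppr0 chi_cp addr0.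
apply/(coord_ker C1) => //; rewrite secM (coordM C1) // secV (coordV C1) // chiV chi_gx.
by rewrite gx_p_sec oppr0 addr0 sec_cp addNr.
Qed.

Let W := x p.-1.
Let D := x p.

Let chiW : chi W = 0%R := chi_gx S _.
Let chiD : chi D = 0%R := chi_gx S _.

Lemma gx_p_comm : D = [~ W, c]. Proof. by apply: gx_pred; lia. Qed.

Lemma sec_D l : sec D l = (sec W l)^-1 * sec W (l - eps)%R ^ sec b l.
Proof. by rewrite gx_p_comm secR ?chiW // chi_c sec_c subrK. Qed.

Lemma lcs2_D l : lcs 2 (c^-1 * sec D l).
Proof. by apply: (eqm_coord C1) => //; rewrite gx_p_sec. Qed.

Lemma lcs2_W l : lcs 2 ((sec W l * c)^-1 * sec W (l - eps)%R).
Proof.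
apply: (eqm_coord C1) => //; have [B0 E] := gx_pred_p_sec S.
rewrite (coordM C1) // !E addrAC; congr (_ + _)%R.
rewrite -{2}(scale1r (th 1 c)) -scalerDl; congr (_ *: _)%R.
by have := geps_neq0 S => e0; field.
Qed.

(* Along the cycle [0, - eps, - 2 eps, ...] the factors multiply up to [c ^- p]. *)
Lemma sum_W : (\sum_l th 2 ((sec W l * c)^-1 * sec W (l - eps)%R)%g)%R = 0%R.
Proof.
pose rho n := (sec W 0%R * c ^+ n)^-1 * sec W (0 - eps *+ n)%R.
pose mu l := (sec W l * c)^-1 * sec W (l - eps)%R.
have rhoS n : rho n.+1 = rho n ^ c * mu (0 - eps *+ n)%R.
  rewrite /rho /mu expgSr (mulrSr eps n) opprD addrA.
  by rewrite /conjg !gnorm.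
have rho_sum n : lcs 2 (rho n) /\ th 2 (rho n) = (\sum_(i < n) th 2 (mu (0 - eps *+ i)))%R.
  elim: n => [|n [rL IH]].
    by rewrite /rho expg0 mulg1 subr0 mulVg big_ord0 (coord1 C2).
  have mL : lcs 2 (mu (0 - eps *+ n)%R) by exact: lcs2_W.
  rewrite rhoS (coordM C2) //; last exact: lcs_conj.
  by split; [apply: lcsM => //; exact: lcs_conj|rewrite (coordJ C2) // IH big_ord_recr].
rewrite -(sum_orbit pr (fun l => th 2 (mu l)) 0%R (geps_neq0 S)) -(rho_sum p).2.
apply/(coord_ker C2); first exact: (rho_sum p).1.
rewrite /rho -mulr_natr (pchar_Fp_0 pr) mulr0 subr0 invgM -mulgA mulVg mulg1.
by apply: lcsV; exact: cX_lcs3.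
Qed.

(** Writing [D] as [[~ W, c]] splits the sum into [sum_W], which is 0, the sum for [yp = [~ W, b]],
    and the class of [[~ c, c]]. *)
Lemma sum_D : (\sum_l th 2 (c^-1 * sec D l)%g)%R = lsum S (th 2) yp.
Proof.
pose mu l := (sec W l * c)^-1 * sec W (l - eps)%R.
have E l : c^-1 * sec D l = mu l * [~ sec W (l - eps)%R, sec b l].
  by rewrite sec_D /mu /commg /conjg !gnorm.
have F l : th 2 (c^-1 * sec D l)%g =
    (th 2 (mu l) + (th 2 [~ sec W l, sec b l] + th 2 [~ c, sec b l]))%R.
  rewrite E (coordM C2); [|exact: lcs2_W|exact: lcs_comm]; congr (_ + _)%R.
  rewrite -(coord_comm_eqml C2 (g := sec W l * c) _ (lcs1 _) (lcs2_W l)).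
  by rewrite (coord_commMl C2).
under eq_bigr do rewrite F.
rewrite !big_split /= sum_W add0r (sum_comm_b S C2) // commgg (coord1 C2) addr0.
by apply: eq_bigr => l _; rewrite secR ?chiW // chi_b subr0 -commgEl.
Qed.

(** Summation by parts gives [eps] times [sum_D] plus [delta] times the class of [[~ c, a]], that is
    [- 2 delta / eps + delta / eps]. *)
Lemma moment_gx_pS :
  (\sum_l l *: th 2 (sec (x p.+1) l))%R = (- (delta / eps) *: one)%R.
Proof.
have xE : x p.+1 = [~ D, c] by apply: (@gx_pred _ _ S p.+1); lia.
pose nn l := th 2 (c^-1 * sec D l)%g.
have E l : th 2 (sec (x p.+1) l) = (nn (l - eps) - nn l + th 2 [~ c, sec b l])%R.
  have -> : sec (x p.+1) l =
      (c^-1 * sec D l)^-1 * (c^-1 * sec D (l - eps)%R) * [~ sec D (l - eps)%R, sec b l].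
    by rewrite xE secR ?chiD // chi_c sec_c subrK /commg /conjg !gnorm.
  have L1 := lcs2_D l; have L2 := lcs2_D (l - eps)%R; have L3 := lcsV L1.
  rewrite (coordM C2) //; [|exact: lcsM|exact: lcs_comm].
  rewrite (coordM C2) // (coordV C2) // addrC [in RHS]addrC [(- _ + _)%R]addrC; congr (_ + _)%R.
  by rewrite (coord_comm_eqml C2 _ _ L2).
under eq_bigr do rewrite E.
rewrite (moment_diff nn) (sum_mul_comm_b S C2 (lcs1 c)).
have -> : (\sum_l nn l)%R = lsum S (th 2) yp := sum_D.
rewrite (lsum_yp S).2 th2_c_a !scalerA -scalerDl; congr (_ *: _)%R.
by have := geps_neq0 S => e0; field.
Qed.

(** [step p 3] is [2p - 1], so [p - 2] commutations lead here from [x p.+1]. The coordinate sum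
    there is 0, hence the result is the moment divided by [eps]. *)
Lemma gx_last_const l : th 2 (sec (x (step p 3)) l) = (- (delta / eps ^+ 2) *: one)%R.
Proof.
have [xL x0] := lcs_pS_lsum S (lcs_gx S p.+1).
have -> : x (step p 3) = comm_iter (x p.+1) c p.-2.
  rewrite (step3 p3) /gx /comm_iter -iterD; congr iter; lia.
have [_ ->] := comm_iter_coord C2 p.-2 l xL.
rewrite (iter_diff_moment pr _ (ltnW p3) (geps_neq0 S)) //.
rewrite moment_gx_pS scalerA; congr (_ *: _)%R.
by have := geps_neq0 S => e0; field.
Qed.

Lemma lcs_last_const g : lcs (step p 3) g -> L 2 g /\
  exists u : 'F_p, forall l, th 2 (sec g l) = (u *: one)%R.
Proof.
have H : lcs p.+1 `<=` polyn S 2 (th 2) (fun=> True) (p.-2 + 0).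
  move=> {}g /(lcs_pS_lsum S) [gL g0]; split=> //; rewrite addn0.
  pose G := iter p.-2 (diff 1%R) (fun m => th 2 (sec g m)).
  exists (G 0%R) => // l; rewrite -/G.
  apply: (@diff0_const _ _ 1%R) => [|m]; first exact: oner_neq0.
  rewrite -[LHS]/(iter p.-2.+1 (diff 1%R) (fun m => th 2 (sec g m)) m) prednK; last by lia.
  by rewrite (iter_diff_sum pr) ?oner_neq0.
have K : lcs (p.+1 + p.-2) `<=` polyn S 2 (th 2) (fun=> True) 0.
  by apply: polyn_chain H.
have E : (p.+1 + p.-2)%N = step p 3 by rewrite (step3 p3); lia.
move: K; rewrite E => K /K [gL [u _ gu0]]; split=> //; exists u.1 => l.
have gu m : th 2 (sec g m) = u by exact: gu0 m.
rewrite (gu l); apply: plane_line.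
by rewrite -(gu l); apply: (basis_line (good2 S) w2); exact: gL.2.
Qed.

Lemma affine_of_const X u : L 2 X -> (forall l, th 2 (sec [~ X, c] l) = (u *: one)%R) ->
  exists B0 : 'F_p, forall l, th 2 (sec X l) = ((B0 + l * (- (u / eps))) *: one)%R.
Proof.
move=> XL XE; have XA := comm_const_affine C2 XL XE.
exists (th 2 (sec X 0%R)).1 => l; rewrite XA scalerA mulrN scalerBl mulrA mulrAC.
congr (_ - _)%R; apply: plane_line.
by apply: (basis_line (good2 S) w2); exact: XL.2.
Qed.

Lemma indep_last X u : L 2 X -> u != 0%R ->
  (forall l, th 2 (sec [~ X, c] l) = (u *: one)%R) ->
  forall v : 'F_p, lcs (step p 3) (X ^+ v) -> v = 0%R.
Proof.
move=> XL u0 XE v /lcs_last_const [_ [k vE]]; have [B0 XA] := affine_of_const XL XE.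
have FE l : th 2 (sec (X ^+ v) l) = (v *: (B0 *: one + (l * (- (u / eps))) *: one))%R.
  by rewrite secX ?XL.1 // (coordX C2 _ (XL.2 _)) XA mulrn_Fp scalerDl.
have := vE 1%R; rewrite -(vE 0%R) !FE; apply: affine_const_eq0 (plane_one_neq0 p).
by rewrite oppr_eq0 mulf_neq0 ?invr_neq0 ?geps_neq0.
Qed.

Lemma indep_iter n X r : lcs n X ->
  (forall u : 'F_p, lcs (n + r).+1 (comm_iter X c r ^+ u) -> u = 0%R) ->
  forall u : 'F_p, lcs n.+1 (X ^+ u) -> u = 0%R.
Proof.
elim: r => [|r IH] XL; first by rewrite addn0.
rewrite addnS => H; apply: IH => // u xu; apply: H.
apply: (eqm_mem (leqnn _) (eqm_commX _ _ (lcs_iter _ _ XL))); exact: lcs_comm.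
Qed.

Let z j := comm_iter yp c j.

Lemma z_lcs j : lcs (p + j) (z j). Proof. by apply: lcs_iter; exact: lcs_yp. Qed.
Lemma z_L j : L 2 (z j). Proof. by have [] := comm_iter_coord C2 j 0%R (lsum_yp S).1. Qed.

Lemma z_last l : th 2 (sec [~ z p.-2, c] l) = ((lsum S (th 2) yp).1 *: one)%R.
Proof.
rewrite -[[~ _, c]]/(z p.-2.+1) prednK; last by lia.
rewrite (comm_iter_const C2 _ (lsum_yp S).1).
by apply: plane_line; rewrite (lsum_yp S).2 plane2Z mulr0.
Qed.

Lemma good3 : good 3.
Proof.
have [p3'|p4] := eqVneq p 3%N; last by apply: good_small => //; lia.
by rewrite -p3'; exact: good_p.
Qed.

End SecondLevel.

(** * Generators between p and 2p - 1, and the base of the induction *)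

Section SecondLevelIndices.
Variables (p : nat) (T : groupType) (S : ggs_group p T).
Local Notation b := (gb S).
Local Notation c := (gc S).
Local Notation sec := (sec S).
Local Notation L := (lcsp S).
Local Notation iota := (giota S).
Local Notation w := (twodim p).
Local Notation eps := (geps S).
Local Notation delta := (gdelta S).
Local Notation x := (gx S).
Local Notation y := (gy S).
Local Notation th := (gth S).
Local Notation good := (good S).
Implicit Types (g h t : T) (k l m d : 'F_p) (n i j : nat).

Let p3 : (2 < p)%N := p_gt2 S.

Let C2 : coordinates 2 (th 2) := good_coord2 S.
Local Notation yp := (yp S).
Local Notation one := ((1, 0)%R : plane p).
Local Notation z j := (comm_iter yp c j).

(* The induction hypothesis at the start of the block of indices attached to [n.+1]. *)
Definition invariant n := [/\ L n.+1 `<=` lcs (step p n.+1),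
  forall g, lcs (step p n.+1) g -> L n g /\
    exists u : 'F_p, forall l, th n (sec g l) = (u *: one)%R,
  exists2 u : 'F_p, u != 0%R & forall l, th n (sec (x (step p n.+1)) l) = (u *: one)%R,
  L n.+1 (y (step p n.+1)) &
  w n.+1 -> (lsum S (th n.+1) (y (step p n.+1))).2 != 0%R].

Lemma deep_gx n i : (1 < n)%N -> good n -> good n.+1 -> L n `<=` lcs i ->
  let g := comm_iter (iota 0%R (x n)) c p in
  [/\ lcs (i + p) g, L n.+1 g & lsum S (th n.+1) g = one].
Proof.
move=> n1 Gn Gn1 Li g; have [gL ->] := deep_iter S n1 Gn Gn1 (lcs_gx S n).
split=> //.
  by apply: lcs_iter; apply: Li; apply: lcsp_iota => //; exact: lcs_gx.
by rewrite -(@gx_pred _ _ S n.+1) ?th_x // ltnW.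
Qed.

(** The first coordinate comes from [deep_gx]. The second is present only if [w 3], that is for
    [p = 3], and then comes from [switch] applied to the affine element [z p.-2]. *)
Lemma lcsp3_lcs : L 3 `<=` lcs (step p 3).
Proof.
have [gl gL gs] := deep_gx (ltnSn 1) (good2 S) (good3 S) (@lcsp2_lcs _ _ S).
have [B0 zA] := affine_of_const (z_L S p.-2) (z_last S).
apply: (lcsp_deep (isT : 1 < 3)%N (good3 S) (good3 S) _ gL (g2 := [~ z p.-2, b])).
- by apply: lcs_le gl; rewrite (step3 p3); lia.
- by rewrite gs; exact: (oner_neq0 'F_p).
- by rewrite gs.
- have -> : step p 3 = (p + p.-2).+1 by rewrite (step3 p3); lia.
  by apply: lcs_comm; exact: z_lcs.
- by apply: lcspRS; [exact: z_L|exact: chi_b].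
move=> w3; have s0 : (- ((lsum S (th 2) yp).1 / eps) != 0)%R.
  by rewrite oppr_eq0 mulf_neq0 ?invr_neq0 ?geps_neq0 ?lsum_yp1.
by have [] := switch (isT : 0 < 2)%N (good2 S) (good3 S) w3 (w2 S) (z_L S p.-2) s0 zA.
Qed.

Lemma lcsp2_pS : lcs p.+1 `<=` L 2.
Proof. by move=> g /(lcs_pS_lsum S) []. Qed.

Lemma gx_L2 n : (p < n)%N -> L 2 (x n).
Proof. by move=> pn; apply: lcsp2_pS; apply: lcs_le (lcs_gx S n). Qed.

Lemma gx_indep_mid n : (p < n)%N -> (n < step p 3)%N ->
  forall u : 'F_p, lcs n.+1 (x n ^+ u) -> u = 0%R.
Proof.
move=> pn ns; have ps : (p < (step p 3).-1)%N by rewrite (step3 p3); lia.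
apply: (@indep_x _ _ S n ((step p 3).-1 - n)); first by lia.
have -> : (n + ((step p 3).-1 - n) = (step p 3).-1)%N by lia.
rewrite prednK; last by lia.
apply: (@indep_last _ _ S _ (- (delta / eps ^+ 2))%R (gx_L2 ps)) => [|l].
  by rewrite oppr_eq0 mulf_neq0 ?invr_neq0 ?expf_neq0 ?geps_neq0 ?gdelta_neq0.
by rewrite -gx_pred ?gx_last_const //; lia.
Qed.

(** As [yp] spans [L 2] modulo deeper terms, [M] contains every commutator of an element of [L 2].
    Modulo these an element of [L 2] is determined by its coordinate sum, which is 0 on
    [lcs p.+1]. *)
Lemma generates_z1 : generates p.+1 [set z 1; 1].
Proof.
move=> M sM sub MA; have Mz : M [~ yp, c] by apply: MA; left.
have Myb : M [~ yp, b].
  apply: sub; apply: (lcs_le _ (lcsp3_lcs _)); first by rewrite (step3 p3); lia.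
  by apply: lcspRS; [exact: (lsum_yp S).1|exact: chi_b].
pose M' := [set g | lcs p g /\ forall h, M [~ g, h]].
have sM' : is_subgroup M' by exact: subgroup_comml.
have Ly := lcs_yp S.
have M'y : M' yp by split=> // h; exact: (gen_bc (S := S) (subgroup_commr sM sub Ly)).
have M'1 g : lcs p.+1 g -> M' g.
  by move=> gg; split=> [|h]; [exact: lcs_leS|apply: sub; exact: lcs_comm].
have LM' : L 2 `<=` M'.
  apply: (lsum_generates (isT : 1 < 2)%N C2 (good2 S) sM' _ (lsum_yp S).1 M'y (lsum_yp1 S) _
    (subg1 (lcsp_subgroup S 2)) (subg1 sM')).
  - by move=> g t gL; apply: M'1; apply: lcs_comm; exact: (lcsp2_lcs (S := S)).
  - by rewrite (lsum_yp S).2 plane2Z mulr0.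
  - by rewrite (negbTE (w2 S)).
move=> g /(lcs_pS_lsum S) [gL g0].
apply: (lsum_mem (isT : 1 < 2)%N C2 sM _ (subg1 (lcsp_subgroup S 2)) gL) => [h t hL||].
- by have [_] := LM' h hL; apply.
- by rewrite g0 /lsum big1 // => l _; rewrite sec1 (coord1 C2).
- exact: subg1.
Qed.

(** The direct argument yields the generator [[~ yp, c]] instead of [x p.+1]. It shows that the
    factor has order [p], and [x p.+1] is non-trivial in it, hence also a generator. *)
Lemma gens_pS : gens S p.+1.
Proof.
have zi : forall u : 'F_p, lcs p.+2 (z 1 ^+ u) -> u = 0%R.
  have zL : lcs p.+1 (z 1) by rewrite -addn1; exact: z_lcs.
  apply: (@indep_iter _ _ S p.+1 (z 1) p.-2.-1 zL).
  have -> : (p.+1 + p.-2.-1).+1 = step p 3 by rewrite (step3 p3); lia.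
  have -> : comm_iter (z 1) c p.-2.-1 = z p.-2 by rewrite /comm_iter -iterD; congr iter; lia.
  by apply: (indep_last (z_L S _) _ (z_last S)); exact: lsum_yp1.
have [thz B] : exists thz : T -> plane p, basis p.+1 (z 1) 1 false thz.
  apply: basis_exists => //.
  - exact: p_pr S.
  - by rewrite -addn1; exact: z_lcs.
  - exact: generates_z1.
  - by move=> g; exact: lcs_exp.
  - by move=> u v; rewrite expg1n mulg1 => /zi ->.
have xL := lcs_gx S p.+1; move=> M sM sub MA; have Mx : M (x p.+1) by apply: MA; left.
have [r rE] : exists r : 'F_p, thz (x p.+1) = (r *: one)%R.
  exists (thz (x p.+1)).1; apply: plane_line; exact: (basis_line B).
have r0 : r != 0%R.
  apply/eqP => r0; have : lcs p.+2 (x p.+1 ^+ (1%R : 'F_p)).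
    by rewrite (expF1 p); apply/(coord_ker B) => //; rewrite rE r0 scale0r.
  have ps : (p.+1 < step p 3)%N by rewrite (step3 p3); lia.
  by move=> /(gx_indep_mid (ltnSn p) ps) /eqP; rewrite oner_eq0.
apply: generates_z1 => // _ [->|->]; last exact: subg1.
have zx : eqm p.+2 (x p.+1 ^+ (r^-1 : 'F_p)%R) (z 1).
  apply: (eqm_coord B); [exact: lcsX|exact: basis_lx B|].
  by rewrite (coordX B _ xL) rE mulrn_Fp scalerA (mulVf r0) scale1r (basis_x B).
rewrite -(mulVKg (x p.+1 ^+ (r^-1 : 'F_p)%R) (z 1)).
by apply: subgM => //; [exact: subgX|exact: sub].
Qed.

Lemma gens_mid n : (p < n)%N -> (n < step p 3)%N -> gens S n.
Proof.
elim: n => [//|n IH]; rewrite ltnS leq_eqVlt => /orP[/eqP <- _|pn ns]; first exact: gens_pS.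
apply: (gens_succ _ _ (IH pn (ltnW ns))) => //; first by lia.
  by move=> _ [->|->]; [exact: lcs_gx|exact: lcs_gy].
have wn : ~~ w n by apply: twodim_mid => //; exact: ltnW.
have y1 : y n = 1 by apply: gy1 => //; lia.
move=> M sM sub Mx My _ [->|->]; last by rewrite y1 !comm1g; split; exact: subg1.
split; last by rewrite -(@gx_pred _ _ S n.+1) //; lia.
apply: sub; apply: (lcs_le ns); apply: lcsp3_lcs; apply: lcspRS; last exact: chi_b.
exact: gx_L2.
Qed.

Lemma good_mid n : (p < n)%N -> (n < step p 3)%N -> good n.
Proof.
move=> pn ns; apply: good_onedim; [lia|exact: twodim_mid|exact: gens_mid|exact: gx_indep_mid].
Qed.

Lemma invariant2 : invariant 2.
Proof.
have ps : (p < (step p 3).-1)%N by rewrite (step3 p3); lia.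
have s1 : (1 < step p 3)%N by rewrite (step3 p3); lia.
have w3 : w (step p 3) = w 3.
  by apply: twodim_step => //; rewrite leqnn (@stepS p p3 3) //; lia.
split.
- exact: lcsp3_lcs.
- exact: lcs_last_const.
- exists (- (delta / eps ^+ 2))%R; last exact: gx_last_const.
  by rewrite oppr_eq0 mulf_neq0 ?invr_neq0 ?expf_neq0 ?geps_neq0 ?gdelta_neq0.
- rewrite gy_pred // w3; case: ifP => _; first exact: (subg1 (lcsp_subgroup S 3)).
  rewrite ifN; last by apply: twodim_mid => //; lia.
  by apply: lcspRS; [exact: gx_L2|exact: chi_b].
move=> w3'; rewrite gy_pred // w3 w3' /= ifN; last by apply: twodim_mid => //; lia.
have xc l : th 2 (sec [~ x (step p 3).-1, c] l) = (- (delta / eps ^+ 2) *: one)%R.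
  by rewrite -gx_pred // gx_last_const.
have [B0 XA] := affine_of_const (gx_L2 ps) xc.
have s0 : (- (- (delta / eps ^+ 2) / eps) != 0)%R.
  by rewrite mulNr opprK !mulf_neq0 ?invr_neq0 ?expf_neq0 ?geps_neq0 ?gdelta_neq0.
by have [] := switch (isT : 0 < 2)%N (good2 S) (good3 S) w3' (w2 S) (gx_L2 ps) s0 XA.
Qed.

End SecondLevelIndices.

(** * The inductive step *)

Section InductiveStep.
Variables (p : nat) (T : groupType) (S : ggs_group p T).
Local Notation b := (gb S).
Local Notation c := (gc S).
Local Notation e := (ev S).
Local Notation chi := (chi S).
Local Notation chib := (chib S).
Local Notation sec := (sec S).
Local Notation L := (lcsp S).
Local Notation w := (twodim p).
Local Notation eps := (geps S).
Local Notation x := (gx S).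
Local Notation y := (gy S).
Local Notation th := (gth S).
Local Notation good := (good S).
Implicit Types (g h t : T) (k l m d : 'F_p) (n i j : nat).

Let p3 : (2 < p)%N := p_gt2 S.

Local Notation one := ((1, 0)%R : plane p).

Variable n0 : nat.
Hypothesis n0_gt0 : (0 < n0)%N.
Let n := n0.+1.
Let k := n.+1.
Let q := step p k.
Hypotheses (Gn : good n) (Gk : good k) (Gk1 : good k.+1) (inv : invariant S n).

Let Cn : coordinates n (th n) := Gn.
Let Ck : coordinates k (th k) := Gk.
Let Ck1 : coordinates k.+1 (th k.+1) := Gk1.
Let k1 : (1 < k)%N. Proof. by []. Qed.
Let k2 : (2 < k)%N. Proof. by rewrite /k /n; lia. Qed.
Let qp : step p k.+1 = (q + p)%N. Proof. exact: stepS. Qed.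
Let q1 : (1 < q)%N. Proof. by have := step_gt p3 k2; rewrite -/q; lia. Qed.

Let wq i : (q <= i)%N -> (i < q + p)%N -> w i = w k.
Proof. by move=> qi iq; apply: twodim_step => //; rewrite -/q qi qp. Qed.

Let wqp : w (q + p) = w k.+1.
Proof.
rewrite -qp; apply: (twodim_step p3 (leqW k2)).
by rewrite leqnn (@stepS p p3 k.+1) //; lia.
Qed.

Let xq : exists2 u : 'F_p, u != 0%R & forall h, L k [~ x q, h] /\
  lsum S (th k) [~ x q, h] = (chib h *: (u *: one))%R.
Proof.
have [_ H2 [u u0 xE] _ _] := inv; exists u => // h.
have [xL _] := H2 _ (lcs_gx S q); have [x0 xn] := xL.
have xc l : eqm k (sec (x q) 0%R) (sec (x q) l).
  by apply: (eqm_coord Cn) => //; rewrite !xE.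
have [RL ->] := lsum_comm h Ck x0 xn xc; split=> //; congr (_ *: _)%R.
rewrite (coord_comm_scale Ck _ Cn (xn _) (lcs_gx S n) (k := u)); last by rewrite xE (th_x Gn).
by rewrite -(@gx_pred _ _ S k) // (th_x Gk).
Qed.

(** Elements of [lcs q] have constant sections, congruent to a power of [x n], so their commutators
    have coordinate sum a multiple of the class of [[~ x n, c] = x k]. *)
Let lcs_q1 g : lcs q.+1 g -> L k g /\ (lsum S (th k) g).2 = 0%R.
Proof.
have sL := lcsp_subgroup S k; have lsum1 : lsum S (th k) 1 = 0%R.
  by rewrite /lsum big1 // => l _; rewrite sec1 (coord1 Ck).
have sK : is_subgroup [set g | L k g /\ (lsum S (th k) g).2 = 0%R].
  split=> [|u v [uL u0] [vL v0]|u [uL u0]].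
  - by split; [exact: subg1|rewrite lsum1].
  - by split; [exact: subgM|rewrite (lsumM Ck) // plane2D u0 v0 addr0].
  - split; first exact: subgV.
    have := lsumM Ck (subgV sL uL) uL; rewrite mulVg lsum1.
    by move=> /(congr1 (fun v : plane p => v.2)); rewrite plane2D u0 addr0.
have := @lcs_min T q.-1 _ sK; rewrite prednK ?(ltnW q1) // => H; apply: H => {}g h gg.
have [_ /(_ g gg) [[g0 gn] [u gE]] _ _ _] := inv.
have gc l : eqm k (sec g 0%R) (sec g l) by apply: (eqm_coord Cn) => //; rewrite !gE.
have [RL RE] := lsum_comm h Ck g0 gn gc; split=> //; rewrite RE.
rewrite (coord_comm_scale Ck _ Cn (gn _) (lcs_gx S n) (k := u)); last by rewrite gE (th_x Gn).
by rewrite -(@gx_pred _ _ S k) // (th_x Gk) !plane2Z !mulr0.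
Qed.

Let lcs_qp g : lcs (q + p) g -> L k g /\
  exists u : 'F_p, forall l, th k (sec g l) = (u *: one)%R.
Proof.
have H : lcs q.+1 `<=` polyn S k (th k) (fun u => u.2 = 0%R) (p.-1 + 0).
  move=> {}g /lcs_q1 [gL g2]; split=> //; rewrite addn0.
  by exists (lsum S (th k) g) => // l; rewrite (iter_diff_sum (p_pr S)) ?oner_neq0.
have K : lcs (q.+1 + p.-1) `<=` polyn S k (th k) (fun u => u.2 = 0%R) 0.
  apply: polyn_chain H => // [u v u0 v0|l u u0].
    by rewrite plane2D u0 v0 addr0.
  by rewrite plane2Z u0 mulr0.
have E : (q.+1 + p.-1 = q + p)%N by lia.
move: K; rewrite E => K /K [gL [u u2 gu]]; split=> //; exists u.1 => l.
have -> : th k (sec g l) = u by exact: gu.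
exact: plane_line.
Qed.

Let Lq : L k `<=` lcs q. Proof. by have [] := inv. Qed.
Let xL i : (q < i)%N -> L k (x i).
Proof. by move=> qi; have [] := lcs_q1 (lcs_le qi (lcs_gx S i)). Qed.

Let yqL : L k (y q). Proof. by have [] := inv. Qed.
Let yL i : (q <= i)%N -> L k (y i).
Proof.
rewrite leq_eqVlt => /orP[/eqP <- //|qi].
by have [] := lcs_q1 (lcs_le qi (lcs_gy S i)).
Qed.

Let yS i : (q <= i)%N -> (i.+1 < q + p)%N -> y i.+1 = [~ y i, c].
Proof.
move=> qi ip; rewrite gy_pred /=; last by lia.
rewrite !wq //; [|lia..]; case: (boolP (w k)) => // wk.
by rewrite gy1 ?comm1g ?wq //; lia.
Qed.

Let xS i : (q <= i)%N -> x i.+1 = [~ x i, c].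
Proof. by move=> qi; rewrite (@gx_pred _ _ S i.+1) //; lia. Qed.

Let x_iter j : x (q.+1 + j) = comm_iter (x q.+1) c j.
Proof.
elim: j => [|j IH]; first by rewrite addn0.
by rewrite addnS xS ?IH //; lia.
Qed.

Let y_iter j : (j < p)%N -> y (q + j) = comm_iter (y q) c j.
Proof.
elim: j => [|j IH] jp; first by rewrite addn0.
by rewrite addnS yS ?IH //; lia.
Qed.

Let x_last : exists2 u : 'F_p, u != 0%R & forall l, th k (sec (x (q + p)) l) = (u *: one)%R.
Proof.
have [u u0 H] := xq; exists u => // l.
have -> : (q + p = q.+1 + p.-1)%N by lia.
have [cL cE] := H c; rewrite x_iter (comm_iter_const Ck _ (xL (ltnSn q))).
by rewrite xS // cE chib_c scale1r.
Qed.

Let y_last l : th k (sec (y (q + p.-1)) l) = lsum S (th k) (y q).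
Proof. by rewrite y_iter; [exact: (comm_iter_const Ck)|lia]. Qed.

Let x_affine : exists (B0 : plane p) (u : 'F_p), u != 0%R /\
  forall l, th k (sec (x (q + p.-1)) l) = (B0 + (l * u) *: one)%R.
Proof.
have [u u0 uE] := x_last; have pE : (q + p = (q + p.-1).+1)%N by lia.
have XL : L k (x (q + p.-1)) by apply: xL; lia.
have XE l : th k (sec [~ x (q + p.-1), c] l) = (u *: one)%R by rewrite -xS -?pE //; lia.
exists (th k (sec (x (q + p.-1)) 0%R)), (- (u / eps))%R; split.
  by rewrite oppr_eq0 mulf_neq0 ?invr_neq0 ?geps_neq0.
move=> l; rewrite (comm_const_affine Ck XL XE) scalerA mulrN scaleNr.
by rewrite mulrA mulrAC.
Qed.

Let y_next : L k.+1 (y (q + p)) /\ (w k.+1 -> (lsum S (th k.+1) (y (q + p))).2 != 0%R).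
Proof.
have pE : (q + p).-1 = (q + p.-1)%N by lia.
rewrite gy_pred ?wqp ?pE; last by lia.
case: (boolP (w k.+1)) => wk1 /=; last by split=> //; exact: (subg1 (lcsp_subgroup S _)).
have YL : L k (y (q + p.-1)) by apply: yL; lia.
have XL : L k (x (q + p.-1)) by apply: xL; lia.
rewrite wq; [|lia..]; case: (boolP (w k)) => wk.
  (* Rank 2 persists: the sections of [Y] are constant, and the second coordinate of the sum is
     inherited from [y q]. *)
  set Y := y (q + p.-1) in YL *; have [Y0 Yk] := YL.
  have Yc l : eqm k.+1 (sec Y 0%R) (sec Y l) by apply: (eqm_coord Ck) => //; rewrite !y_last.
  have [RL RE] := lsum_comm c Ck1 Y0 Yk Yc; split=> // _; rewrite RE chib_c scale1r.
  have e := basis_expand Gk (Yk 0%R).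
  have lX := @lcsX T k (x k) (th k (sec Y 0%R)).1 (lcs_gx S k).
  have lY := @lcsX T k (y k) (th k (sec Y 0%R)).2 (lcs_gy S k).
  rewrite (coord_comm_eqml Ck1 _ (Yk 0%R) e) (coord_commMl Ck1) //.
  rewrite !(coord_commXl Ck1) ?lcs_gx ?lcs_gy //; [|exact: lcs_gy|exact: lcs_gx].
  rewrite !mulrn_Fp y_last.
  rewrite -(@gx_pred _ _ S k.+1) // (th_x Gk1).
  have yy : y k.+1 = [~ y k, c] by rewrite gy_pred // wk1 wk.
  rewrite -yy (basis_y Gk1) wk1 plane2D !plane2Z /= mulr0 add0r mulr1.
  by have [_ _ _ _] := inv; apply.
split; first by apply: lcspRS => //; exact: chi_b.
(* The rank rises from 1 to 2, and the new generator comes from the affine sections of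
   [x (q + p.-1)]. *)
move=> _; have [B0 [u [u0 XE]]] := x_affine.
have [|] := @switch _ _ S k (x (q + p.-1)) B0.1 u (ltnW k1) Gk Gk1 wk1 wk XL u0; last by [].
move=> l; rewrite XE scalerDl; congr (_ + _)%R.
apply: plane_line; have := basis_line Gk wk (XL.2 0%R); rewrite XE plane2D plane2Z /= mulr0 addr0.
by [].
Qed.

Let Lk1 : L k.+1 `<=` lcs (q + p).
Proof.
have [gl gL gs] := deep_gx k1 Gk Gk1 Lq.
have [yL' y2] := y_next.
apply: (lcsp_deep (isT : 1 < k.+1)%N Gk1 Gk1 gl gL _ _ (lcs_gy S _) yL' y2).
  by rewrite gs; exact: (oner_neq0 'F_p).
by rewrite gs.
Qed.

Let Lk_mem M : is_subgroup M -> lcs q.+1 `<=` M -> M (y q) -> L k `<=` M.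
Proof.
move=> sM sub My; have [u u0 /(_ c) [xcL xcE]] := xq.
have [_ _ _ _ y2] := inv.
apply: (lsum_generates k1 Ck Gk sM _ xcL _ _ _ yqL My y2).
- by move=> g t /Lq gg; apply: sub; exact: lcs_comm.
- by apply: sub; apply: lcs_comm; exact: lcs_gx.
- by rewrite xcE chib_c scale1r plane1Z /= mulr1.
- by rewrite xcE !plane2Z !mulr0.
Qed.

(** The constant sections of an element of [lcs q] are proportional to those of [x q]. Dividing by a
    power of [x q] leaves an element of [L k], which [Lk_mem] obtains from [y q]. *)
Let gens_q : gens S q.
Proof.
move=> M sM sub MA; have Mx : M (x q) by apply: MA; left.
have My : M (y q) by apply: MA; right.
have LM := Lk_mem sM sub My.
have [_ H2 [u u0 xE] _ _] := inv; move=> g /H2 [[g0 gn] [v gE]].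
have [[x0 xn] _] := H2 _ (lcs_gx S q).
pose h := (x q ^+ (v / u)%R)^-1 * g.
rewrite -(mulVKg (x q ^+ (v / u)%R) g); apply: subgM => //; first exact: subgX.
have xX0 : chi (x q ^+ (v / u)%R) = 0%R by rewrite chiX x0 mul0rn.
apply: LM; split=> [|l]; first by rewrite chiM chiV xX0 oppr0 add0r.
have lX : lcs n (sec (x q) l ^+ (v / u)%R) by exact: lcsX.
rewrite secM chiV xX0 oppr0 addr0 secV xX0 subr0 secX //.
apply: (eqm_coord Cn) => //; rewrite (coordX Cn) // xE gE mulrn_Fp.
by rewrite scalerA divfK.
Qed.

Let xy_lcs i : [set x i; y i] `<=` lcs i.
Proof. by move=> _ [->|->]; [exact: lcs_gx|exact: lcs_gy]. Qed.

Let gens_q1 : gens S q.+1.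
Proof.
apply: (gens_succ _ (@xy_lcs q) gens_q); first exact: ltnW.
move=> M sM sub Mx My s.
have Myb : M [~ y q, b].
  apply: sub; apply: (@lcs_le _ _ (q + p)); first by lia.
  by apply: Lk1; apply: lcspRS => //; exact: chi_b.
have Myc : M [~ y q, c] by rewrite -yS //; lia.
have Mxc : M [~ x q, c] by rewrite -xS.
have Lyq := lcs_gy S q.
move=> [->|->]; split=> //.
have sM' := subgroup_comml sM sub.
have LM' : L k `<=` [set g | lcs q g /\ forall h, M [~ g, h]].
  apply: (Lk_mem sM') => [g gg|].
    by split=> [|h]; [exact: lcs_leS|apply: sub; exact: lcs_comm].
  by split=> // h; exact: (gen_bc (S := S) (subgroup_commr sM sub Lyq)).
(* [[~ x q, b]] and [[~ x q, c]] have equal coordinate sums, because [chib] is 1 on both [b] and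
   [c]. *)
have [u u0 H] := xq; have [cL cE] := H c; have [bL bE] := H b.
apply: (lsum_mem k1 Ck sM _ cL bL _ Mxc) => [g t gL|].
  by have [_] := LM' g gL; apply.
by rewrite cE bE chib_c; apply: (congr1 (fun r => r *: _)%R); rewrite chib_b.
Qed.

Let gens_block i : (q <= i)%N -> (i < q + p)%N -> gens S i.
Proof.
move=> qi ip; rewrite -(subnKC qi) in ip *; move: (i - q)%N ip => j {qi i}.
elim: j => [|[|j] IH] jp; [by rewrite addn0; exact: gens_q|by rewrite addn1; exact: gens_q1|].
rewrite addnS; apply: (gens_succ _ (@xy_lcs _) (IH _)); [lia..|].
(* As [b] fixes the first level, commuting with it pushes the sections one term deeper and leaves
   the block. *)
have Lb g : L k g -> lcs (q + j.+1).+2 [~ g, b].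
  move=> gL; apply: (@lcs_le _ _ (q + p)); first by lia.
  by apply: Lk1; apply: lcspRS => //; exact: chi_b.
move=> M sM sub Mx My _ [->|->]; split.
- by apply: sub; apply: Lb; apply: xL; lia.
- by rewrite -xS //; lia.
- by apply: sub; apply: Lb; apply: yL; lia.
- by rewrite -yS //; lia.
Qed.

Let indep_last : forall u v : 'F_p,
  lcs (q + p) (x (q + p.-1) ^+ u * y (q + p.-1) ^+ v) -> u = 0%R /\ (w k -> v = 0%R).
Proof.
move=> u v /lcs_qp [_ [s sE]]; have [B0 [r [r0 XE]]] := x_affine.
have XL : L k (x (q + p.-1)) by apply: xL; lia.
have YL : L k (y (q + p.-1)) by apply: yL; lia.
have FE l : (u *: (B0 + (l * r) *: one) + v *: lsum S (th k) (y q) = s *: one)%R.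
  rewrite -(sE l) secM !secX ?chiX ?XL.1 ?YL.1 // mul0rn addr0 (coordM Ck); first last.
  - by apply: lcsX; exact: YL.2.
  - by apply: lcsX; exact: XL.2.
  rewrite !(coordX Ck); [|exact: YL.2|exact: XL.2].
  by rewrite XE y_last !mulrn_Fp.
have u0 : u = 0%R.
  by have := FE 1%R; rewrite -(FE 0%R) => /addIr; exact: affine_const_eq0 r0 (plane_one_neq0 p).
split=> // wk; have := FE 0%R; rewrite u0 scale0r add0r => /(congr1 (fun v : plane p => v.2)).
rewrite !plane2Z /= mulr0 => /eqP; rewrite mulf_eq0.
by have [_ _ _ _ /(_ wk) /negbTE ->] := inv; rewrite orbF => /eqP.
Qed.

Let indep_block j : (j < p)%N -> forall u v : 'F_p,
  lcs (q + (p.-1 - j)).+1 (x (q + (p.-1 - j)) ^+ u * y (q + (p.-1 - j)) ^+ v) ->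
  u = 0%R /\ (w k -> v = 0%R).
Proof.
elim: j => [|j IH] jp.
  rewrite subn0 (_ : (q + p.-1).+1 = (q + p)%N); last by lia.
  exact: indep_last.
have := IH (ltnW jp); have -> : (q + (p.-1 - j) = (q + (p.-1 - j.+1)).+1)%N by lia.
move=> H; apply: (indep_pred (S := S)); [lia|exact: lcs_gx|exact: lcs_gy|].
by rewrite -xS -?yS //; lia.
Qed.

Lemma good_block i : (step p k <= i < step p k.+1)%N -> good i.
Proof.
rewrite qp -/q => /andP[qi ip]; apply: goodP; apply: basis_exists.
- exact: p_pr S.
- by lia.
- exact: lcs_gx.
- exact: lcs_gy.
- exact: gens_block.
- by move=> g; apply: (lcs_exp S); lia.
- by move=> wi; rewrite gy1 //; lia.
rewrite wq //; have := @indep_block (p.-1 - (i - q)).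
by rewrite (_ : (q + (p.-1 - (p.-1 - (i - q))))%N = i); [apply|]; lia.
Qed.

Lemma invariant_succ : invariant S n.+1.
Proof.
have [yL' y2] := y_next.
by split; rewrite qp; [exact: Lk1|exact: lcs_qp|exact: x_last|exact: yL'|exact: y2].
Qed.

End InductiveStep.

(** * Consequences for the abstract group *)

Section Conclusions.
Variables (p : nat) (T : groupType) (S : ggs_group p T).
Local Notation a := (ga S).
Local Notation c := (gc S).
Local Notation e := (ev S).
Local Notation chi := (chi S).
Local Notation sec := (sec S).
Local Notation L := (lcsp S).
Local Notation iota := (giota S).
Local Notation eps := (geps S).
Local Notation delta := (gdelta S).
Local Notation x := (gx S).
Local Notation y := (gy S).
Local Notation th := (gth S).
Local Notation good := (good S).
Implicit Types (g h t : T) (k l m d : 'F_p) (n i j : nat).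

Let p3 : (2 < p)%N := p_gt2 S.

(** The inductive step at [k = j.+3] needs the factors up to [j.+4]; [step_gt] guarantees that they
    precede [step p j.+3]. *)
Lemma all_good_aux j : invariant S j.+2 /\ forall i, (0 < i < step p j.+3)%N -> good i.
Proof.
elim: j => [|j [inv G]].
  split=> [|i /andP[i0 i3]]; first exact: invariant2.
  have [ip|pi|->] := ltngtP i p; [|exact: good_mid|exact: good_p].
  case: i i0 ip {i3} => [//|[|i]] _ ip; first exact: good1.
  exact: good_small.
have sg := step_gt p3 (isT : 2 < j.+3)%N.
have [G1 G2 G3] : [/\ good j.+2, good j.+3 & good j.+4] by split; apply: G; lia.
split; first exact: (@invariant_succ _ _ S j.+1).
move=> i /andP[i0 i4]; have [i3|i3] := ltnP i (step p j.+3); first by apply: G; rewrite i0.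
by apply: (@good_block _ _ S j.+1) => //; rewrite i3.
Qed.

Lemma all_good n : (0 < n)%N -> good n.
Proof.
move=> n0; have [_] := all_good_aux n; apply; rewrite n0.
by have := step_gt p3 (isT : 2 < n.+3)%N; lia.
Qed.

Lemma lcsp_lcs n : (2 < n)%N -> L n `<=` lcs (step p n).
Proof. by case: n => [|[|[|n]]] // _; have [[]] := all_good_aux n. Qed.

Lemma lcs_lcsp n : (1 < n)%N -> lcs (step p n.+1) `<=` L n.
Proof.
case: n => [|[|n]] // _ g gg.
by have [[_ H _ _ _] _] := all_good_aux n; have [] := H g gg.
Qed.

Lemma lcsp_sub n : (1 < n)%N -> L n `<=` lcs n.
Proof.
rewrite leq_eqVlt => /orP[/eqP <-|n2] g gL.
  by apply: (lcs_le _ (lcsp2_lcs gL)); exact: ltnW.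
apply: (lcs_le _ (lcsp_lcs n2 gL)); have := step_gt p3 n2; lia.
Qed.

Lemma residually_trivial g : (forall n, lcs n g) -> g = 1.
Proof.
apply: (@self_similar_trivial _ _ S (fun g => forall n, lcs n g)) => {}g gg.
split=> [|l n]; first by have /(lcs2P S) [] := gg 2.
have [_ /(_ l)] := lcs_lcsp (isT : 1 < n.+2)%N (gg _).
by apply: lcs_le; rewrite leqW.
Qed.

Lemma th1_cXM (B : 'F_p) g : th 1 (c ^+ B * g) = (B *: th 1 c + th 1 g)%R.
Proof.
have C1 : coordinates 1 (th 1) := good1 S.
by rewrite (coordM C1 (lcs1 _) (lcs1 _)) (coordX C1 B (lcs1 c)) mulrn_Fp.
Qed.

(** Up to [lcs 2], the sections of [x p.-1] are the elements [c ^+ B * a ^+ (delta / eps)] with [B]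
    arbitrary; as [delta] is non-zero, these generate the group together with [lcs 2]. *)
Lemma section_lcs2_onto t : exists2 g, lcs 2 g & sec g 0%R = t.
Proof.
pose Q := [set t | exists2 g, lcs 2 g & sec g 0%R = t].
have sQ : is_subgroup Q.
  split=> [|_ _ [g gg <-] [h hh <-]|_ [g gg <-]].
  - by exists 1; rewrite ?sec1.
  - have [g0 _] := (lcs2P S g).1 gg.
    by exists (g * h); [exact: lcsM|rewrite secM g0 addr0].
  - have [g0 _] := (lcs2P S g).1 gg.
    by exists g^-1; [exact: lcsV|rewrite secV g0 subr0].
have Q2 h : lcs 2 h -> Q h.
  move=> hh; exists (iota 0%R h); last by rewrite sec_iota ?eqxx.
  by apply: (@lcsp_sub 2) => //; exact: lcsp_iota.
have Qm g h : eqm 2 g h -> Q g -> Q h.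
  by move=> e Qg; rewrite -(mulVKg g h); apply: (subgM sQ) => //; exact: Q2.
have [B0 E] := gx_pred_p_sec S.
have xQ l : Q (sec (x p.-1) l).
  exists (x p.-1 ^ (a ^+ (- l)%R)); last by rewrite sec_rot ?chi_gx // opprK add0r.
  by apply: lcs_conj; apply: (lcs_le _ (lcs_gx S p.-1)); lia.
have QB (B : 'F_p) : Q (c ^+ B * a ^+ (delta / eps)%R).
  apply: Qm (xQ ((B0 - B) * eps)%R); apply: (eqm_coord (good1 S)) => //.
  have EB : (B0 + (B0 - B) * eps * (- eps^-1))%R = B.
    by have := geps_neq0 S => e0; field.
  by rewrite (th1_cXM B (a ^+ (delta / eps)%R)) E EB.
have Qa : Q (a ^+ (delta / eps)%R).
  by have := QB 0%R; rewrite (_ : c ^+ (0%R : 'F_p) = 1) ?mul1g.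
have Qc : Q c.
  by have := QB 1%R; rewrite expF1 => H; apply: (subgMr sQ Qa H).
have Qa1 : Q a.
  have -> : a = (a ^+ (delta / eps)%R) ^+ ((delta / eps)^-1 : 'F_p)%R.
    by rewrite -(aXM S) divff ?mulf_neq0 ?invr_neq0 ?gdelta_neq0 ?geps_neq0.
  exact: subgX.
apply: (gen_ab S sQ Qa1).
by apply: (subgMl sQ (subgX eps sQ Qa1)); exact: Qc.
Qed.

Definition normalised (M : set T) := forall g h, M g -> M (g ^ h).

Lemma iota_conj l h t : lcs 2 h ->
  exists t', iota l (h ^ t) = iota 0%R h ^ t'.
Proof.
move=> hh; have [g g0 gt] := section_onto S t 0%R.
exists (g * a ^+ l); rewrite conjgM (iota_rot S l (lcs_conj t hh)); congr (_ ^ _).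
have hR : lcs 2 [~ h, t] by exact/lcs_leS/lcs_comm.
rewrite -[h ^ t](mulVKg h) -commgEl iotaM //.
by rewrite -gt -iotaR // commgEl mulVKg.
Qed.

Lemma lcsp_sub_normal M n : is_subgroup M -> normalised M -> (1 < n)%N ->
  (forall h, lcs n h -> M (iota 0%R h)) -> L n `<=` M.
Proof.
move=> sM nM n1 H g gL; rewrite (lcsp_prod n1 gL); apply: subg_prod => // l.
have [_ /(_ l) gl] := gL; rewrite (iota_rot S l); last exact: lcs_le gl.
by apply: nM; apply: H.
Qed.

Lemma iota_mem_subgroup M n : (1 < n)%N -> is_subgroup M ->
  is_subgroup [set h | lcs n h /\ M (iota 0%R h)].
Proof.
move=> n1 sM; split=> [|u v [u2 uM] [v2 vM]|u [u2 uM]].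
- by split; [exact: lcs_1|rewrite iota1; exact: subg1].
- split; first exact: lcsM.
  by rewrite iotaM; [exact: subgM|exact: lcs_le u2|exact: lcs_le v2].
- split; first exact: lcsV.
  by rewrite iotaV; [exact: subgV|exact: lcs_le u2].
Qed.

(** Lifting an arbitrary [t] to [lcs 2] by [section_lcs2_onto] shows that [P] contains [iota 0
    [~ g, t]] for [g] in [lcs n], hence all of [L n.+1], which contains [lcs N]. So [M] contains
    [L N]; the two applications of [step] in the bound reflect these two levels. *)
Lemma contains_lcs M n : is_subgroup M -> normalised M -> (1 < n)%N ->
  (forall g h, lcs n g -> lcs 2 h -> M (iota 0%R [~ g, h])) ->
  lcs (step p (step p n.+2).+1) `<=` M.
Proof.
move=> sM nM n1 H; pose N := step p n.+2.
have n2 : (2 < n.+2)%N by lia.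
have N1 : (1 < N)%N by have := step_gt p3 n2; rewrite /N; lia.
suff LM : L N `<=` M by move=> g /(lcs_lcsp N1) /LM.
pose P := [set h | lcs 2 h /\ M (iota 0%R h)].
have sP : is_subgroup P by exact: iota_mem_subgroup.
have nP : normalised P.
  move=> h t [h2 hM]; split; first exact: lcs_conj.
  by have [t' ->] := iota_conj 0%R t h2; exact: nM.
suff LP : L n.+1 `<=` P.
  apply: lcsp_sub_normal => // h hN; have [] // : P h.
  by apply: LP; apply: lcs_lcsp hN; exact: ltnW.
apply: lcsp_sub_normal => // h hn.
have [] // : [set h | lcs n h /\ P (iota 0%R h)] h.
apply: (lcs_min (n := n.-1) (iota_mem_subgroup n1 sP)); rewrite ?prednK ?(ltnW n1) //.
move=> g t gn; have [t' t'2 <-] := section_lcs2_onto t.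
have g2 := lcs_le n1 gn; have [t'0 _] := (lcs2P S t').1 t'2.
split; first exact/lcs_leS/lcs_comm.
rewrite -iotaR //; split; first exact/lcs_leS/lcs_commr.
by apply: H => //; apply: lcsp_sub => //; exact: lcsp_iota.
Qed.

(* Induction on the length of the shortest word moved by [g]: if [g] fixes the first
   level, descend to a section moving a shorter word. *)
Lemma normal_contains_lcs g : g <> 1 -> exists n, forall M : set T,
  is_subgroup M -> normalised M -> M g -> lcs n `<=` M.
Proof.
move=> /(@moves_neq1 _ _ S) [N]; elim: N g => [|N IH] g; first by move=> /(@moves0 _ _ S).
have R M u v : is_subgroup M -> normalised M -> M u -> M [~ u, v] /\ M [~ v, u].
  move=> sM nM Mu; have MR : M [~ u, v].
    by rewrite commgEl; apply: subgM => //; [exact: subgV|exact: nM].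
  by split=> //; rewrite -invgR; exact: subgV.
have [g0|g0] := eqVneq (chi g) 0%R; last first.
  move=> _; exists (step p (step p 4).+1) => M sM nM Mg.
  apply: contains_lcs => // h h' h2 h'2.
  have hV : lcs 2 h^-1 by exact: lcsV.
  (* Since [g] moves the letter 0, [u] has section [h] there; a commutator with an element supported
     at 0 discards its other sections. *)
  set u := [~ iota 0%R h^-1, g].
  have uM : M u by have [_] := R M g (iota 0%R h^-1) sM nM Mg.
  have [uh _] := R M u (iota 0%R h') sM nM uM.
  have u0 : chi u = 0%R by exact: chiR.
  have sec_u : sec u 0%R = h.
    rewrite secR ?chi_iota // !sec_iota // eqxx invgK sub0r oppr_eq0 (negbTE g0).
    by rewrite conj1g mulg1.
  have -> : iota 0%R [~ h, h'] = [~ u, iota 0%R h']; last by [].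
  by rewrite -[RHS]invgR iotaR // sec_u -iotaV ?invgR //; exact/lcs_leS/lcs_comm.
move=> /(@movesS _ _ S) [//|[l /IH [n0 H]]].
pose n := n0.+2; exists (step p (step p n.+2).+1) => M sM nM Mg.
apply: contains_lcs => // y h yn h2.
(* A normal subgroup that contains the section [sec g l], so the induction hypothesis applies to
   it. *)
pose Mg' := [set y | forall h, lcs 2 h -> M (iota 0%R [~ y, h])].
have i2 (u v : T) : lcs 2 v -> lcs 2 [~ u, v] by move=> v2; apply/lcs_leS/lcs_commr.
have iJ (u t : T) : lcs 2 u -> M (iota 0%R u) -> M (iota 0%R (u ^ t)).
  by move=> u2 uM; have [t' ->] := iota_conj 0%R t u2; exact: nM.
have sM' : is_subgroup Mg'.
  split=> [k k2|u v uM vM k k2|u uM k k2].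
  - by rewrite comm1g iota1; exact: subg1.
  - rewrite commMg (@iotaM _ _ S 0%R _ _ (lcs_conj v (i2 u k k2)) (i2 v k k2)).
    apply: (subgM sM); last exact: vM.
    by apply: iJ; [exact: i2|exact: uM].
  - have -> : [~ u^-1, k] = ([~ u, k]^-1) ^ u^-1 by rewrite /commg /conjg !gnorm.
    apply: iJ; first by apply: lcsV; exact: i2.
    by rewrite (@iotaV _ _ S 0%R _ (i2 u k k2)); apply: (subgV sM); exact: uM.
have nM' : normalised Mg'.
  move=> u t uM k k2; have -> : [~ u ^ t, k] = [~ u, k ^ t^-1] ^ t by rewrite conjRg conjgKV.
  by apply: iJ; [apply: i2; exact: lcs_conj|apply: uM; exact: lcs_conj].
suff : Mg' (sec g l).
  move=> gM; apply: (H Mg' sM' nM' gM) => //.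
  by apply: lcs_le yn; rewrite /n; lia.
move=> k k2; have [t' tE] : exists t', iota l [~ sec g l, k] = iota 0%R [~ sec g l, k] ^ t'.
  by have := iota_conj l 1 (i2 (sec g l) k k2); rewrite conjg1.
have : M (iota l [~ sec g l, k]).
  have [_] := R M g (iota l k) sM nM Mg; rewrite iotaR // => Mk.
  by rewrite -invgR iotaV; [exact: (subgV sM)|exact/lcs_leS/lcs_comm].
by rewrite tE => /(nM _ t'^-1); rewrite conjgK.
Qed.

Lemma normal_descent M i (A : set T) : is_subgroup M -> normalised M -> (0 < i)%N ->
  generates i A -> A `<=` M -> A `<=` lcs i -> forall n, lcs n `<=` M -> lcs i `<=` M.
Proof.
move=> sM nM i0 gA AM AL.
have R u v : M u -> M [~ u, v].
  by move=> Mu; rewrite commgEl; apply: subgM => //; [exact: subgV|exact: nM].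
have G r : generates (i + r) (M `&` lcs (i + r)).
  elim: r => [|r IH]; rewrite ?addn0 ?addnS => M2 sM2 sub MM2.
    by apply: gA => // u Au; apply: MM2; split; [exact: AM|exact: AL].
  apply: (generates_succ (@gen_bc _ _ S) _ IH _ sM2 sub) => [u []//||u [uM uL]].
    by rewrite ltn_addr.
  by split; apply: MM2; split; [exact: R|exact: lcs_comm|exact: R|exact: lcs_comm].
have D r : lcs (i + r) `<=` M -> lcs i `<=` M.
  elim: r => [|r IH]; rewrite ?addn0 // addnS => H; apply: IH.
  by apply: G => // u [].
move=> n nM'; apply: (D n) => g gg; apply: nM'; apply: lcs_le gg; exact: leq_addl.
Qed.

Lemma gx_neq1 n : (0 < n)%N -> x n <> 1.
Proof.
move=> n0 x1; have G := all_good n0; have := th_x G; rewrite x1 (coord1 G).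
by move=> /(congr1 (fun u : plane p => u.1)) /= /eqP; rewrite eq_sym oner_eq0.
Qed.

Lemma lcs_normal_closure n : (0 < n)%N ->
  lcs n = normal_closure (gen [set x n; y n]) [set: T].
Proof.
move=> n0; have G := all_good n0.
have nC : normalised (normal_closure (gen [set x n; y n]) [set: T]).
  move=> g h gN H [sH HH]; suff : [set g | H (g ^ h)] g by [].
  apply: gN; split=> [|_ [u uG [v _ <-]]].
    split=> [|u v /= Hu Hv|u /= Hu].
    - by rewrite /= conj1g; exact: subg1.
    - by rewrite conjMg; exact: subgM.
    - by rewrite conjVg; exact: subgV.
  by rewrite /= -conjgM; apply: HH; exists u => //; exists (v * h).
have sC := gen_subgroup [set g ^ h | g in gen [set x n; y n] & h in [set: T]].
apply/seteqP; split.
  have AC : [set x n; y n] `<=` normal_closure (gen [set x n; y n]) [set: T].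
    move=> u Au; apply: gen_sub; exists u; first exact: gen_sub.
    by exists 1; rewrite ?conjg1.
  have [m H] := normal_contains_lcs (gx_neq1 n0).
  apply: (normal_descent sC nC n0 (basis_generates G) AC _ (n := m)).
    by move=> _ [->|->]; [exact: lcs_gx|exact: lcs_gy].
  by apply: H => //; apply: AC; left.
apply: gen_min => // _ [u uG [v _ <-]]; apply: lcs_conj.
by apply: (gen_min _ _ uG) => // _ [->|->]; [exact: lcs_gx|exact: lcs_gy].
Qed.

Lemma lcs_set_mul n : (0 < n)%N ->
  lcs n = set_mul (gen [set x n; y n]) (lcs n.+1).
Proof.
move=> n0; have G := all_good n0; have sG := gen_subgroup [set x n; y n].
apply/seteqP; split=> [g gn|_ [u uG [v vn <-]]]; last first.
  apply: lcsM; last exact: lcs_leS.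
  by apply: (gen_min _ _ uG) => // _ [->|->]; [exact: lcs_gx|exact: lcs_gy].
exists (x n ^+ (th n g).1 * y n ^+ (th n g).2).
  by apply: (subgM sG); apply: (subgX _ sG); apply: gen_sub; [left|right].
exists ((x n ^+ (th n g).1 * y n ^+ (th n g).2)^-1 * g); last by rewrite mulVKg.
by apply: eqm_sym; exact: basis_expand G gn.
Qed.

End Conclusions.

(** * The GGS-group as an abstract group *)

Section SubgroupType.
Variables (p : nat) (e : 'rV['F_p]_(p.-1)).

Record ggs_type := GGSType { ggs_val : taut p; ggs_valP : GGS e ggs_val }.

Lemma ggs_val_inj : injective ggs_val.
Proof. by case=> g gP [h hP] /= gh; subst h; congr GGSType; exact: Prop_irrelevance. Qed.

HB.instance Definition _ := gen_eqMixin ggs_type.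
HB.instance Definition _ := gen_choiceMixin ggs_type.

Let GGS_subgroup : is_subgroup (GGS e) := gen_subgroup _.

Definition ggs_one := GGSType (subg1 GGS_subgroup).
Definition ggs_inv (g : ggs_type) := GGSType (subgV GGS_subgroup (ggs_valP g)).
Definition ggs_mul (g h : ggs_type) :=
  GGSType (subgM GGS_subgroup (ggs_valP g) (ggs_valP h)).

Lemma ggs_mulA : associative ggs_mul.
Proof. by move=> f g h; apply: ggs_val_inj; rewrite /= mulgA. Qed.
Lemma ggs_mul1 : left_id ggs_one ggs_mul.
Proof. by move=> f; apply: ggs_val_inj; rewrite /= mul1g. Qed.
Lemma ggs_mulr1 : right_id ggs_one ggs_mul.
Proof. by move=> f; apply: ggs_val_inj; rewrite /= mulg1. Qed.
Lemma ggs_mulV : left_inverse ggs_one ggs_inv ggs_mul.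
Proof. by move=> f; apply: ggs_val_inj; rewrite /= mulVg. Qed.
Lemma ggs_mulrV : right_inverse ggs_one ggs_inv ggs_mul.
Proof. by move=> f; apply: ggs_val_inj; rewrite /= mulgV. Qed.

HB.instance Definition _ := isGroup.Build ggs_type
  ggs_mulA ggs_mul1 ggs_mulr1 ggs_mulV ggs_mulrV.

Lemma ggs_valM g h : ggs_val (g * h) = ggs_val g * ggs_val h. Proof. by []. Qed.
Lemma ggs_valX g n : ggs_val (g ^+ n) = ggs_val g ^+ n.
Proof. by elim: n => [//|n IH]; rewrite !expgS ggs_valM IH. Qed.
Lemma GGS_a : GGS e (ggs_a p). Proof. by apply: gen_sub; left. Qed.
Lemma GGS_b : GGS e (ggs_b e). Proof. by apply: gen_sub; right. Qed.
Definition type_a := GGSType GGS_a.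
Definition type_b := GGSType GGS_b.

Lemma ggs_type_gen (H : set ggs_type) : is_subgroup H -> H type_a -> H type_b -> forall g, H g.
Proof.
move=> sH Ha Hb [g gP]; pose H' := [set t | exists tP : GGS e t, H (GGSType tP)].
have [gP' Hg] : H' g.
  apply: gP; split=> [|_ [->|->]]; [|by exists GGS_a|by exists GGS_b].
  split=> [|u v [uP Hu] [vP Hv]|u [uP Hu]].
  - by exists (ggs_valP 1); apply: subg1 sH.
  - by exists (ggs_valP (GGSType uP * GGSType vP)); apply: subgM sH Hu Hv.
  - by exists (ggs_valP (GGSType uP)^-1); apply: subgV sH Hu.
by rewrite (Prop_irrelevance gP gP').
Qed.

Hypothesis (pr : prime p).

(* Letter i of the alphabet sits at position i + 1 of 'F_p, so that the last
   letter, where b has section b, sits at 0. *)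
Definition letter (l : 'F_p) : 'I_p := cast_ord (Fp_cast pr) (l - 1)%R.

Lemma letter_val l : letter l = (l - 1)%R :> nat. Proof. by []. Qed.

Definition position (i : 'I_p) : 'F_p := (i.+1%:R)%R.

Lemma positionK : cancel position letter.
Proof.
move=> i; apply: val_inj; rewrite /= letter_val /position -natr1 addrK.
by rewrite (val_Fp_nat pr) modn_small.
Qed.

Lemma letterK : cancel letter position.
Proof. by move=> l; rewrite /position -natr1 letter_val natr_Zp subrK. Qed.

Lemma letter_nat (i : nat) : (i < p)%N -> letter (i.+1%:R)%R = i :> nat.
Proof. by move=> ip; rewrite letter_val -natr1 addrK (val_Fp_nat pr) modn_small. Qed.

Definition decomposes (g : taut p) (n : 'F_p) (s : 'F_p -> taut p) :=
  act g [::] = [::] /\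
  forall l v, act g (letter l :: v) = letter (l + n)%R :: act (s l) v.

Definition entry (l : 'F_p) : option 'I_p.-1 := insub (letter l : nat).

Lemma ggs_a_decomposes : decomposes (ggs_a p) 1%R (fun=> 1).
Proof.
split=> // l v /=; congr cons; apply: val_inj => /=.
rewrite -[LHS]/((letter l).+1 %% p)%N.
have -> : (l + 1 = (letter l).+2%:R)%R.
  by rewrite -[in LHS](letterK l) /position -[RHS]natr1.
have := ltn_ord (letter l); rewrite leq_eqVlt => /orP[/eqP E|lp].
  rewrite E modnn letter_val -natr1 addrK.
  by rewrite (val_Fp_nat pr) modnn.
by rewrite letter_nat // modn_small.
Qed.

Lemma ggs_b_decomposes : decomposes (ggs_b e) 0%R
  (fun l => if entry l is Some i then ggs_a p ^+ e 0%R i else ggs_b e).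
Proof. by split=> // l v; rewrite /= addr0 /entry; case: insub. Qed.

Lemma decomposes1 : decomposes 1 0%R (fun=> 1).
Proof. by split=> // l v; rewrite addr0. Qed.

Lemma decomposesM g h n k s t : decomposes g n s -> decomposes h k t ->
  decomposes (g * h) (n + k)%R (fun l => s l * t (l + n)%R).
Proof.
move=> [g0 gE] [h0 hE]; split=> [|l v]; first by rewrite -[LHS]/(act h (act g _)) g0.
by rewrite -[LHS]/(act h (act g _)) gE hE addrA.
Qed.

Lemma decomposesV g n s : decomposes g n s ->
  decomposes g^-1 (- n)%R (fun l => (s (l - n)%R)^-1).
Proof.
move=> [g0 gE]; split=> [|l v]; first by have := actK g [::]; rewrite g0.
have := gE (l - n)%R (act_inv (s (l - n)%R) v).
by rewrite subrK act_invK => <-; exact: actK.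
Qed.

Lemma decomposes_uniq g n k s t : decomposes g n s -> decomposes g k t -> n = k /\ s = t.
Proof.
move=> [_ gE] [_ gE']; split.
  have := gE 0%R [::]; rewrite gE' !add0r => /(congr1 (head (letter 0%R))) /=.
  by move=> /(can_inj letterK).
apply/funext => l; apply: taut_ext => v.
by have := gE l v; rewrite gE' => /(congr1 behead).
Qed.

Lemma type_b_decomposes : decomposes (ggs_val type_b) 0%R
  (fun l => ggs_val (if entry l is Some i then type_a ^+ e 0%R i else type_b)).
Proof.
rewrite (_ : (fun l => _) = (fun l => if entry l is Some i then ggs_a p ^+ e 0%R i else ggs_b e)).
  exact: ggs_b_decomposes.
by apply/funext => l /=; case: entry => // i; rewrite ggs_valX.
Qed.

Lemma ggs_decomposes (g : ggs_type) : exists ns : 'F_p * ('F_p -> ggs_type),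
  decomposes (ggs_val g) ns.1 (fun l => ggs_val (ns.2 l)).
Proof.
move: g; apply: ggs_type_gen.
- split=> [|g h [[n s] /= gE] [[k t] /= hE]|g [[n s] /= gE]].
  + by exists (0%R, fun=> 1); exact: decomposes1.
  + by exists ((n + k)%R, fun l => s l * t (l + n)%R); exact: decomposesM gE hE.
  + by exists ((- n)%R, fun l => (s (l - n)%R)^-1); exact: decomposesV gE.
- by exists (1%R, fun=> 1); exact: ggs_a_decomposes.
by exists (0%R, fun l => if entry l is Some i then type_a ^+ e 0%R i else type_b);
  exact: type_b_decomposes.
Qed.

Definition dec (g : ggs_type) := projT1 (cid (ggs_decomposes g)).
Definition ggs_chi g := (dec g).1.
Definition ggs_sec g := (dec g).2.

Lemma decP g : decomposes (ggs_val g) (ggs_chi g) (fun l => ggs_val (ggs_sec g l)).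
Proof. exact: projT2 (cid (ggs_decomposes g)). Qed.

Lemma dec_eq g n s : decomposes (ggs_val g) n (fun l => ggs_val (s l)) ->
  ggs_chi g = n /\ ggs_sec g = s.
Proof.
move=> /(decomposes_uniq (decP g)) [-> st]; split=> //; apply/funext => l.
by apply: ggs_val_inj; exact: (congr1 (fun f => f l) st).
Qed.

Definition ggs_ev (l : 'F_p) : 'F_p := if entry l is Some i then e 0%R i else 0%R.

Lemma entry0 : entry 0%R = None.
Proof.
rewrite /entry insubF //; apply/negP; rewrite ltn_predRL => H.
have := letterK 0%R; rewrite /position => /(congr1 (@nat_of_ord _)); rewrite (val_Fp_nat pr).
by rewrite modn_small.
Qed.

Lemma entryS (i : 'I_p.-1) : entry (i.+1%:R)%R = Some i.
Proof.
have ip : (i < p)%N by apply: leq_trans (ltn_ord i) (leq_pred p).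
by rewrite /entry letter_nat // valK.
Qed.

Lemma entry_neq0 l : l != 0%R -> exists i : 'I_p.-1, l = (i.+1%:R)%R :> 'F_p.
Proof.
move=> l0; have lp : (letter l < p.-1)%N.
  rewrite ltn_neqAle -ltnS prednK ?prime_gt0 // ltn_ord andbT.
  apply: contra l0 => /eqP E; rewrite -[l]letterK /position E prednK ?prime_gt0 //.
  by rewrite (pchar_Fp_0 pr).
by exists (Ordinal lp); rewrite /= -[LHS]letterK.
Qed.

Lemma sum_ord_pred (W : nmodType) n (G : nat -> W) : (0 < n)%N ->
  (\sum_(i < n) G i = G 0 + \sum_(i < n.-1) G i.+1)%R.
Proof. by case: n => // n _; rewrite big_ord_recl. Qed.

Lemma sum_letters (F : 'F_p -> 'F_p) : F 0%R = 0%R ->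
  (\sum_l F l = \sum_(i < p.-1) F i.+1%:R)%R.
Proof.
move=> F0; pose G (n : nat) := F (n%:R)%R.
have -> : (\sum_l F l = \sum_(l : 'F_p) G l)%R.
  by apply: eq_bigr => l _; rewrite /G natr_Zp.
by rewrite (sum_Fp pr) sum_ord_pred ?prime_gt0 // [G 0%N]F0 add0r.
Qed.

Hypotheses (p_odd : odd p) (eFG : FG_type e).

Lemma ggs_evS (i : 'I_p.-1) : ggs_ev (i.+1%:R)%R = e 0%R i.
Proof. by rewrite /ggs_ev entryS. Qed.

Lemma ggs_ev0 : ggs_ev 0%R = 0%R. Proof. by rewrite /ggs_ev entry0. Qed.

Lemma sum_ggs_ev : (\sum_l ggs_ev l)%R = eps e.
Proof.
rewrite sum_letters ?ggs_ev0 // /eps; apply: eq_bigr => i _; exact: ggs_evS.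
Qed.

Lemma sum_mul_ggs_ev : (\sum_l l * ggs_ev l)%R = delta e.
Proof.
rewrite (sum_letters (F := fun l => l * ggs_ev l)%R) ?mul0r // /delta.
by apply: eq_bigr => i _; rewrite ggs_evS.
Qed.

Lemma decM g h : ggs_chi (g * h) = (ggs_chi g + ggs_chi h)%R /\
  ggs_sec (g * h) = fun l => ggs_sec g l * ggs_sec h (l + ggs_chi g)%R.
Proof. by apply: dec_eq; exact: decomposesM (decP g) (decP h). Qed.

Lemma dec_a : ggs_chi type_a = 1%R /\ ggs_sec type_a = fun=> 1.
Proof. by apply: dec_eq; exact: ggs_a_decomposes. Qed.

Lemma dec_b : ggs_chi type_b = 0%R /\
  ggs_sec type_b = fun l => if entry l is Some i then type_a ^+ e 0%R i else type_b.
Proof. by apply: dec_eq; exact: type_b_decomposes. Qed.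

Definition ggs_moves (g : ggs_type) n := exists2 v, size v = n & act (ggs_val g) v <> v.

Definition ggs_structure : ggs_group p ggs_type.
Proof.
refine (@GGSGroup p ggs_type pr p_odd type_a type_b ggs_ev ggs_chi ggs_sec ggs_moves
  ggs_ev0 _ _ _ _ _ _ _ _ _ ggs_type_gen _ _ _).
- by rewrite sum_ggs_ev; case: eFG.
- by rewrite sum_mul_ggs_ev; case: eFG.
- by move=> g h; have [] := decM g h.
- by move=> g h l; have [_ ->] := decM g h.
- by have [] := dec_a.
- by move=> l; have [_ ->] := dec_a.
- by have [] := dec_b.
- by have [_ ->] := dec_b; rewrite entry0.
- by move=> l /entry_neq0 [i ->]; have [_ ->] := dec_b; rewrite ggs_evS entryS.
- by move=> g [[|//] _]; have [-> _] := decP g.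
- move=> g n [[|i v] //= [vn] gv]; have [_ gE] := decP g.
  move: gv; rewrite -[i]positionK gE => gv.
  have [g0|] := eqVneq (ggs_chi g) 0%R; last by move=> /eqP; left.
  right; exists (position i); exists v => // sv; apply: gv.
  by rewrite g0 addr0 sv.
- move=> g g1; apply: contrapT => H; apply: g1; apply: ggs_val_inj; apply: taut_ext => v.
  by apply: contrapT => gv; apply: H; exists (size v), v.
Defined.

End SubgroupType.

(** * Transfer to the group of tree automorphisms *)

Section Transfer.
Variables (T T' : groupType) (f : T -> T') (fM : forall x y, f (x * y) = f x * f y).
Implicit Types A B : set T.

Lemma morph1 : f 1 = 1.
Proof. by apply: (mulgI (f 1)); rewrite -fM !mulg1. Qed.
Lemma morphV x : f x^-1 = (f x)^-1.
Proof. by apply: (mulgI (f x)); rewrite -fM !mulgV morph1. Qed.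
Lemma morphJ x y : f (x ^ y) = f x ^ f y.
Proof. by rewrite !fM morphV. Qed.
Lemma morphR x y : f [~ x, y] = [~ f x, f y].
Proof. by rewrite fM morphV morphJ. Qed.

Lemma image_gen A : f @` gen A = gen (f @` A).
Proof.
apply/seteqP; split=> [_ [g gA <-]|].
  have : [set g | gen (f @` A) (f g)] g; last by [].
  apply: (gen_min _ _ gA) => [|h Ah]; last by apply: gen_sub; exists h.
  have sG := gen_subgroup (f @` A); split=> [|u v /= Hu Hv|u /= Hu] /=.
  - by rewrite morph1; exact: (subg1 sG).
  - by rewrite fM; exact: (subgM sG).
  - by rewrite morphV; exact: (subgV sG).
have sA := gen_subgroup A.
apply: gen_min => [|_ [g Ag <-]]; last by exists g => //; exact: gen_sub.
split=> [|_ _ [u uA <-] [v vA <-]|_ [u uA <-]].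
- by exists 1; [exact: (subg1 sA)|rewrite morph1].
- by exists (u * v); [exact: (subgM sA)|rewrite fM].
- by exists u^-1; [exact: (subgV sA)|rewrite morphV].
Qed.

Lemma image_op A B (op : T -> T -> T) (op' : T' -> T' -> T') :
  (forall u v, f (op u v) = op' (f u) (f v)) ->
  f @` [set op u v | u in A & v in B] = [set op' u v | u in f @` A & v in f @` B].
Proof.
move=> H; apply/seteqP; split=> [_ [_ [u Au [v Bv <-]] <-]|_ [_ [u Au <-] [_ [v Bv <-] <-]]].
  by rewrite H; exists (f u); [exists u|exists (f v); [exists v|]].
by exists (op u v); [exists u => //; exists v|rewrite H].
Qed.

Lemma image_gamma A n : f @` gamma A n = gamma (f @` A) n.
Proof.
case: n => [//|n]; elim: n => [//|n IH].
rewrite [gamma A _]/(commutator_subgroup (gamma A n.+1) A).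
rewrite [RHS]/(commutator_subgroup (gamma (f @` A) n.+1) (f @` A)) -IH.
rewrite image_gen; congr gen; apply: image_op => u v; exact: morphR.
Qed.

Lemma image_normal_closure A B : f @` normal_closure A B = normal_closure (f @` A) (f @` B).
Proof. by rewrite image_gen; congr gen; apply: image_op => u v; exact: morphJ. Qed.

Lemma image_set_mul A B : f @` set_mul A B = set_mul (f @` A) (f @` B).
Proof. by apply: image_op => u v; exact: fM. Qed.

Lemma image_comm_iter u c k : f (comm_iter u c k) = comm_iter (f u) (f c) k.
Proof.
elim: k => [//|k IH].
by rewrite /comm_iter !iterS morphR -/(comm_iter u c k) IH.
Qed.

End Transfer.

Lemma has_index_card (T : groupType) (H K : set T) (I : finType) (F : I -> T) n :
  is_subgroup K -> (forall i, H (F i)) ->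
  (forall h, H h -> exists i, K ((F i)^-1 * h)) ->
  (forall i j, K ((F i)^-1 * F j) -> i = j) -> #|I| = n -> has_index H K n.
Proof.
move=> sK HF cover Finj <-; rewrite /has_index.
pose C (i : 'I_#|I|) := [set F (enum_val i) * k | k in K].
have -> : [set [set h * k | k in K] | h in H] = C @` [set: 'I_#|I|].
  apply/seteqP; split=> [_ [h Hh <-]|_ [i _ <-]]; last by exists (F (enum_val i)).
  have [i Ki] := cover h Hh; exists (enum_rank i) => //; rewrite /C enum_rankK.
  apply/seteqP; split=> _ [k Kk <-].
    exists (((F i)^-1 * h)^-1 * k); first by apply: (subgM sK) => //; exact: (subgV sK).
    by rewrite !gnorm.
  exists ((F i)^-1 * h * k); first exact: (subgM sK).
  by rewrite !gnorm.
apply: card_eq_trans (inj_card_eq _) _; last by rewrite card_eq_sym; exact: card_II.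
move=> i j _ _ /seteqP [sub _].
have [k Kk E] := sub (F (enum_val i)) (ex_intro2 _ _ 1 (subg1 sK) (mulg1 _)).
apply: enum_val_inj; apply: esym; apply: Finj; rewrite -E mulKg //.
Qed.

Section Main.
Variables (p : nat) (e : 'rV['F_p]_(p.-1)) (pr : prime p) (po : odd p) (eFG : FG_type e).
Let S := ggs_structure pr po eFG.
Local Notation G := (GGS e).
Local Notation val := (@ggs_val p e).
Let p3 : (2 < p)%N := p_gt2 S.

Let valM : forall g h, val (g * h) = val g * val h. Proof. by []. Qed.

Lemma image_valT : val @` [set: ggs_type e] = G.
Proof.
apply/seteqP; split=> [_ [g _ <-]|g gG]; first exact: ggs_valP.
by exists (GGSType gG).
Qed.

Lemma gamma_image n : gamma G n = val @` lcs n.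
Proof. by rewrite -image_valT -(image_gamma valM). Qed.

Lemma gc_val : val (gc S) = ggs_c e.
Proof.
have epsE : geps S = eps e := sum_ggs_ev e pr.
by rewrite /gc valM ggs_valX epsE.
Qed.

Lemma gx_val i : val (gx S i) = ggs_x e i.
Proof. by rewrite /gx (image_comm_iter valM) gc_val. Qed.

Lemma gy_val m i : (ell p m <= i < rseq p m)%N -> val (gy S i) = ggs_y e (ell p m) i.
Proof.
case: m => [|m]; first by case: i => [|[|i]] //; rewrite /= ltnS => /andP[].
have wE j : (ell p m.+1 <= j < rseq p m.+1)%N -> twodim p j.
  by move=> H; apply/asboolP; exists m.+1.
have w0 := twodim_ell_pred p3 m; move: (ell_ge p3 m) wE w0.
move: (ell p m.+1) (rseq p m.+1) => u v pu wE w0 /andP[ui iv].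
have u1 : (1 < u)%N by lia.
rewrite /ggs_y ifN; last by apply/eqP => u2; rewrite u2 in u1.
elim: i iv ui => [|i IH] iv; first by lia.
rewrite leq_eqVlt => /orP[/eqP E|ui].
  have wi : twodim p i.+1 by apply: wE; lia.
  have wi' : twodim p i = false by apply: negbTE; rewrite E in w0.
  have -> : gy S i.+1 = [~ gx S i, gb S] by rewrite gy_pred ?wi ?wi' //; lia.
  by rewrite E subnn (morphR valM) gx_val.
have wi : twodim p i.+1 by apply: wE; lia.
have wi' : twodim p i by apply: wE; lia.
have -> : gy S i.+1 = [~ gy S i, gc S] by rewrite gy_pred ?wi ?wi' //; lia.
have -> : (i.+1 - u = (i - u).+1)%N by lia.
by rewrite (morphR valM) IH ?gc_val //; lia.
Qed.

Lemma gen_val g h : gen [set val g; val h] = val @` gen [set g; h].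
Proof. by rewrite (image_gen valM) image_setU !image_set1. Qed.

(** At indices of rank 1 the second generator [gy] is 1, so results on pairs cover the single
    generator. *)
Lemma gen1_val g : gen [set val g] = val @` gen [set g; 1].
Proof.
rewrite -gen_val; have sG := gen_subgroup [set val g].
apply/seteqP; split; apply: gen_min; try exact: gen_subgroup.
  by move=> _ ->; apply: gen_sub; left.
by move=> _ [->|->]; [exact: gen_sub|exact: (subg1 sG)].
Qed.

Lemma gamma_subgroup n : is_subgroup (gamma G n).
Proof.
rewrite gamma_image; have sL := @lcs_subgroup (ggs_type e) n.
split=> [|_ _ [g gL <-] [h hL <-]|_ [g gL <-]].
- by exists 1; first exact: lcs_1.
- by exists (g * h); first exact: lcsM.
- by exists g^-1; first exact: lcsV.
Qed.

Lemma gamma_val n g : gamma G n (val g) <-> lcs n g.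
Proof.
rewrite gamma_image; split; last by exists g.
by move=> [h hL /(@ggs_val_inj p e) <-].
Qed.

Lemma gamma_divl n g h : gamma G n ((val g)^-1 * val h) <-> eqm n g h.
Proof. by rewrite -(morphV valM) -valM; exact: gamma_val. Qed.

Lemma index_twodim n : (0 < n)%N -> twodim p n ->
  has_index (gamma G n) (gamma G n.+1) (p ^ 2)%N.
Proof.
move=> n0 wn; have B := all_good S n0.
pose F (u : 'F_p * 'F_p) := gx S n ^+ u.1 * gy S n ^+ u.2.
have FL u : lcs n (F u) by apply: lcsM; apply: lcsX; [exact: lcs_gx|exact: lcs_gy].
have thF u : gth S n (F u) = u.
  have [C lx ex ly ey _] := B; rewrite (coordM C) ?(coordX C) //; [|exact: lcsX..].
  by rewrite ex ey wn !mulrn_Fp (@plane_expand p u true).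
apply: (@has_index_card _ _ _ _ (fun u => val (F u))).
- exact: gamma_subgroup.
- by move=> u; apply/gamma_val.
- rewrite gamma_image => _ [g gn <-]; exists (gth S n g); apply/gamma_divl.
  by apply: (eqm_coord B) => //; rewrite thF.
- move=> u v /gamma_divl e1; rewrite -[u]thF -[v]thF; exact: (coord_eqm B (FL u) e1).
by rewrite card_prod card_Fp // -mulnn.
Qed.

Lemma index_onedim n : (0 < n)%N -> ~~ twodim p n ->
  has_index (gamma G n) (gamma G n.+1) p.
Proof.
move=> n0 wn; have B := all_good S n0.
pose F (u : 'F_p) := gx S n ^+ u.
have FL u : lcs n (F u) by apply: lcsX; exact: lcs_gx.
have thF u : gth S n (F u) = (u, 0)%R.
  have [C lx ex _ _ _] := B; rewrite (coordX C) // ex mulrn_Fp.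
  by rewrite [RHS]plane_line.
apply: (@has_index_card _ _ _ _ (fun u => val (F u))).
- exact: gamma_subgroup.
- by move=> u; apply/gamma_val.
- rewrite gamma_image => _ [g gn <-]; exists (gth S n g).1; apply/gamma_divl.
  apply: (eqm_coord B) => //; rewrite thF; apply: plane_eq => //=.
  by rewrite (basis_line B wn gn).
- move=> u v /gamma_divl e1; have := coord_eqm B (FL u) e1; rewrite !thF.
  by move=> /(congr1 (fun z : plane p => z.1)).
by rewrite card_Fp.
Qed.

Lemma gamma_set_mul n : (0 < n)%N ->
  gamma G n = set_mul (val @` gen [set gx S n; gy S n]) (gamma G n.+1).
Proof.
by move=> n0; rewrite !gamma_image -(image_set_mul valM) -(lcs_set_mul S n0).
Qed.

Lemma gamma_normal_closure n : (0 < n)%N ->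
  gamma G n = normal_closure (val @` gen [set gx S n; gy S n]) G.
Proof.
move=> n0; rewrite gamma_image (lcs_normal_closure S n0).
by rewrite (image_normal_closure valM) image_valT.
Qed.

Lemma GGS_residually_nilpotent : residually_nilpotent G.
Proof.
apply/seteqP; split=> [g gG|_ -> n _]; last exact: (subg1 (gamma_subgroup n)).
have [h _ hg] : (val @` lcs 1) g by rewrite -gamma_image; exact: gG.
rewrite -hg in gG *; rewrite (residually_trivial S (g := h)) // => n.
by apply: (lcs_le (leqnSn n)); apply/gamma_val; apply: gG.
Qed.

End Main.

Theorem theoremA (p : nat) (e : 'rV['F_p]_(p.-1)) :
  prime p -> odd p -> e != 0%R -> FG_type e ->
  [/\ forall m i : nat, (ell p m <= i < rseq p m)%N ->
        [/\ has_index (gamma (GGS e) i) (gamma (GGS e) i.+1) (p ^ 2)%N,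
            gamma (GGS e) i =
              set_mul (gen [set ggs_x e i; ggs_y e (ell p m) i])
                      (gamma (GGS e) i.+1)
          & gamma (GGS e) i =
              normal_closure (gen [set ggs_x e i; ggs_y e (ell p m) i])
                             (GGS e)],
      forall m i : nat, (rseq p m <= i < ell p m.+1)%N ->
        [/\ has_index (gamma (GGS e) i) (gamma (GGS e) i.+1) p,
            gamma (GGS e) i =
              set_mul (gen [set ggs_x e i]) (gamma (GGS e) i.+1)
          & gamma (GGS e) i =
              normal_closure (gen [set ggs_x e i]) (GGS e)]
    & has_lower_central_width p (GGS e) 2].
Proof.
move=> pr po _ eFG; have p3 := p_gt2 (ggs_structure pr po eFG); split.
- move=> m i H; have w : twodim p i by apply/asboolP; exists m.
  have i0 : (0 < i)%N.
    by case: m H {w} => [|m]; [case/andP|move=> /andP[+ _]; have := ell_ge p3 m; lia].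
  rewrite -(gx_val pr po eFG) -(gy_val pr po eFG H) gen_val.
  by split; [exact: index_twodim|exact: gamma_set_mul|exact: gamma_normal_closure].
- move=> m i H; have w := twodim_gap p3 H.
  have i1 : (1 < i)%N.
    by case: m H {w} => [|m]; [case/andP|move=> /andP[+ _]; have := rseq_gt p3 m; lia].
  have i0 := ltnW i1; rewrite -(gx_val pr po eFG) gen1_val -(gy1 (ggs_structure pr po eFG) i1 w).
  by split; [exact: index_onedim|exact: gamma_set_mul|exact: gamma_normal_closure].
split; first exact: GGS_residually_nilpotent.
(* The truth value plus one is the rank, 1 or 2; the maximum is attained at [i = 1]. *)
exists (fun i => (twodim p i).+1); split=> [i i0|i _|].
- case: (boolP (twodim p i)) => w; first exact: index_twodim.
  by rewrite expn1; exact: index_onedim.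
- by case: twodim.
by exists 1%N; rewrite ?twodim1.
Qed.
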